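(* Let $M$ be an (irreversible) deterministic Turing machine. Consider a computation of $M$ on an input $x$ that uses time $T$ (number of steps) and space $S$ (number of tape squares). Then for every integer parameter $k$ with $0 \le k \le \log T$, freely chosen, this computation can be simulated by a reversible Turing machine, which may know $T$, $S$ and $k$ in advance, in time $$T' = 3^k\, 2^{O(T/2^k)}\, S$$ and space $$S' = S\,(1+O(k)).$$ Here the constants implied by the $O$-notation depend only on $M$; they do not depend on $x$, $T$, $S$ or $k$.
   Context: Logarithms are to base 2. Expressions containing $O(\cdot)$ are read as upper bounds. Turing machines are given by quadruples of two types. A read/write quadruple $(p,a,b,q)$ causes the machine in state $p$ scanning symbol $a$ to write symbol $b$ and enter state $q$. A move quadruple $(p,\ast,\sigma,q)$ with $\sigma\in\{-1,+1\}$ causes the machine in state $p$ to move its head by $\sigma$ squares and enter state $q$, regardless of the scanned symbol. Two quadruples overlap in domain if they cause the machine in the same state and scanning the same symbol to perform different actions. A machine is deterministic if no two of its quadruples overlap in domain. Two quadruples overlap in range if they enter the same state, unless both are read/write quadruples that write different symbols. A reversible Turing machine is a deterministic Turing machine no two of whose quadruples overlap in range; thus every configuration has at most one predecessor as well as at most one successor. A $k$-tape reversible machine uses $(2k+2)$-tuples that select, separately for each tape, a read/write or a move on that tape; any two tuples can be restricted to some single tape on which they do not overlap in range. Reversible simulation of an irreversible computation: if $M$ on input $x$ halts with output $f(x)$, a reversible machine simulates this computation if, started with $x$ and otherwise blank work tapes, it halts with output $\langle x, f(x)\rangle$ and otherwise blank work tapes. The simulating machine may have several tapes and a larger (finite)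 tape alphabet than $M$; its number of tapes, states and symbols depends only on $M$. Its space is the number of tape squares used. The simulated machine works on a tape section of $S$ squares delimited by end markers which it does not cross. *)

(* Defs.v *)
From HB Require Import structures.
From mathcomp Require Import all_boot all_order all_algebra.
From mathcomp Require Import reals exp.

Set Implicit Arguments.
Unset Strict Implicit.
Unset Printing Implicit Defensive.

Import Order.TTheory GRing.Theory Num.Theory.

Local Open Scope ring_scope.

(* What a tuple does on one tape: [inl (a, b)] reads a and writes b,
   [inr d] moves the head by -1 (d = false) or +1 (d = true) whatever is
   scanned. *)
Notation action A := ((A * A) + bool)%type.

Definition shift (d : bool) : int := if d then 1 else -1.

(* With n = 1 the rules are quadruples.  As states and symbols range over
   finite types, a rule set is automatically finite. *)
Record machine (n : nat) : Type := Machine {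
  state : finType;
  symbol : finType;
  blank : symbol;
  start : state;
  rules : {set state * {ffun 'I_n -> action symbol} * state} }.

Section Machines.
Variables (n : nat) (M : machine n).

Definition rule : Type := (state M * {ffun 'I_n -> action (symbol M)} * state M)%type.
Definition source (r : rule) : state M := r.1.1.
Definition act (r : rule) (i : 'I_n) : action (symbol M) := r.1.2 i.
Definition target (r : rule) : state M := r.2.

(* Overlap of the restrictions of two distinct rules to tape i. *)
Definition overlap_domain (i : 'I_n) (r s : rule) : bool :=
  (source r == source s) &&
  match act r i, act s i with
  | inl (a, _), inl (a', _) => a == a'
  | _, _ => true
  end.

Definition overlap_range (i : 'I_n) (r s : rule) : bool :=
  (target r == target s) &&
  match act r i, act s i with
  | inl (_, b), inl (_, b') => b == b'
  | _, _ => true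
  end.

Definition deterministic : Prop :=
  forall r s : rule, r \in rules M -> s \in rules M -> r != s ->
    exists i, ~~ overlap_domain i r s.

Definition reversible : Prop :=
  deterministic /\
  forall r s : rule, r \in rules M -> s \in rules M -> r != s ->
    exists i, ~~ overlap_range i r s.

Definition read_only (i : 'I_n) : Prop :=
  forall r : rule, r \in rules M ->
    match act r i with inl (a, b) => a = b | inr _ => True end.

Record config : Type := Config {
  cstate : state M;
  chead : 'I_n -> int;
  ctape : 'I_n -> int -> symbol M }.

Definition applicable (r : rule) (c : config) : bool :=
  (source r == cstate c) &&
  [forall i, match act r i with
             | inl (a, _) => ctape c i (chead c i) == a
             | inr _ => true
             end].

Definition apply_rule (r : rule) (c : config) : config :=
  Config (target r)
    (fun i => match act r i with
              | inl _ => chead c i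
              | inr d => chead c i + shift d
              end)
    (fun i z => match act r i with
                | inl (_, b) => if z == chead c i then b else ctape c i z
                | inr _ => ctape c i z
                end).

Definition step (c d : config) : Prop :=
  exists r : rule, [/\ r \in rules M, applicable r c & d = apply_rule r c].

Definition halted (c : config) : Prop := forall d, ~ step c d.

(* c 0, ..., c T is a computation of T steps that ends in a halting
   configuration; the values c t for t > T are irrelevant. *)
Definition halting_run (c : nat -> config) (T : nat) : Prop :=
  (forall t, (t < T)%N -> step (c t) (c t.+1)) /\ halted (c T).

(* A tape is untouched if its head rests on one blank square throughout. *)
Definition touched (c : nat -> config) (T : nat) (i : 'I_n) : bool :=
  has (fun t => (chead (c t) i != chead (c 0%N) i)
                || (ctape (c t) i (chead (c t) i) != blank M)) (iota 0 T.+1).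

End Machines.

(* The tape with w on squares 0, ..., size w - 1. *)
Definition word_tape (A : Type) (b : A) (w : seq A) (z : int) : A :=
  if z is Posz j then nth b w j else b.

Definition init1 (M : machine 1) (x : seq (symbol M)) : config M :=
  Config (start M) (fun=> 0) (fun=> word_tape (blank M) x).

(* The section of S squares lo, ..., lo + S - 1, delimited by the squares
   lo - 1 and lo + S. *)
Definition in_section (lo : int) (S : nat) (z : int) : bool :=
  (lo <= z) && (z < lo + S%:Z).

Definition delimiter (lo : int) (S : nat) (z : int) : bool :=
  (z == lo - 1) || (z == lo + S%:Z).

(* Binary expansion, least significant bit first. *)
Definition bits (m : nat) : seq bool :=
  [seq odd (m %/ 2 ^ i)%N | i <- iota 0 (trunc_log 2 m).+1].

(* T, S and k in binary, separated by None. *)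
Definition param_word (T S k : nat) : seq (option bool) :=
  map Some (bits T) ++ None :: map Some (bits S) ++ None :: map Some (bits k).

(* What the simulating machine must be able to denote by single symbols.  A
   symbol of a pair of words <x, y> is a pair of symbols. *)
Inductive io_symbol (A : Type) : Type :=
  | Single of A
  | Pair of A & A
  | EndMark of bool
  | Param of option bool.
Arguments EndMark {A}.
Arguments Param {A}.

Section Simulation.
Variables (A : Type) (m : nat) (N : machine m.+2).
Variable enc : io_symbol A -> symbol N.

Definition main_tape : 'I_m.+2 := ord0.
Definition param_tape : 'I_m.+2 := ord_max.

(* Contents of all tapes of N: w in the delimited section of the main tape, the
   parameters on the parameter tape, and blanks everywhere else. *)
Definition layout (lo : int) (T S k : nat) (w : int -> io_symbol A)
    (i : 'I_m.+2) (z : int) : symbol N :=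
  if i == main_tape then
    if z == lo - 1 then enc (EndMark false)
    else if z == lo + S%:Z then enc (EndMark true)
    else if in_section lo S z then enc (w z)
    else blank N
  else if i == param_tape then
    word_tape (blank N) [seq enc (Param p) | p <- param_word T S k] z
  else blank N.

Definition init_sim (lo : int) (T S k : nat) (w : int -> io_symbol A) : config N :=
  Config (start N) (fun=> 0) (layout lo T S k w).

(* Squares used by the run d 0, ..., d T': the section of the main tape,
   together with every square that is visited on a touched tape.  As for the
   simulated machine, the two delimiters are not counted; neither is the
   read-only parameter tape. *)
Definition squares_used (lo : int) (S : nat) (d : nat -> config N) (T' : nat)
    : seq ('I_m.+2 * int) :=
  undup
    ([seq (main_tape, lo + j%:Z) | j <- iota 0 S] ++
     [seq u <- [seq (i, chead (d t) i) | i <- enum 'I_m.+2, t <- iota 0 T'.+1]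
        | [&& u.1 != param_tape, touched d T' u.1
            & ~~ ((u.1 == main_tape) && delimiter lo S u.2)]]).

End Simulation.

Definition log2 (R : realType) (x : R) : R := ln x / ln 2.

(* Main.v *)
(* A structured language of partial injections, in which a branch is recognizable
   from its result and a loop from its entry, has an evident inverse for each
   program, and compiles to reversible machines.

   A segment of d steps is simulated without a history, following Lange, McKenzie
   and Tapp. Give level 0 to the current configuration and level l + 1 to the
   successor of a configuration of level l. The predecessors of depth at most d of
   the configuration Z of level d form a tree of bounded degree, and a move of the
   Euler tour of this tree only depends on the configuration at hand, its level, and
   the rule that is tried: it is injective. Started at the current configuration,
   the tour reaches the end of Z in time 2^O(d) S; then Z is added (as in a
   toggle) to a second slot, and the tour is undone. The level takes a counter
   with one digit of constant size per square, which suffices because T is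
   less than the number 2^O(S) of configurations.

   With d of the order of T / 2^k, this is the base level of Bennett's recursion: to
   toggle the configuration 2^n d steps ahead, toggle the one halfway, toggle the
   final one from there, and toggle the halfway one again. Three recursive calls at
   each of k levels give the factor 3^k, and each level keeps one frame of O(S)
   squares on a stack tape. A control tape with one square per level stands for the
   return addresses; it is built from k by a reversible setup, that is undone
   once the output has been copied. *)

Require Import Defs.
From mathcomp Require Import all_boot all_order all_algebra.
From mathcomp Require Import reals exp.
From mathcomp Require Import boolp zify.

Set Implicit Arguments.
Unset Strict Implicit.
Unset Printing Implicit Defensive.

Import Order.TTheory GRing.Theory Num.Theory.

Local Open Scope ring_scope.

(** Three requirements shape the construction. For [k = 0] the factor [1 + cs * k] leaves exactly
    [S] squares, with no additive constant: the stack and control tapes must then stay untouched, so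
    the setup tests [k] on the read-only parameter tape and calls the base level directly. Next, a
    reversible loop must tell its first entry from all later ones. For the tour this means never
    coming back to its starting state; it holds because the tour is deterministic and reaches a
    state without successor, which leaves no room for a cycle. Finally, the section must end with
    pairs in place of letters and nothing else changed. The setup therefore looks only at the first
    component of an input symbol, so that the very same program can be undone once the pairs are
    written. A segment is as long as the largest number with a certain count of digits. That count
    is computed from the number of bits of [T] and from [k], and a run that ends inside a segment is
    recognized by the halting of [M]. *)

Notation tape A := (int * (int -> A))%type.

Definition upd (A : Type) (t : int -> A) (h : int) (a : A) (z : int) : A :=
  if z == h then a else t z.

Lemma upd_id (A : Type) (t : int -> A) h : upd t h (t h) = t.
Proof. by apply: funext => z; rewrite /upd; case: eqP => [->|]. Qed.

Lemma upd_upd (A : Type) (t : int -> A) h a b : upd (upd t h a) h b = upd t h b.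
Proof. by apply: funext => z; rewrite /upd; case: eqP. Qed.

(** * Structured reversible programs *)

Section Language.
Variables (n : nat) (Sy Rg : finType) (ro : 'I_n).

Definition test := Rg -> ('I_n -> Sy) -> bool.

(* [Rw i f g] relates v to w when f v = w and g w = v: whatever f and g are,
   this is a partial injection, whose inverse is [Rw i g f].
   [Loop e p x q] runs p, (q, p)*, entering with e true and leaving as soon as x
   is true; e must be false each time q ends. [If c p q c'] must end with c'
   true if it takes the branch p, and false otherwise. *)
Inductive prog :=
  | Rw of 'I_n & (Rg * Sy -> Rg * Sy) & (Rg * Sy -> Rg * Sy)
  | Mv of 'I_n & (Rg -> option bool)
  | Seq of prog & prog
  | If of test & prog & prog & test
  | Loop of test & prog & test & prog.

Fixpoint undo (p : prog) : prog :=
  match p with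
  | Rw i f g => Rw i g f
  | Mv i d => Mv i (fun r => omap negb (d r))
  | Seq p q => Seq (undo q) (undo p)
  | If c p q c' => If c' (undo p) (undo q) c
  | Loop e p x q => Loop x (undo p) e (undo q)
  end.

Record store := Store { rg : Rg; tps : 'I_n -> tape Sy }.

Definition scan (s : store) (i : 'I_n) : Sy := (tps s i).2 (tps s i).1.
Definition holds (c : test) (s : store) : bool := c (rg s) (scan s).
Definition set_tape (s : store) (i : 'I_n) (r : Rg) (t : tape Sy) : store :=
  Store r (fun j => if j == i then t else tps s j).

Section Exec.
Variable J : 'I_n -> tape Sy -> Prop.

(** Parametrized by arbitrary relations, so that [exec] can use it in a structural recursion on
    programs. The 2 pays for the two guarded transitions of an iteration. *)
Inductive chain (P Q : store -> store -> nat -> Prop) (e x : test) : store -> store -> nat -> Prop :=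
  | Chain1 s s' b : P s s' b -> chain P Q e x s s' b
  | ChainS s s1 s2 s' b1 b2 b3 b :
      P s s1 b1 -> ~~ holds x s1 -> Q s1 s2 b2 -> ~~ holds e s2 ->
      chain P Q e x s2 s' b3 -> (b1 + b2 + b3 + 2 <= b)%N -> chain P Q e x s s' b.

(* A big-step semantics in at most b machine steps, on which J holds of all
   tapes all the time. *)
Fixpoint exec (p : prog) (s s' : store) (b : nat) {struct p} : Prop :=
  match p with
  | Rw i f g => (0 < b)%N /\ exists r a,
      [/\ f (rg s, scan s i) = (r, a), g (r, a) = (rg s, scan s i),
          i = ro -> a = scan s i,
          s' = set_tape s i r ((tps s i).1, upd (tps s i).2 (tps s i).1 a)
        & J i (tps s i) /\ J i (tps s' i)]
  | Mv i d => [/\ (0 < b)%N,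
          s' = set_tape s i (rg s)
                 (if d (rg s) is Some e then (tps s i).1 + shift e else (tps s i).1, (tps s i).2)
        & J i (tps s i) /\ J i (tps s' i)]
  | Seq p q => exists s1 b1 b2, [/\ exec p s s1 b1, exec q s1 s' b2 & (b1 + b2 < b)%N]
  | If c p q c' => exists b1, (b1 + 2 <= b)%N /\
       if holds c s then exec p s s' b1 /\ holds c' s' else exec q s s' b1 /\ ~~ holds c' s'
  | Loop e p x q => exists b1,
     [/\ (b1 + 2 <= b)%N, holds e s, chain (exec p) (exec q) e x s s' b1 & holds x s']
  end.

Lemma exec_le p s s' b b' : exec p s s' b -> (b <= b')%N -> exec p s s' b'.
Proof.
case: p => [i f g|i d|p q|c p q c'|e p x q] /=.
- by case=> b0 H le; split=> //; apply: leq_trans le.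
- by case=> b0 ? ? le; split=> //; apply: leq_trans le.
- by case=> s1 [b1 [b2 [? ? ?]]] le; exists s1, b1, b2; split=> //; apply: leq_trans le.
- by case=> b1 [? ?] le; exists b1; split=> //; apply: leq_trans le.
- by case=> b1 [? ? ? ?] le; exists b1; split=> //; apply: leq_trans le.
Qed.

(** Reading a chain backwards meets its last iteration first, so the reversal has to add iterations
    at the far end. *)
Lemma chain_rcons P Q e x s s1 s2 s' b1 b2 b3 :
  chain P Q e x s s1 b1 -> ~~ holds x s1 -> Q s1 s2 b2 -> ~~ holds e s2 ->
  P s2 s' b3 -> chain P Q e x s s' (b1 + b2 + b3 + 2)%N.
Proof.
move=> C; elim: C s2 s' b2 b3 => {s s1 b1} [s s1 b1 Pss1|s s0 s0' s1 a1 a2 a3 a P1 x0 Q1 e0 _ IH le] s2 s' b2 b3 x1 Q2 e1 P2.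
  by apply: (ChainS (b1 := b1) (b3 := b3) Pss1 x1 Q2 e1 (Chain1 _ _ _ P2)) => //; lia.
by apply: (ChainS P1 x0 Q1 e0 (IH _ _ _ _ x1 Q2 e1 P2)); lia.
Qed.

(** The two tests exchange roles: [x] false before each repetition and [e] false after it are mirror
    conditions. *)
Lemma chain_undo (P Q P' Q' : store -> store -> nat -> Prop) e x s s' b :
  (forall s s' b, P s s' b -> P' s' s b) -> (forall s s' b, Q s s' b -> Q' s' s b) ->
  chain P Q e x s s' b -> exists2 b', (b' <= b)%N & chain P' Q' x e s' s b'.
Proof.
move=> PP QQ; elim=> {s s' b} [s s' b /PP ?|s s1 s2 s' b1 b2 b3 b /PP P1 x1 /QQ Q1 e2 _ [b' le' C] le].
  by exists b => //; constructor.
by exists (b' + b2 + b1 + 2)%N; [lia|apply: (chain_rcons C e2 Q1)].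
Qed.

(** Every clause of [exec] demands as much of the final store as of the initial one: [g] inverts
    [f], [c'] decides the branch backwards, and [J] is required on both sides. Uncomputation thus
    needs no separate proof and takes the same time. *)
Lemma exec_undo p s s' b : exec p s s' b -> exec (undo p) s' s b.
Proof.
elim: p s s' b => [i f g|i d|p IHp q IHq|c p IHp q IHq c'|e p IHp x q IHq] s s' b /=.
- case=> b0 [r [a [fE gE roE -> [J1 J2]]]]; split=> //.
  exists (rg s), (scan s i); rewrite /set_tape /scan /= !eqxx /=.
  have uE : upd (tps s i).2 (tps s i).1 a (tps s i).1 = a by rewrite /upd eqxx.
  split; rewrite ?uE //; first by move=> /roE ->.
  - case: s {J1 J2 roE fE gE uE} => r0 T /=; congr Store; apply: funext => j.
    by case: eqP => [->|//]; rewrite upd_upd upd_id; case: (T i).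
  - by split; [move: J2; rewrite /set_tape /= eqxx|case: (tps s i) J1].
- case=> b0 -> [J1 J2]; split=> //.
    case: s {J1 J2} => r0 T; rewrite /set_tape /= !eqxx; congr Store; apply: funext => j.
    case: eqP => [->|//].
    case: (d r0) => [e|] /=; last by case: (T i).
    by case: e; rewrite /= ?addrK ?subrK; case: (T i).
- by case=> s1 [b1 [b2 [/IHp Hp /IHq Hq le]]]; exists s1, b2, b1; split=> //; lia.
- case=> b1 [le H]; exists b1; split=> //; move: H.
  by case: ifPn => [cs [/IHp ? ->]|cs [/IHq ? /negbTE ->]].
- by case=> b1 [le es C xs]; have [b2 le2 C'] := chain_undo IHp IHq C; exists b2; split=> //; lia.
Qed.

End Exec.

(** * Compilation of programs to reversible rule sets *)

Inductive instr := IRw of 'I_n & (Rg * Sy -> Rg * Sy) & (Rg * Sy -> Rg * Sy)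
  | IMv of 'I_n & (Rg -> option bool) | IGuard of test.

Fixpoint point (p : prog) : finType :=
  match p with
  | Rw _ _ _ | Mv _ _ => bool
  | Seq p q => (point p + point q)%type
  | If _ p q _ | Loop _ p _ q => (bool + (point p + point q))%type
  end.

Fixpoint entry (p : prog) : point p :=
  match p with
  | Rw _ _ _ | Mv _ _ => false
  | Seq p q => inl (entry p)
  | If _ p q _ | Loop _ p _ q => inl false
  end.

Fixpoint exit (p : prog) : point p :=
  match p with
  | Rw _ _ _ | Mv _ _ => true
  | Seq p q => inr (exit q)
  | If _ p q _ | Loop _ p _ q => inl true
  end.

Definition ontrue (T : Type) (b : bool) (x : T) : option T := if b then Some x else None.
Definition tneg (c : test) : test := fun r v => ~~ c r v.

Fixpoint edge (p : prog) : point p -> point p -> option instr :=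
  match p return point p -> point p -> option instr with
  | Rw i f g => fun x y => ontrue (~~ x && y) (IRw i f g)
  | Mv i d => fun x y => ontrue (~~ x && y) (IMv i d)
  | Seq p q => fun x y =>
      match x, y with
      | inl x, inl y => edge x y
      | inr x, inr y => edge x y
      | inl x, inr y => ontrue ((x == exit p) && (y == entry q)) (IGuard (fun _ _ => true))
      | inr _, inl _ => None
      end
  | If c p q c' => fun x y =>
      match x, y with
      | inr (inl x), inr (inl y) => edge x y
      | inr (inr x), inr (inr y) => edge x y
      | inl false, inr (inl y) => ontrue (y == entry p) (IGuard c)
      | inl false, inr (inr y) => ontrue (y == entry q) (IGuard (tneg c))
      | inr (inl x), inl true => ontrue (x == exit p) (IGuard c')
      | inr (inr x), inl true => ontrue (x == exit q) (IGuard (tneg c'))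
      | _, _ => None
      end
  | Loop e p x q => fun a b =>
      match a, b with
      | inr (inl a), inr (inl b) => edge a b
      | inr (inr a), inr (inr b) => edge a b
      | inl false, inr (inl b) => ontrue (b == entry p) (IGuard e)
      | inr (inr a), inr (inl b) => ontrue ((a == exit q) && (b == entry p)) (IGuard (tneg e))
      | inr (inl a), inl true => ontrue (a == exit p) (IGuard x)
      | inr (inl a), inr (inr b) => ontrue ((a == exit p) && (b == entry q)) (IGuard (tneg x))
      | _, _ => None
      end
  end.

(** Jumps into a program come only from the enclosing construct. With its mirror [edge_exit], this
    rules out clashes between inner edges and the edges that glue programs together. *)
Lemma edge_entry p y : edge y (entry p) = None.
Proof.
elim: p y => [i f g|i d|p IHp q IHq|c p IHp q IHq c'|e p IHp x q IHq] //=.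
- by case.
- by case.
- by case.
- by case=> [[]|[]].
- by case=> [[]|[]].
Qed.

Lemma edge_exit p y : edge (exit p) y = None.
Proof.
elim: p y => [i f g|i d|p IHp q IHq|c p IHp q IHq c'|e p IHp x q IHq] //=.
by case.
Qed.

Definition disjoint (a a' : instr) : Prop :=
  match a, a' with
  | IGuard c, IGuard c' => forall r v, ~~ (c r v && c' r v)
  | _, _ => False
  end.

(** Only tests create points with two outgoing edges, and their two guards are complementary. *)
Lemma edge_det p x y y' a a' :
  edge x y = Some a -> edge x y' = Some a' -> y = y' :> point p \/ disjoint a a'.
Proof.
elim: p x y y' a a' => [i f g|i d|p IHp q IHq|c p IHp q IHq c'|e p IHp x q IHq] /=.
- by case=> [] [] [] //= *; left.
- by case=> [] [] [] //= *; left.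
- case=> x [] y [] y' a a' //=.
  + by move=> E1 E2; case: (IHp _ _ _ _ _ E1 E2) => [->|]; [left|right].
  + by move=> E1; case: eqP => // xE; rewrite xE edge_exit in E1.
  + by case: eqP => // xE _; rewrite xE edge_exit.
  + by case: eqP => //= _; case: eqP => // -> _; case: eqP => // -> _; left.
  + by move=> E1 E2; case: (IHq _ _ _ _ _ E1 E2) => [->|]; [left|right].
- case=> [[]|[] x] [[]|[] y] [[]|[] y'] a a' //=.
  + by case: eqP => // -> _; case: eqP => // -> _; left.
  + by case: eqP => // -> [<-]; case: eqP => // -> [<-]; right=> r v; rewrite /tneg andbN.
  + by case: eqP => // -> [<-]; case: eqP => // -> [<-]; right=> r v; rewrite /tneg andNb.
  + by case: eqP => // -> _; case: eqP => // -> _; left.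
  + by left.
  + by case: eqP => // -> _; rewrite edge_exit.
  + by move=> E1; case: eqP => // xE; rewrite xE edge_exit in E1.
  + by move=> E1 E2; case: (IHp _ _ _ _ _ E1 E2) => [->|]; [left|right].
  + by left.
  + by case: eqP => // -> _; rewrite edge_exit.
  + by move=> E1; case: eqP => // xE; rewrite xE edge_exit in E1.
  + by move=> E1 E2; case: (IHq _ _ _ _ _ E1 E2) => [->|]; [left|right].
- case=> [[]|[] a] [[]|[] b] [[]|[] b'] u u' //=.
  + by case: eqP => // -> _; case: eqP => // -> _; left.
  + by left.
  + by case: eqP => // -> _; rewrite edge_exit.
  + by case: eqP => // _ [<-] /=; case: eqP => //= _ [<-]; right=> r v; rewrite /tneg andbN.
  + by move=> E1; case: eqP => // xE; rewrite xE edge_exit in E1.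
  + by move=> E1 E2; case: (IHp _ _ _ _ _ E1 E2) => [->|]; [left|right].
  + by move=> E1; case: eqP => // xE; rewrite xE edge_exit in E1.
  + by case: eqP => //= _; case: eqP => // _ [<-] [<-]; right=> r v; rewrite /tneg andNb.
  + by case: eqP => // -> _; rewrite edge_exit.
  + by case: eqP => // _; case: eqP => //= -> _; case: eqP => //= -> _; left.
  + by case: eqP => // _; case: eqP => //= -> _; case: eqP => //= -> _; left.
  + by case: eqP => // -> _; rewrite edge_exit.
  + by move=> E1; case: eqP => // xE; rewrite xE edge_exit in E1.
  + by move=> E1 E2; case: (IHq _ _ _ _ _ E1 E2) => [->|]; [left|right].
Qed.

(** Two edges meet only at the end of a conditional and at the start of a loop body; there the
    assertion [c'] or the entry test [e] separates them. This is the purpose of the second test of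
    [If] and of the first test of [Loop]. *)
Lemma edge_codet p x x' y a a' :
  edge x y = Some a -> edge x' y = Some a' -> x = x' :> point p \/ disjoint a a'.
Proof.
elim: p x x' y a a' => [i f g|i d|p IHp q IHq|c p IHp q IHq c'|e p IHp x q IHq] /=.
- by case=> [] [] [] //= *; left.
- by case=> [] [] [] //= *; left.
- case=> x [] x' [] y a a' //=.
  + by move=> E1 E2; case: (IHp _ _ _ _ _ E1 E2) => [->|]; [left|right].
  + by case: eqP => // -> _; case: eqP => // -> _; left.
  + by case: (y =P _) => [->|]; rewrite ?andbF ?edge_entry.
  + by case: (y =P _) => [->|]; rewrite ?andbF ?edge_entry.
  + by move=> E1 E2; case: (IHq _ _ _ _ _ E1 E2) => [->|]; [left|right].
- case=> [[]|[] x] [[]|[] x'] [[]|[] y] a a' //=.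
  + by left.
  + by left.
  + by case: eqP => // -> _; rewrite edge_entry.
  + by case: eqP => // -> _; rewrite edge_entry.
  + by case: (y =P _) => // ->; rewrite edge_entry.
  + by case: eqP => // -> _; case: eqP => // -> _; left.
  + by move=> E1 E2; case: (IHp _ _ _ _ _ E1 E2) => [->|]; [left|right].
  + by case: eqP => // _ [<-]; case: eqP => // _ [<-]; right=> r v; rewrite /tneg andbN.
  + by case: (y =P _) => // ->; rewrite edge_entry.
  + by case: eqP => // _ [<-]; case: eqP => // _ [<-]; right=> r v; rewrite /tneg andNb.
  + by case: eqP => // -> _; case: eqP => // -> _; left.
  + by move=> E1 E2; case: (IHq _ _ _ _ _ E1 E2) => [->|]; [left|right].
- case=> [[]|[] a] [[]|[] a'] [[]|[] b] u u' //=.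
  + by left.
  + by case: eqP => // -> _; rewrite edge_entry.
  + by case: (b =P _) => [_ [<-]|//]; case: eqP => //= _ [<-]; right=> r v; rewrite /tneg andbN.
  + by case: (b =P _) => // ->; rewrite edge_entry.
  + by case: eqP => // -> _; case: eqP => // -> _; left.
  + by move=> E1 E2; case: (IHp _ _ _ _ _ E1 E2) => [->|]; [left|right].
  + by case: eqP => //= ->; case: eqP => //= _ _; case: eqP => //= -> _; left.
  + by case: (b =P _) => [->|]; rewrite ?andbF ?edge_entry.
  + by case: (b =P _) => [->|]; rewrite ?andbF ?edge_entry.
  + by case: (b =P _) => [_|]; rewrite ?andbF //; case: eqP => //= _ [<-] [<-]; right=> r v; rewrite /tneg andNb.
  + by case: (b =P _) => [->|]; rewrite ?andbF ?edge_entry.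
  + by case: (b =P _) => [->|]; rewrite ?andbF ?edge_entry.
  + by case: eqP => //= -> _; case: eqP => //= -> _; left.
  + by move=> E1 E2; case: (IHq _ _ _ _ _ E1 E2) => [->|]; [left|right].
Qed.

(** A rule has no idle action, so a tape that stays put rewrites the symbol it reads; hence one rule
    per vector [v] of scanned symbols. A rewrite is retained only where [g] undoes [f], which makes
    arbitrary [f] and [g] harmless. *)
Definition instr_rel (a : instr) (r : Rg) (c : {ffun 'I_n -> action Sy}) (r' : Rg) : bool :=
  match a with
  | IRw i f g => [exists v : {ffun 'I_n -> Sy}, let w := f (r, v i) in
      [&& g w == (r, v i), w.1 == r', (i == ro) ==> (w.2 == v i)
        & c == [ffun j => inl (v j, if j == i then w.2 else v j)]]]
  | IMv i d => (r' == r) && [exists v : {ffun 'I_n -> Sy},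
      c == [ffun j => if (if j == i then d r else None) is Some e then inr e
                      else inl (v j, v j)]]
  | IGuard t => (r' == r) && [exists v : {ffun 'I_n -> Sy},
      t r v && (c == [ffun j => inl (v j, v j)])]
  end.

Definition same_reads (c1 c2 : {ffun 'I_n -> action Sy}) : Prop :=
  forall i, match c1 i, c2 i with inl (x, _), inl (x', _) => x == x' | _, _ => true end.

Definition same_writes (c1 c2 : {ffun 'I_n -> action Sy}) : Prop :=
  forall i, match c1 i, c2 i with inl (_, x), inl (_, x') => x == x' | _, _ => true end.

Lemma instr_rel_det a r c1 c2 r1 r2 : instr_rel a r c1 r1 -> instr_rel a r c2 r2 ->
  same_reads c1 c2 ->
  (c1, r1) = (c2, r2).
Proof.
case: a => [i f g|i d|t] /=.
- case/existsP=> v /and4P[/eqP gv /eqP <- _ /eqP ->] /existsP[v' /and4P[/eqP gv' /eqP <- _ /eqP ->]] H.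
  suff -> : v = v' by [].
  by apply/ffunP => j; move: (H j); rewrite !ffunE => /eqP.
- case/andP=> /eqP -> /existsP[v /eqP ->] /andP[/eqP -> /existsP[v' /eqP ->]] H.
  congr pair; apply/ffunP => j; move: (H j); rewrite !ffunE.
  by case: (if _ then _ else _) => [//|/eqP ->].
- case/andP=> /eqP -> /existsP[v /andP[_ /eqP ->]] /andP[/eqP -> /existsP[v' /andP[_ /eqP ->]]] H.
  suff -> : v = v' by [].
  by apply/ffunP => j; move: (H j); rewrite !ffunE => /eqP.
Qed.

Lemma instr_rel_codet a r c1 c2 r1 r2 : instr_rel a r1 c1 r -> instr_rel a r2 c2 r ->
  same_writes c1 c2 ->
  (c1, r1) = (c2, r2).
Proof.
case: a => [i f g|i d|t] /=.
- case/existsP=> v /and4P[/eqP gv /eqP wv _ /eqP ->] /existsP[v' /and4P[/eqP gv' /eqP wv' _ /eqP ->]] H.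
  have ww : f (r1, v i) = f (r2, v' i).
    rewrite [LHS]surjective_pairing [RHS]surjective_pairing wv wv'; congr pair.
    by move: (H i); rewrite !ffunE eqxx => /eqP.
  have [rr vv] : (r1, v i) = (r2, v' i) by rewrite -gv -gv' ww.
  suff -> : v = v' by rewrite rr.
  apply/ffunP => j; move: (H j); rewrite !ffunE; case: (j =P i) => [->//|_ /eqP//].
- case/andP=> /eqP <- /existsP[v /eqP ->] /andP[/eqP <- /existsP[v' /eqP ->]] H.
  congr pair; apply/ffunP => j; move: (H j); rewrite !ffunE.
  by case: (if _ then _ else _) => [//|/eqP ->].
- case/andP=> /eqP <- /existsP[v /andP[_ /eqP ->]] /andP[/eqP <- /existsP[v' /andP[_ /eqP ->]]] H.
  suff -> : v = v' by [].
  by apply/ffunP => j; move: (H j); rewrite !ffunE => /eqP.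
Qed.

Definition compile (sb : Sy) (r0 : Rg) (p : prog) : machine n :=
  @Machine n (point p * Rg)%type Sy sb (entry p, r0)
    [set u | if edge u.1.1.1 u.2.1 is Some a then instr_rel a u.1.1.2 u.1.2 u.2.2 else false].

Lemma compile_reversible sb r0 p : reversible (compile sb r0 p).
Proof.
split=> -[[[x r] c] [y r']] [[[x1 r1] c1] [y1 r1']]; rewrite !inE /=;
  case E: (edge x y) => [a|//] A; case E1: (edge x1 y1) => [a1|//] A1 ne;
  apply/existsP; rewrite -[X in is_true X]negbK negb_exists;
  apply: contra ne => /forallP H.
(* Here [ro] merely names some tape: sources can be compared only through the overlap on a
   particular tape. *)
- have /andP[/eqP[xx rr] _] := negbNE (H ro); subst x1 r1.
  have {}H : same_reads c c1.
    by move=> i; have /andP[_] := negbNE (H i); rewrite /act /=; case: (c i) (c1 i) => [[? ?]|?] [[? ?]|?].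
  have [yy|] := edge_det E E1.
    subst y1; rewrite E in E1; case: E1 => aa; subst a1.
    by case: (instr_rel_det A A1 H) => -> ->.
  case: a a1 A A1 {E E1} => // c0 [] //= c0'.
  case/andP=> /eqP -> /existsP[v /andP[cv /eqP ve]] /andP[/eqP -> /existsP[v' /andP[cv' /eqP ve']]] D.
  have vv : v = v'.
    by apply/ffunP => j; move: (H j); rewrite ve ve' !ffunE => /eqP.
  by have := D r v; rewrite cv vv cv'.
- have /andP[/eqP[xx rr] _] := negbNE (H ro); subst y1 r1'.
  have {}H : same_writes c c1.
    by move=> i; have /andP[_] := negbNE (H i); rewrite /act /=; case: (c i) (c1 i) => [[? ?]|?] [[? ?]|?].
  have [yy|] := edge_codet E E1.
    subst x1; rewrite E in E1; case: E1 => aa; subst a1.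
    by case: (instr_rel_codet A A1 H) => -> ->.
  case: a a1 A A1 {E E1} => // c0 [] //= c0'.
  case/andP=> /eqP <- /existsP[v /andP[cv /eqP ve]] /andP[/eqP <- /existsP[v' /andP[cv' /eqP ve']]] D.
  have vv : v = v'.
    by apply/ffunP => j; move: (H j); rewrite ve ve' !ffunE => /eqP.
  by have := D r' v; rewrite cv vv cv'.
Qed.

Lemma compile_read_only sb r0 p : @read_only n (compile sb r0 p) ro.
Proof.
move=> -[[[x r] c] [y r']]; rewrite inE /=; case: edge => [[i f g|i d|t]|//] /=.
- case/existsP=> v /and4P[_ _ /implyP H /eqP ->]; rewrite /act /= ffunE.
  by case: (ro =P i) => [ri|//]; move: H; rewrite -ri eqxx => /(_ isT)/eqP ->.
- by case/andP=> _ /existsP[v /eqP ->]; rewrite /act /= ffunE; case: (if _ then _ else _).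
- by case/andP=> _ /existsP[v /andP[_ /eqP ->]]; rewrite /act /= ffunE.
Qed.

(** * Executions as runs of the compiled machine *)

Section Runs.
Variable J : 'I_n -> tape Sy -> Prop.

Definition sem (a : instr) (s s' : store) : Prop :=
  match a with
  | IRw i f g => exec J (Rw i f g) s s' 1
  | IMv i d => exec J (Mv i d) s s' 1
  | IGuard c => s' = s /\ holds c s
  end.

Inductive grun (p : prog) : nat -> point p -> store -> point p -> store -> Prop :=
  | GNil x s : grun 0 x s x s
  | GCons x y z s s1 s2 a t :
      edge x y = Some a -> sem a s s1 -> grun t y s1 z s2 -> grun t.+1 x s z s2.

Lemma grun1 p a x y s s' : edge x y = Some a -> sem a s s' -> @grun p 1 x s y s'.
Proof. by move=> E S; apply: (GCons E S); constructor. Qed.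

Lemma grun_cat p t t' x y z s s1 s2 :
  @grun p t x s y s1 -> grun t' y s1 z s2 -> grun (t + t') x s z s2.
Proof. by elim=> // x0 y0 z0 s0 s3 s4 a t0 E S _ IH /IH; exact: GCons E S. Qed.

Lemma grun_lift p P (h : point p -> point P) t x y s s' :
  (forall x y, edge (h x) (h y) = edge x y) ->
  grun t x s y s' -> grun t (h x) s (h y) s'.
Proof.
move=> hE; elim=> [*|x0 y0 z0 s0 s1 s2 a t0 E S _ IH]; first exact: GNil.
by apply: (GCons _ S IH); rewrite hE.
Qed.

Lemma exec_grun p s s' b : exec J p s s' b ->
  exists2 t, (t <= b)%N & grun t (entry p) s (exit p) s'.
Proof.
elim: p s s' b => [i f g|i d|p IHp q IHq|c p IHp q IHq c'|e p IHp x q IHq] s s' b.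
- case=> b0 H; exists 1%N => //; exact: (@grun1 (Rw i f g) (IRw i f g) false true).
- case=> b0 H1 H2; exists 1%N => //; exact: (@grun1 (Mv i d) (IMv i d) false true).
- case=> s1 [b1 [b2 [/IHp[t1 l1 R1] /IHq[t2 l2 R2] le]]].
  exists (t1 + (1 + t2))%N; first by lia.
  apply: grun_cat (grun_lift (P := Seq p q) (h := inl) _ R1) _ => //.
  apply: grun_cat (grun_lift (P := Seq p q) (h := inr) _ R2) => //.
  by apply: (grun1 (a := IGuard (fun _ _ => true))) => //=; rewrite !eqxx.
- case=> b1 [le]; case: ifPn => [cs [/IHp[t l R] cs']|cs [/IHq[t l R] cs']].
    exists (1 + (t + 1))%N; first by lia.
    apply: (@grun_cat (If c p q c') _ _ _ (inr (inl (entry p)))).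
      by apply: (grun1 (a := IGuard c)) => //=; rewrite eqxx.
    apply: grun_cat (grun_lift (P := If c p q c') (h := fun u => inr (inl u)) _ R) _ => //.
    by apply: (grun1 (a := IGuard c')) => //=; rewrite eqxx.
  exists (1 + (t + 1))%N; first by lia.
  apply: (@grun_cat (If c p q c') _ _ _ (inr (inr (entry q)))).
    by apply: (grun1 (a := IGuard (tneg c))) => //=; rewrite eqxx.
  apply: grun_cat (grun_lift (P := If c p q c') (h := fun u => inr (inr u)) _ R) _ => //.
  by apply: (grun1 (a := IGuard (tneg c'))) => //=; rewrite eqxx.
- case=> b1 [le es C xs].
  set P := Loop e p x q.
  have [t l R] : exists2 t, (t <= b1)%N &
      @grun P t (inr (inl (entry p))) s (inr (inl (exit p))) s'.
    elim: C {es le xs b} => {s s' b1} [s s' b1 /IHp[t l R]|s s1 s2 s' b1 b2 b3 b /IHp[t1 l1 R1] x1 /IHq[t2 l2 R2] e2 _ [t3 l3 R3] le].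
      by exists t => //; apply: (grun_lift (P := P) (h := fun u => inr (inl u))) R.
    exists (t1 + (1 + (t2 + (1 + t3))))%N; first by lia.
    apply: grun_cat (grun_lift (P := P) (h := fun u => inr (inl u)) _ R1) _ => //.
    apply: (@grun_cat P _ _ _ (inr (inr (entry q)))).
      by apply: (grun1 (a := IGuard (tneg x))) => //=; rewrite !eqxx.
    apply: grun_cat (grun_lift (P := P) (h := fun u => inr (inr u)) _ R2) _ => //.
    apply: (@grun_cat P _ _ _ (inr (inl (entry p)))) R3.
    by apply: (grun1 (a := IGuard (tneg e))) => //=; rewrite !eqxx.
  exists (1 + (t + 1))%N; first by lia.
  apply: (@grun_cat P _ _ _ (inr (inl (entry p)))).
    by apply: (grun1 (a := IGuard e)) => //=; rewrite eqxx.
  apply: grun_cat R _.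
  by apply: (grun1 (a := IGuard x)) => //=; rewrite eqxx.
Qed.

Definition conf sb r0 p (x : point p) (s : store) : config (compile sb r0 p) :=
  @Config n (compile sb r0 p) (x, rg s) (fun i => (tps s i).1) (fun i => (tps s i).2).

Lemma step_compile sb r0 p x y a s s' : edge x y = Some a -> sem a s s' ->
  step (conf sb r0 x s) (@conf sb r0 p y s').
Proof.
pose v : {ffun 'I_n -> Sy} := [ffun i => scan s i].
have scanE : scan s = v by apply: funext => i; rewrite ffunE.
move=> E; case: a E => [i f g|i d|t] E /=.
- case=> _ [r [a [fE gE roE -> _]]].
  exists ((x, rg s), [ffun j => inl (v j, if j == i then a else v j)], (y, r)); split.
  + rewrite inE /= E /=; apply/existsP; exists v; rewrite scanE in fE gE roE.
    by rewrite fE gE /= !eqxx /=; apply/andP; split=> //; apply/implyP => /eqP/roE ->.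
  + rewrite /applicable /source /= eqxx /=; apply/forallP => j.
    by rewrite /act /= !ffunE.
  + rewrite /apply_rule /conf /target /=; congr Config; apply: funext => j; rewrite /act /= ffunE.
      by case: (j =P i) => [->|].
    case: (j =P i) => [->|_]; apply: funext => z //=; case: eqP => // ->.
    by rewrite ffunE.
- case=> _ -> _.
  exists ((x, rg s), [ffun j => if (if j == i then d (rg s) else None) is Some e then inr e else inl (v j, v j)], (y, rg s)); split.
  + by rewrite inE /= E /= eqxx; apply/existsP; exists v.
  + rewrite /applicable /source /= eqxx /=; apply/forallP => j.
    by rewrite /act /= !ffunE; case: (if _ then _ else _).
  + rewrite /apply_rule /conf /target /=; congr Config; apply: funext => j; rewrite /act /= ffunE.
      by case: (j =P i) => [->|] //; case: (d (rg s)).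
    case: (j =P i) => [->|_] /=.
      case: (d (rg s)) => //=; apply: funext => z; case: eqP => // ->; by rewrite ffunE.
    apply: funext => z; case: eqP => // ->; by rewrite ffunE.
- case=> -> ts.
  exists ((x, rg s), [ffun j => inl (v j, v j)], (y, rg s)); split.
  + rewrite inE /= E /= eqxx; apply/existsP; exists v; rewrite eqxx andbT.
    by rewrite -scanE.
  + rewrite /applicable /source /= eqxx /=; apply/forallP => j.
    by rewrite /act /= !ffunE.
  + rewrite /apply_rule /conf /target /=; congr Config; apply: funext => j; rewrite /act /= ffunE //.
    apply: funext => z; case: eqP => // ->; by rewrite ffunE.
Qed.

Lemma sem_J a s s' : sem a s s' -> (forall i, J i (tps s i)) -> forall i, J i (tps s' i).
Proof.
case: a => [i f g|i d|t] /=; last by case=> ->.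
  case=> _ [r [a [_ _ _ -> [_]]]] /=; rewrite eqxx => J2 H j.
  by case: eqP => [->|].
case=> _ -> [_] /=; rewrite eqxx => J2 H j.
by case: eqP => [->|].
Qed.

Lemma exec_compile sb r0 p s s' b :
  rg s = r0 -> (forall i, J i (tps s i)) -> exec J p s s' b ->
  exists t (c : nat -> config (compile sb r0 p)),
    [/\ (t <= b)%N, c 0%N = conf sb r0 (entry p) s, c t = conf sb r0 (exit p) s',
        halting_run c t
      & forall j i, (j <= t)%N -> J i (chead (c j) i, ctape (c j) i)].
Proof.
move=> sr Js /exec_grun[t le R]; exists t.
suff [c [c0 ct cs Jc]] : exists c : nat -> config (compile sb r0 p),
    [/\ c 0%N = conf sb r0 (entry p) s, c t = conf sb r0 (exit p) s',
     forall j, (j < t)%N -> step (c j) (c j.+1) &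
     forall j i, (j <= t)%N -> J i (chead (c j) i, ctape (c j) i)].
  exists c; split=> //; split=> // d; rewrite ct => -[u [uM uA _]].
  (* No edge leaves the exit point, so the last configuration halts. *)
  move: uM uA; rewrite inE /applicable /= => uM /andP[/eqP su _].
  by move: uM; rewrite [u.1.1]su /= edge_exit.
move: R Js; move: (entry p) (exit p) => x y R {sr le}.
elim: R => {x y s s' t} [x s|x y z s s1 s2 a t E S _ IH] Js.
  exists (fun _ => conf sb r0 x s); split=> // j i _ /=.
  by move: (Js i); case: (tps s i).
have [c [c0 ct cs Jc]] := IH (sem_J S Js).
exists (fun j => if j is j'.+1 then c j' else conf sb r0 x s); split=> //.
  by case=> [_|j]; [rewrite c0; exact: step_compile E S|exact: cs].
case=> [i _|j i]; last exact: Jc.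
by move: (Js i) => /=; case: (tps s i).
Qed.

End Runs.
End Language.

Arguments Mv {n Sy Rg}.
Arguments Rw {n Sy Rg}.
Arguments If {n Sy Rg}.
Arguments Loop {n Sy Rg}.
Arguments exec : simpl never.
Arguments undo : simpl never.

(** * Programs on four tapes *)

Definition sel (T : Type) (a b c d : T) (i : 'I_4) : T :=
  match val i with 0%N => a | 1%N => b | 2%N => c | _ => d end.

(* The main tape, the stack, the control tape and the parameters. *)
Definition tm : 'I_4 := ord0.
Definition ts : 'I_4 := @Ordinal 4 1 isT.
Definition tc : 'I_4 := @Ordinal 4 2 isT.
Definition tp : 'I_4 := ord_max.

Lemma sel_set (T : Type) (a b c d x : T) :
  [/\ (fun j => if j == tm then x else sel a b c d j) = sel x b c d,
      (fun j => if j == ts then x else sel a b c d j) = sel a x c d,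
      (fun j => if j == tc then x else sel a b c d j) = sel a b x d
    & (fun j => if j == tp then x else sel a b c d j) = sel a b c x].
Proof. by split; apply: funext => -[[|[|[|[|]]]] ?]. Qed.

Section FourTapes.
Variables (Sy Rg : finType).
Variables (Jm Js Jc Jp : tape Sy -> Prop).

Notation prog := (prog 4 Sy Rg).
Notation exec := (@exec 4 Sy Rg tp (sel Jm Js Jc Jp)).

Definition mk (r : Rg) (a b c d : tape Sy) : store 4 Sy Rg := Store r (sel a b c d).

Definition skip : prog := Mv tm (fun=> None).
Definition mv (i : 'I_4) (d : bool) : prog := Mv i (fun=> Some d).
Definition at_ (i : 'I_4) (P : Rg -> Sy -> bool) : test 4 Sy Rg := fun r v => P r (v i).

Lemma exec_seq p q s s1 s' b1 b2 b :
  exec p s s1 b1 -> exec q s1 s' b2 -> (b1 + b2 < b)%N -> exec (Seq p q) s s' b.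
Proof. by move=> P Q le; exists s1, b1, b2. Qed.

Lemma exec_loop e p x q s s' b1 b :
  holds e s -> chain (exec p) (exec q) e x s s' b1 -> holds x s' -> (b1 + 2 <= b)%N ->
  exec (Loop e p x q) s s' b.
Proof. by move=> *; exists b1; split. Qed.

Lemma exec_if1 (c c' : test 4 Sy Rg) p q s s' b1 b :
  holds c s -> exec p s s' b1 -> holds c' s' -> (b1 + 2 <= b)%N -> exec (If c p q c') s s' b.
Proof. by move=> cs P cs' le; exists b1; rewrite cs. Qed.

Lemma exec_if0 (c c' : test 4 Sy Rg) p q s s' b1 b :
  ~~ holds c s -> exec q s s' b1 -> ~~ holds c' s' -> (b1 + 2 <= b)%N ->
  exec (If c p q c') s s' b.
Proof. by move=> cs P cs' le; exists b1; rewrite (negbTE cs). Qed.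

Lemma exec_skip r m s c p : Jm m -> exec skip (mk r m s c p) (mk r m s c p) 1.
Proof.
move=> J; split=> //; rewrite /set_tape /mk /= -surjective_pairing.
by case: (sel_set m s c p m) => ->.
Qed.

Section Atoms.
Variables (r r' : Rg) (h : int) (t : int -> Sy) (a : Sy) (m s c p : tape Sy).

Lemma exec_rw_m f g : f (r, t h) = (r', a) -> g (r', a) = (r, t h) ->
  Jm (h, t) -> Jm (h, upd t h a) ->
  exec (Rw tm f g) (mk r (h, t) s c p) (mk r' (h, upd t h a) s c p) 1.
Proof.
move=> fE gE J1 J2; split=> //; exists r', a; split=> //.
by rewrite /set_tape /mk /=; case: (sel_set (h, t) s c p (h, upd t h a)) => ->.
Qed.

Lemma exec_rwid_m f g : f (r, t h) = (r', t h) -> g (r', t h) = (r, t h) -> Jm (h, t) ->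
  exec (Rw tm f g) (mk r (h, t) s c p) (mk r' (h, t) s c p) 1.
Proof.
move=> fE gE J1; split=> //; exists r', (t h); split=> //.
rewrite /set_tape /mk /=; case: (sel_set (h, t) s c p (h, upd t h (t h))) => -> _ _ _.
by rewrite upd_id.
Qed.

Lemma exec_rw_s f g : f (r, t h) = (r', a) -> g (r', a) = (r, t h) ->
  Js (h, t) -> Js (h, upd t h a) ->
  exec (Rw ts f g) (mk r m (h, t) c p) (mk r' m (h, upd t h a) c p) 1.
Proof.
move=> fE gE J1 J2; split=> //; exists r', a; split=> //.
by rewrite /set_tape /mk /=; case: (sel_set m (h, t) c p (h, upd t h a)) => _ ->.
Qed.

Lemma exec_rw_c f g : f (r, t h) = (r', a) -> g (r', a) = (r, t h) ->
  Jc (h, t) -> Jc (h, upd t h a) ->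
  exec (Rw tc f g) (mk r m s (h, t) p) (mk r' m s (h, upd t h a) p) 1.
Proof.
move=> fE gE J1 J2; split=> //; exists r', a; split=> //.
by rewrite /set_tape /mk /=; case: (sel_set m s (h, t) p (h, upd t h a)) => _ _ ->.
Qed.

Lemma exec_rw_p f g : f (r, t h) = (r', t h) -> g (r', t h) = (r, t h) -> Jp (h, t) ->
  exec (Rw tp f g) (mk r m s c (h, t)) (mk r' m s c (h, t)) 1.
Proof.
move=> fE gE J1; split=> //; exists r', (t h); split=> //.
rewrite /set_tape /mk /=; case: (sel_set m s c (h, t) (h, upd t h (t h))) => _ _ _ ->.
by rewrite upd_id.
Qed.

Lemma exec_mvd_m d e : d r = Some e -> Jm (h, t) -> Jm (h + shift e, t) ->
  exec (Mv tm d) (mk r (h, t) s c p) (mk r (h + shift e, t) s c p) 1.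
Proof.
move=> dE J1 J2; split=> //=.
by rewrite /set_tape /mk /= dE; case: (sel_set (h, t) s c p (h + shift e, t)) => ->.
Qed.

Lemma exec_mvd0_m d : d r = None -> Jm (h, t) ->
  exec (Mv tm d) (mk r (h, t) s c p) (mk r (h, t) s c p) 1.
Proof.
move=> dE J1; split=> //=.
by rewrite /set_tape /mk /= dE; case: (sel_set (h, t) s c p (h, t)) => ->.
Qed.

Lemma exec_mv_m e : Jm (h, t) -> Jm (h + shift e, t) ->
  exec (mv tm e) (mk r (h, t) s c p) (mk r (h + shift e, t) s c p) 1.
Proof. exact: exec_mvd_m. Qed.

Lemma exec_mv_s e : Js (h, t) -> Js (h + shift e, t) ->
  exec (mv ts e) (mk r m (h, t) c p) (mk r m (h + shift e, t) c p) 1.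
Proof.
move=> J1 J2; split=> //=.
by rewrite /set_tape /mk /=; case: (sel_set m (h, t) c p (h + shift e, t)) => _ ->.
Qed.

Lemma exec_mvd_c d e : d r = Some e -> Jc (h, t) -> Jc (h + shift e, t) ->
  exec (Mv tc d) (mk r m s (h, t) p) (mk r m s (h + shift e, t) p) 1.
Proof.
move=> dE J1 J2; split=> //=.
by rewrite /set_tape /mk /= dE; case: (sel_set m s (h, t) p (h + shift e, t)) => _ _ ->.
Qed.

Lemma exec_mv_c e : Jc (h, t) -> Jc (h + shift e, t) ->
  exec (mv tc e) (mk r m s (h, t) p) (mk r m s (h + shift e, t) p) 1.
Proof. exact: exec_mvd_c. Qed.

Lemma exec_mv_p e : Jp (h, t) -> Jp (h + shift e, t) ->
  exec (mv tp e) (mk r m s c (h, t)) (mk r m s c (h + shift e, t)) 1.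
Proof.
move=> J1 J2; split=> //=.
by rewrite /set_tape /mk /=; case: (sel_set m s c (h, t) (h + shift e, t)) => _ _ _ ->.
Qed.

End Atoms.
End FourTapes.

Arguments skip {Sy Rg}.
Arguments mv {Sy Rg}.
Notation "p ;; q" := (Seq p q) (at level 60, right associativity).

(* The section lo, ..., lo + S - 1 of the main tape and its delimiters, which
   are recognized by isL and isR. *)
Section Sweeps.
Variables (Sy Rg : finType) (isL isR : pred Sy) (lo : int) (S : nat).
Variables (Js Jc Jp : tape Sy -> Prop).

Definition in_range (u : tape Sy) : Prop := (lo - 1 <= u.1) /\ (u.1 <= lo + S%:Z).
Notation prog := (prog 4 Sy Rg).
Notation J := (sel in_range Js Jc Jp).

Definition framed (t : int -> Sy) : Prop := forall z : int, lo - 1 <= z -> z <= lo + S%:Z ->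
  isL (t z) = (z == lo - 1) /\ isR (t z) = (z == lo + S%:Z).

(** Entry is recognizable because only the left delimiter satisfies [isL]. Undoing this walk is how
    the head comes home from the first [stop]. *)
Definition goR (stop : pred Sy) : prog :=
  Loop (at_ tm (fun _ => isL)) skip (at_ tm (fun _ => stop)) (mv tm true).

Definition pass (stop : pred Sy) (f g : Rg * Sy -> Rg * Sy) : prog :=
  Loop (at_ tm (fun _ => isL)) skip (at_ tm (fun _ => stop)) (Rw tm f g ;; mv tm true).

(** The return undoes a plain walk and not the rewriting pass, so the rewriting persists. *)
Definition sweep (f g : Rg * Sy -> Rg * Sy) : prog := pass isR f g ;; undo (goR isR).

(** Brings a property of the whole section into the finite control: the square where the scan stops
    tells whether something was met on the way. As [f] acts as an involution there, a second probe
    erases the result. *)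
Definition probe (stop : pred Sy) (f : Rg -> Sy -> Rg) : prog :=
  goR stop ;; Rw tm (fun u => (f u.1 u.2, u.2)) (fun u => (f u.1 u.2, u.2)) ;; undo (goR stop).

Definition first_stop (stop : pred Sy) (t : int -> Sy) (q : int) : Prop :=
  [/\ lo - 1 <= q, q <= lo + S%:Z, stop (t q)
    & forall z : int, lo - 1 <= z -> z < q -> ~~ stop (t z)].

Lemma first_stop_ex (stop : pred Sy) (t : int -> Sy) (y : int) :
  lo - 1 <= y -> y <= lo + S%:Z -> stop (t y) -> exists q, first_stop stop t q.
Proof.
move=> y1 y2 sy; have ex : exists n : nat, stop (t (lo - 1 + n%:Z)) && (lo - 1 + n%:Z <= y).
  exists `|(y - (lo - 1))%R|%N; have -> : lo - 1 + `|(y - (lo - 1))%R|%:Z = y by lia.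
  by rewrite sy lexx.
case: (ex_minnP ex) => n /andP[sn ny] least; exists (lo - 1 + n%:Z); split=> //; try by lia.
move=> z z1 z2; apply/negP => sz; have := least `|(z - (lo - 1))%R|%N.
have -> : lo - 1 + `|(z - (lo - 1))%R|%:Z = z by lia.
by rewrite sz /=; lia.
Qed.

Lemma exec_goR stop r t q s c p b :
  framed t -> first_stop stop t q -> (4 * S + 7 <= b)%N ->
  exec tp J (goR stop) (mk r (lo - 1, t) s c p) (mk r (q, t) s c p) b.
Proof.
move=> fr [q1 q2 sq ns] le.
apply: (@exec_loop _ _ _ _ _ _ _ _ _ _ _ _ (4 * `|(q - (lo - 1))%R| + 1)%N) => //; last by lia.
  by rewrite /holds /at_ /scan /=; case: (fr (lo - 1)) => [| |->]; rewrite ?eqxx; lia.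
(* Induction on the distance still to go; each square costs a skip, a move and two guards. *)
have {le}: lo - 1 = q - `|(q - (lo - 1))%R|%:Z by lia.
have: q - `|(q - (lo - 1))%R|%:Z >= lo - 1 by lia.
move: `|(q - (lo - 1))%R|%N => n n1 {1}->.
elim: n n1 => [|n IH] n1.
  have -> : q - 0%:Z = q by lia.
  by apply: Chain1; apply: exec_skip; split=> //=; lia.
have Jn : forall j, (j <= n.+1)%N -> in_range (q - j%:Z, t) by move=> j lj; split=> /=; lia.
apply: (ChainS (b1 := 1) (b2 := 1) (s1 := mk r (q - n.+1%:Z, t) s c p)
   (s2 := mk r (q - n%:Z, t) s c p) (b3 := (4 * n + 1)%N)).
- by apply: exec_skip; exact: Jn.
- by apply: (ns (q - n.+1%:Z)); lia.
- have -> : q - n%:Z = q - n.+1%:Z + shift true by rewrite /shift; lia.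
  apply: exec_mv_m; first exact: Jn.
  by have -> : q - n.+1%:Z + shift true = q - n%:Z; [rewrite /shift; lia|apply: Jn].
- by rewrite /holds /at_ /scan /=; case: (fr (q - n%:Z)) => [| |->]; lia.
- by apply: IH; lia.
- by lia.
Qed.

Lemma exec_goL stop r t q s c p b :
  framed t -> first_stop stop t q -> (4 * S + 7 <= b)%N ->
  exec tp J (undo (goR stop)) (mk r (q, t) s c p) (mk r (lo - 1, t) s c p) b.
Proof. by move=> *; apply: exec_undo; apply: exec_goR. Qed.

Lemma exec_pass stop f g r t t' q s c p b :
  framed t -> framed t' -> first_stop stop t q ->
  (forall z : int, lo - 1 <= z -> z < q -> f (r, t z) = (r, t' z) /\ g (r, t' z) = (r, t z)) ->
  (forall z : int, (z < lo - 1) || (q <= z) -> t' z = t z) ->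
  (6 * S + 9 <= b)%N ->
  exec tp J (pass stop f g) (mk r (lo - 1, t) s c p) (mk r (q, t') s c p) b.
Proof.
move=> fr fr' [q1 q2 sq ns] fg out le.
apply: (exec_loop (b1 := (6 * `|(q - (lo - 1))%R| + 1)%N)); last by lia.
- by rewrite /holds /at_ /scan /=; case: (fr (lo - 1)) => [| |->]; rewrite ?eqxx; lia.
(* The tape when [n] squares remain: already [t'] to the left of the head, still [t] from the head
   on. *)
- pose u (n : nat) z := if z < q - n%:Z then t' z else t z.
  have {1}-> : t = u `|(q - (lo - 1))%R|%N.
    by apply: funext => z; rewrite /u; case: ifP => // zl; rewrite out //; lia.
  have -> : t' = u 0%N.
    by apply: funext => z; rewrite /u; case: ifP => // zl; rewrite out //; lia.
  have {1}-> : lo - 1 = q - `|(q - (lo - 1))%R|%:Z by lia.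
  have: q - `|(q - (lo - 1))%R|%:Z >= lo - 1 by lia.
  move: `|(q - (lo - 1))%R|%N => n; elim: n => [|n IH] n1.
    have -> : q - 0%:Z = q by lia.
    by apply: Chain1; apply: exec_skip; split=> //=; lia.
  have Jn : forall j v, (j <= n.+1)%N -> in_range (q - j%:Z, v) by move=> j v lj; split=> /=; lia.
  pose h := q - n.+1%:Z; rewrite -/h.
  have hn : h + shift true = q - n%:Z by rewrite /h /shift; lia.
  have uh : u n.+1 h = t h by rewrite /u /h ltxx.
  have unE : u n = upd (u n.+1) h (t' h).
    apply: funext => z; rewrite /upd /u; case: eqP => [->|/eqP zh].
      by have -> : h < q - n%:Z by rewrite /h; lia.
    by congr (if _ then _ else _); rewrite /h in zh; lia.
  apply: (ChainS (b1 := 1) (b2 := 3) (s1 := mk r (h, u n.+1) s c p)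
     (s2 := mk r (h + shift true, u n) s c p) (b3 := (6 * n + 1)%N)).
  + by apply: exec_skip; exact: Jn.
  + by rewrite /holds /at_ /scan /= uh; apply: ns; rewrite /h; lia.
  + apply: (exec_seq (s1 := mk r (h, u n) s c p) (b1 := 1) (b2 := 1)) => //.
      rewrite unE; have [fh gh] : f (r, t h) = (r, t' h) /\ g (r, t' h) = (r, t h).
        by apply: fg; rewrite /h; lia.
      by apply: exec_rw_m; rewrite ?uh //; exact: Jn.
    by apply: exec_mv_m; [exact: Jn|rewrite hn; exact: Jn].
  + rewrite hn /holds /at_ /scan /= /u ltxx.
    by case: (fr (q - n%:Z)) => [||->]; lia.
  + by rewrite hn; apply: IH; lia.
  + by lia.
- by rewrite /holds /at_ /scan /= out // lexx orbT.
Qed.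

Lemma first_stop_R t : framed t -> first_stop isR t (lo + S%:Z).
Proof.
move=> fr; split=> //; first by lia.
  by case: (fr (lo + S%:Z)) => [| |_ ->]; rewrite ?eqxx; lia.
by move=> z z1 z2; case: (fr z) => [| |_ ->]; lia.
Qed.

Lemma exec_sweep f g r t t' s c p b :
  framed t -> framed t' ->
  (forall z : int, lo - 1 <= z -> z < lo + S%:Z ->
     f (r, t z) = (r, t' z) /\ g (r, t' z) = (r, t z)) ->
  (forall z : int, (z < lo - 1) || (lo + S%:Z <= z) -> t' z = t z) ->
  (10 * S + 20 <= b)%N ->
  exec tp J (sweep f g) (mk r (lo - 1, t) s c p) (mk r (lo - 1, t') s c p) b.
Proof.
move=> fr fr' fg out le.
apply: (exec_seq (s1 := mk r (lo + S%:Z, t') s c p) (b1 := (6 * S + 9)%N) (b2 := (4 * S + 7)%N)); last by lia.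
  by apply: exec_pass => //; apply: first_stop_R.
by apply: exec_goL => //; apply: first_stop_R.
Qed.

Lemma exec_probe stop f q r t s c p b :
  framed t -> first_stop stop t q -> f (f r (t q)) (t q) = r -> (8 * S + 20 <= b)%N ->
  exec tp J (probe stop f) (mk r (lo - 1, t) s c p) (mk (f r (t q)) (lo - 1, t) s c p) b.
Proof.
move=> fr fs fK le; have [q1 q2 _ _] := fs.
apply: (exec_seq (s1 := mk r (q, t) s c p) (b1 := (4 * S + 7)%N) (b2 := (4 * S + 10)%N)); last by lia.
  exact: exec_goR.
apply: (exec_seq (s1 := mk (f r (t q)) (q, t) s c p) (b1 := 1) (b2 := (4 * S + 7)%N)); last by lia.
  by apply: exec_rwid_m; rewrite //= fK.
exact: exec_goL.
Qed.

End Sweeps.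

Arguments goR {Sy Rg}.
Arguments exec_if1 {Sy Rg Jm Js Jc Jp c c' p q s s' b1 b}.
Arguments exec_if0 {Sy Rg Jm Js Jc Jp c c' p q s s' b1 b}.

(** * The tour of the predecessors of a configuration *)

Section Tour.
Variables (M : machine 1) (detM : deterministic M) (lo : int) (S : nat).

Notation Q := (state M).
Notation A := (symbol M).
Notation cfg := (Q * int * (int -> A))%type.
Notation sec := (in_section lo S).

Definition nrules : nat := #|rules M|.
Notation I := 'I_nrules.+1.

Definition rule_at (i : I) : option (rule M) :=
  nth None [seq Some r | r <- enum (rules M)] i.

(* Whether the rule of index i can be undone in state q when scanning a; on a
   delimiter, where a is None, nothing can be undone. *)
Definition undoable (i : I) (q : Q) (a : option A) : bool :=
  if rule_at i is Some r then
    (target r == q) && (if act r ord0 is inl (_, b) then a == Some b else a != None)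
  else false.

Definition in_sec (X : cfg) : option A := if sec X.1.2 then Some (X.2 X.1.2) else None.

Definition child (i : I) (X : cfg) : bool := undoable i X.1.1 (in_sec X).

Definition pred_cfg (i : I) (X : cfg) : cfg :=
  if rule_at i is Some r then
    match act r ord0 with
    | inl (a, _) => (source r, X.1.2, upd X.2 X.1.2 a)
    | inr d => (source r, X.1.2 - shift d, X.2)
    end
  else X.

Lemma rule_atP i r : rule_at i = Some r -> r \in rules M.
Proof.
rewrite /rule_at; case: (ltnP i (size (enum (rules M)))) => li; last first.
  by rewrite nth_default // size_map.
rewrite (nth_map r) // => -[<-].
by rewrite -mem_enum mem_nth.
Qed.

Lemma rule_at_inj i j r : rule_at i = Some r -> rule_at j = Some r -> i = j.
Proof.
move=> ir jr; apply/val_inj/eqP.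
have sz k : rule_at k = Some r -> (k < size [seq Some r | r <- enum (rules M)])%N.
  by move=> kr; rewrite ltnNge; apply/negP => /(nth_default None) E; rewrite /rule_at E in kr.
rewrite -(nth_uniq None (sz _ ir) (sz _ jr)).
  by rewrite /rule_at in ir jr; rewrite ir jr.
by rewrite map_inj_uniq ?enum_uniq // => ? ? [].
Qed.

Lemma rule_at_max : rule_at ord_max = None.
Proof. by rewrite /rule_at nth_default // size_map -cardE. Qed.

Lemma rule_atK r : r \in rules M -> exists i, rule_at i = Some r.
Proof.
move=> rM; have li : (index r (enum (rules M)) < nrules.+1)%N.
  by rewrite ltnS /nrules cardE index_size.
exists (Ordinal li); rewrite /rule_at (nth_map r) /= ?nth_index ?index_mem ?mem_enum //.
Qed.

(** A move fires also where [a] is [None]: a predecessor may have its head on a delimiter, and the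
    tour has to find its way back from there. *)
Definition fires (q : Q) (a : option A) (r : rule M) : bool :=
  (source r == q) && (if act r ord0 is inl (b, _) then a == Some b else true).

Definition stuck (q : Q) (a : option A) : bool := [forall r in rules M, ~~ fires q a r].

Lemma fires_inj q a r r' :
  r \in rules M -> r' \in rules M -> fires q a r -> fires q a r' -> r = r'.
Proof.
move=> rM rM' /andP[/eqP sr ar] /andP[/eqP sr' ar'].
apply/eqP/negPn/negP => /(detM rM rM')[i]; rewrite (ord1 i) /overlap_domain sr sr' eqxx /=.
case: (act r ord0) ar => [[b c]|d] //; case: (act r' ord0) ar' => [[b' c']|d'] //.
by move=> /eqP -> /eqP[->]; rewrite eqxx.
Qed.

Lemma child_fires i X : child i X -> exists r,
  [/\ rule_at i = Some r, r \in rules M & fires (pred_cfg i X).1.1 (in_sec (pred_cfg i X)) r].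
Proof.
case: X => -[q h] t; rewrite /child /undoable /pred_cfg /fires.
case E: (rule_at i) => [r|//] /andP[_ ar]; exists r; split=> //; first exact: rule_atP E.
case: (act r ord0) ar => [[a b]|d] /=; rewrite ?eqxx //= /in_sec /=.
by case: ifP => // sh _; rewrite /upd eqxx.
Qed.

(** Determinism of [M] recovers the rule from the predecessor. Undoing a known rule loses nothing,
    because the symbol that is overwritten is the one that the rule writes. *)
Lemma pred_cfg_inj i j X Y :
  child i X -> child j Y -> pred_cfg i X = pred_cfg j Y -> i = j /\ X = Y.
Proof.
move=> ci cj E; have [r [ri rM fr]] := child_fires ci; have [r' [rj rM' fr']] := child_fires cj.
rewrite -E in fr'; have rr := fires_inj rM rM' fr fr'; subst r'.
have ij := rule_at_inj ri rj; split=> //; subst j => {rj rM' fr'}.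
move: ci cj E; rewrite /child /undoable /pred_cfg ri /in_sec.
case: X Y {fr} => -[q h] t [[q' h'] t'] /=.
case: (act r ord0) => [[a b]|d] /andP[/eqP -> ta] /andP[/eqP -> ta'] [] => [hh|/addIr -> -> //].
subst h' => tt; congr pair; have tb : t h = t' h.
  by case: ifP ta ta' => // _ /eqP[->] /eqP[->].
rewrite -(upd_id t h) -(upd_id t' h) tb -[LHS](upd_upd t h a) -[RHS](upd_upd t' h a).
by rewrite tt.
Qed.

(* A state (X, l, i) of the tour stands at the node X of level l, about to
   visit its i-th child; after its last child the tour goes up. *)
Notation tstate := (cfg * nat * I)%type.

Variable m : nat.

Definition tour_ok (s : tstate) : Prop :=
  [/\ (s.1.2 <= m)%N, lo - 1 <= s.1.1.1.2, s.1.1.1.2 <= lo + S%:Z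
    & forall z, ~~ sec z -> s.1.1.2 z = blank M].

(** The level is the depth still available, so at level 0 all children are skipped. [TourDown] and
    [TourUp] cross the same edge in its two directions and then advance the index cyclically, [ord0]
    following [ord_max]; [flip] and [rotate] program the step in this form. *)
Inductive tour : tstate -> tstate -> Prop :=
  | TourDown X l i : child i X -> tour (X, l.+1, i) (pred_cfg i X, l, ord0)
  | TourStay X l i : i != ord_max -> ~~ ((0 < l)%N && child i X) ->
      tour (X, l, i) (X, l, ordS i)
  | TourUp X l i : child i X -> (l < m)%N ->
      tour (pred_cfg i X, l, ord_max) (X, l.+1, ordS i).

Lemma child_max X : child ord_max X = false.
Proof. by rewrite /child /undoable rule_at_max. Qed.

Lemma tour_det s s1 s2 : tour s s1 -> tour s s2 -> s1 = s2.
Proof.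
move=> T1; case: _ _ / T1 => {s s1} [X l i ci|X l i im nc|X l i ci lm];
 move E2: (_, _, _) => u T2; case: _ _ / T2 E2 => {u s2} [Y l' j cj|Y l' j jm nc'|Y l' j cj lm'] [].
- by move=> -> -> ->.
- by move=> XY ll ij; move: nc'; rewrite -XY -ij -ll ci ltn0Sn.
- by move=> _ _ im; rewrite im child_max in ci.
- by move=> XY ll ij; move: nc; rewrite XY ll ij cj ltn0Sn.
- by move=> -> -> ->.
- by move=> _ _ im'; rewrite im' eqxx in im.
- by move=> _ _ jm; rewrite -jm child_max in cj.
- by move=> _ _ jm'; rewrite -jm' eqxx in jm.
- by move=> /(pred_cfg_inj ci cj)[-> ->] ->.
Qed.

Inductive tours : nat -> tstate -> tstate -> Prop :=
  | Tour0 s : tour_ok s -> tours 0 s s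
  | TourS n s s1 s2 : tour_ok s -> tour s s1 -> tours n s1 s2 -> tours n.+1 s s2.

Lemma tours_cat n n' s s1 s2 : tours n s s1 -> tours n' s1 s2 -> tours (n + n') s s2.
Proof. by elim=> // n0 s0 s3 s4 ok T _ IH /IH; exact: TourS T. Qed.

Lemma tours1 s s1 : tour_ok s -> tour_ok s1 -> tour s s1 -> tours 1 s s1.
Proof. by move=> ok ok1 T; apply: (TourS ok T); exact: Tour0. Qed.

Lemma toursE n s s2 : tours n s s2 ->
  if n is n'.+1 then exists2 s1, tour s s1 & tours n' s1 s2 else s = s2.
Proof. by case=> // n' {}s s1 {}s2 _ T TT; exists s1. Qed.

Lemma tours_norevisit n s s' j : tours n s s' -> (forall u, ~ tour s' u) -> ~ tours j.+1 s s.
Proof.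
move=> T term C.
(* By determinism, every path from [s1] is a prefix of the one that ends in [s']. *)
have key : forall k n1 s1 s2, tours k s1 s2 -> tours n1 s1 s' -> (k <= n1)%N /\ tours (n1 - k) s2 s'.
  elim=> [|k IH] n1 s1 s2 /toursE; first by move=> -> ?; rewrite subn0.
  move=> [s3 T1 T2]; case: n1 => [|n1] /toursE; first by move=> E; case: (term s3); rewrite -E.
  move=> [s4 T3 T4]; rewrite (tour_det T3 T1) in T4.
  by have [] := IH _ _ _ T2 T4; rewrite subSS.
elim: n {-2}n (leqnn n) T => [|N IH] n le T; have [jn Tn] := key _ _ _ _ C T; first by lia.
by apply: (IH (n - j.+1)%N) => //; lia.
Qed.

(** Only a node whose head is inside the section has children, so undoing one move takes the head at
    most onto a delimiter. *)
Lemma tour_ok_child X l i j : child i X -> tour_ok (X, l.+1, i) -> tour_ok (pred_cfg i X, l, j).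
Proof.
case: X => -[q h] t; rewrite /child /undoable /pred_cfg /tour_ok /in_sec /=.
case: (rule_at i) => [r|//] /andP[_ ar] [lm h1 h2 bl].
have sh : sec h by case: (act r ord0) ar => [[? ?]|?]; case: ifP.
have [h3 h4] := andP sh.
case: (act r ord0) ar => [[a b]|d] _ /=; split=> //; try by lia.
- by move=> z sz; rewrite /upd; case: eqP => [E|_]; [rewrite E sh in sz|exact: bl].
- by case: d; rewrite /shift; lia.
- by case: d; rewrite /shift; lia.
Qed.

(** A node has at most [nrules] children; the extra 3 in the base absorbs the step down and the step
    up around each of them. *)
Definition subtree_bound (l : nat) : nat := ((nrules + 3) ^ l.+1)%N.

Lemma tour_subtree l X i : tour_ok (X, l, i) ->
  exists2 n, (n <= subtree_bound l)%N & tours n (X, l, i) (X, l, ord_max).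
Proof.
elim: l X i => [|l IH] X i ok.
  suff [n le T] : exists2 n, (n <= nrules - i)%N & tours n (X, 0%N, i) (X, 0%N, ord_max).
    by exists n => //; apply: (leq_trans le); rewrite /subtree_bound expn1; lia.
  move En: (nrules - i)%N => n; elim: n i En ok => [|n IHn] i En ok.
    have -> : i = ord_max by apply: val_inj => /=; have := ltn_ord i; lia.
    by exists 0%N => //; exact: Tour0.
  have im : i != ord_max by apply/eqP => E; move: En; rewrite E /=; lia.
  have vi : val (ordS i) = i.+1 by rewrite /= modn_small //; have := ltn_ord i; lia.
  have Ei : (nrules - ordS i)%N = n by move: vi => /= ->; lia.
  have [k lk T] := IHn (ordS i) Ei ok.
  by exists k.+1; rewrite ?ltnS //; apply: (TourS ok _ T); apply: TourStay.
suff [n le T] : exists2 n, (n <= (nrules - i) * (subtree_bound l + 2))%N & tours n (X, l.+1, i) (X, l.+1, ord_max).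
  exists n => //; apply: (leq_trans le).
  apply: (@leq_trans (nrules * (subtree_bound l + 2))); first by rewrite leq_mul2r leq_subr orbT.
  rewrite /subtree_bound (expnS _ l.+1) mulnDl mulnDr leq_add2l.
  have: (0 < (nrules + 3) ^ l)%N by rewrite expn_gt0 addn3.
  by rewrite expnS; nia.
move En: (nrules - i)%N => n; elim: n i En ok => [|n IHn] i En ok.
  have -> : i = ord_max by apply: val_inj => /=; have := ltn_ord i; lia.
  by exists 0%N => //; exact: Tour0.
have im : i != ord_max by apply/eqP => E; move: En; rewrite E /=; lia.
have vi : val (ordS i) = i.+1 by rewrite /= modn_small //; have := ltn_ord i; lia.
have Ei : (nrules - ordS i)%N = n by move: vi => /= ->; lia.
have [k lk T] := IHn (ordS i) Ei ok.
case: (boolP (child i X)) => ci.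
  have ok' j : tour_ok (pred_cfg i X, l, j) by apply: tour_ok_child ok.
  have [k' lk' T'] := IH (pred_cfg i X) ord0 (ok' _).
  exists (1 + (k' + (1 + k)))%N; first by rewrite mulSn; lia.
  apply: tours_cat (tours1 ok _ (TourDown _ ci)) _; first exact: ok'.
  apply: tours_cat T' _; apply: tours_cat T.
  by apply: tours1 => //; apply: TourUp => //; case: ok.
exists k.+1; first by rewrite mulSn; lia.
by apply: (TourS ok _ T); apply: TourStay; rewrite // (negbTE ci) andbF.
Qed.

(** Once the subtree of [C j] is exhausted the tour climbs to [C j.+1] and arrives just behind the
    child it came from. The siblings that remain cost at most one more subtree. *)
Lemma tour_path (C : nat -> cfg) n :
  (n <= m)%N -> (forall j, (j <= n)%N -> tour_ok (C j, j, ord0)) ->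
  (forall j, (j < n)%N -> exists i, child i (C j.+1) /\ pred_cfg i (C j.+1) = C j) ->
  exists2 N, (N <= n.+1 * (subtree_bound m).+1)%N & tours N (C 0%N, 0%N, ord0) (C n, n, ord_max).
Proof.
have sb l : (l <= m)%N -> (subtree_bound l <= subtree_bound m)%N.
  by move=> lm; rewrite /subtree_bound leq_exp2l // addn3.
elim: n => [|n IH] nm ok st.
  have [N le T] := tour_subtree (ok 0%N (leqnn 0)); exists N => //.
  by rewrite mul1n; apply: (leq_trans le); apply: leqW; exact: sb.
have [||N le T] := IH (ltnW nm); [by move=> j jn; apply: ok; lia|by move=> j jn; apply: st; lia|].
have [i [ci pi]] := st n (ltnSn n).
have ok' : tour_ok (C n.+1, n.+1, ordS i) := ok _ (leqnn _).
have [N' le' T'] := tour_subtree ok'.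
exists (N + (1 + N'))%N.
  by rewrite mulSn; have := sb _ nm; lia.
apply: tours_cat T _; apply: tours_cat T'; apply: tours1 => //.
  by apply: (ok n); lia.
by rewrite -pi; apply: TourUp.
Qed.

End Tour.

Definition cfg_of (M : machine 1) (c : config M) : state M * int * (int -> symbol M) :=
  (cstate c, chead c ord0, ctape c ord0).

Lemma step_pred_cfg (M : machine 1) lo S (c d : config M) :
  step c d -> in_section lo S (chead d ord0) ->
  exists i, child lo S i (cfg_of d) /\ pred_cfg i (cfg_of d) = cfg_of c.
Proof.
move=> -[r [rM /andP[/eqP sr /forallP/(_ ord0) ar] ->]] sd.
have [i ri] := rule_atK rM; exists i.
move: ar sd; rewrite /child /undoable /pred_cfg ri /in_sec /cfg_of /apply_rule /=.
case: (act r ord0) => [[a b]|e] ar ->; rewrite eqxx /= -?sr.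
  rewrite eqxx eqxx; split=> //; congr pair; rewrite -(eqP ar).
  by apply: funext => z; rewrite /upd; case: eqP => [->|].
by split=> //; rewrite addrK.
Qed.

Lemma halted_stuck (M : machine 1) lo S (c : config M) :
  halted c -> in_section lo S (chead c ord0) -> stuck (cstate c) (in_sec lo S (cfg_of c)).
Proof.
move=> hc sc; apply/forallP => r; apply/implyP => rM; apply/negP => /andP[/eqP sr ar].
apply: (hc (apply_rule r c)); exists r; split=> //; rewrite /applicable sr eqxx /=.
apply/forallP => i; rewrite (ord1 i); move: ar; rewrite /in_sec /cfg_of /= sc.
by case: (act r ord0) => [[a b]|//] /eqP[->].
Qed.

(** * Digits of the level counter *)

Section Digits.
Variable B : nat.
Local Notation base := B.+1.

Definition digit (l j : nat) : nat := (l %/ base ^ j) %% base.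

Lemma digit_lt l j : (digit l j < base)%N.
Proof. exact: ltn_pmod. Qed.

Lemma digitS l j : digit l j.+1 = digit (l %/ base) j.
Proof. by rewrite /digit expnS divnMA. Qed.

Lemma digit0 l : digit l 0 = (l %% base)%N.
Proof. by rewrite /digit expn0 divn1. Qed.

Lemma digits_inj n l l' : (l < base ^ n)%N -> (l' < base ^ n)%N ->
  (forall j, (j < n)%N -> digit l j = digit l' j) -> l = l'.
Proof.
elim: n l l' => [|n IH] l l'; first by rewrite expn0; lia.
rewrite expnSr => ln ln' H; rewrite (divn_eq l base) (divn_eq l' base).
have := H 0%N isT; rewrite !digit0 => ->; congr (_ * _ + _)%N.
apply: IH; rewrite ?ltn_divLR // => j jn.
by rewrite -!digitS; exact: H.
Qed.

Lemma digit_zero j : digit 0 j = 0%N.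
Proof. by rewrite /digit div0n mod0n. Qed.

Lemma digit_max n j : (j < n)%N -> digit (base ^ n).-1 j = B.
Proof.
elim: n j => [//|n IH] j jn.
have E : (base ^ n.+1).-1 = ((base ^ n).-1 * base + B)%N.
  by rewrite expnSr; have : (0 < base ^ n)%N; [rewrite expn_gt0|case: (base ^ n)%N => // k _; rewrite mulSn /=; lia].
case: j jn => [_|j jn]; first by rewrite digit0 E modnMDl modn_small.
by rewrite digitS E divnMDl // divn_small // addn0 IH.
Qed.

Lemma digit_pred l j :
  (forall i, (i < j)%N -> digit l.+1 i = 0%N) -> digit l.+1 j <> 0%N ->
  [/\ forall i, (i < j)%N -> digit l i = B, digit l.+1 j = (digit l j).+1
    & forall i, (j < i)%N -> digit l i = digit l.+1 i].
Proof.
elim: j l => [|j IH] l H nz.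
  move: nz; rewrite !digit0 => nz.
  have := divn_eq l.+1 base; move: nz (ltn_pmod l.+1 (ltn0Sn B)).
  case E: (l.+1 %% base)%N => [//|r] _ rB lE.
  have {lE}lE : l = ((l.+1 %/ base) * base + r)%N by lia.
  have lq : (l %/ base = l.+1 %/ base)%N by rewrite {1}lE divnMDl // (divn_small (ltnW rB)) addn0.
  split; [by []|by rewrite {1}lE modnMDl (modn_small (ltnW rB))|].
  by case=> // i _; rewrite !digitS lq.
have := H 0%N isT; rewrite digit0 => E.
have := divn_eq l.+1 base; rewrite E addn0 => lE.
have q0 : (0 < l.+1 %/ base)%N by case: (l.+1 %/ base)%N lE.
have l2 : l = ((l.+1 %/ base).-1 * base + B)%N.
  by move: lE q0; case: (l.+1 %/ base)%N => // k; rewrite mulSn /=; lia.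
have lq : (l %/ base = (l.+1 %/ base).-1)%N by rewrite {1}l2 divnMDl // (divn_small (ltnSn B)) addn0.
have Sq : (l.+1 %/ base = (l %/ base).+1)%N by rewrite lq prednK.
have [||h1 h2 h3] := IH (l %/ base)%N.
- by move=> i ij; rewrite -Sq -digitS; apply: H.
- by rewrite -Sq -digitS.
rewrite !digitS Sq; split=> //.
- case=> [_|i ij]; first by rewrite digit0 l2 modnMDl modn_small.
  by rewrite digitS; apply: h1.
- by case=> // i ij; rewrite !digitS Sq; apply: h3.
Qed.

Lemma lowest_digit n l : (0 < l)%N -> (l < base ^ n)%N ->
  exists j, [/\ (j < n)%N, digit l j <> 0%N & forall i, (i < j)%N -> digit l i = 0%N].
Proof.
move=> l0 ln; have ex : exists j, (j < n)%N && (digit l j != 0%N).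
  apply: contrapT => nex; move: l0; suff -> : l = 0%N by [].
  apply: (@digits_inj n) => //; first by rewrite expn_gt0.
  move=> j jn; rewrite digit_zero.
  by apply/eqP/negPn/negP => dj; apply: nex; exists j; rewrite jn dj.
case: (ex_minnP ex) => j /andP[jn /eqP dj] least; exists j; split=> // i ij.
by apply/eqP/negPn/negP => di; have := least i; rewrite di (ltn_trans ij jn) => /(_ isT); lia.
Qed.

End Digits.

(** * The tour as a program on the main tape *)

Section BaseLevel.
Variables (M : machine 1) (detM : deterministic M) (B : nat) (O : finType).

Notation Q := (state M).
Notation A := (symbol M).
Notation cfg := (Q * int * (int -> A))%type.
Notation I := 'I_(nrules M).+1.

(* Half a square of a configuration: a symbol, and the state if the head is there. *)
Definition slot : finType := (option A * option Q)%type.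
Definition slot0 : slot := (None, None).

Definition io : finType := (A + A * A + bool + option bool)%type.
Definition ioS (a : A) : io := inl (inl (inl a)).
Definition ioP (a b : A) : io := inl (inl (inr (a, b))).
Definition ioE (d : bool) : io := inl (inr d).
Definition ioM (o : option bool) : io := inr o.

Definition io_framed (lo : int) (S : nat) (w : int -> io) : Prop :=
  forall z : int, lo - 1 <= z -> z <= lo + S%:Z ->
    (w z == ioE false) = (z == lo - 1) /\ (w z == ioE true) = (z == lo + S%:Z).

(* The tracks of a square: input and output, three copies of configurations
   (the two arguments of the pebble game and the tour), a digit of the level of
   the tour, and the control symbols of the recursion. *)
Definition ctl : finType := option (option (bool * bool)).
Definition cell : finType := (io * slot * slot * slot * option 'I_B.+1 * ctl)%type.

Definition c_io (c : cell) : io := let: (i, _, _, _, _, _) := c in i.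
Definition c_s1 (c : cell) : slot := let: (_, s, _, _, _, _) := c in s.
Definition c_x (c : cell) : slot := let: (_, _, _, x, _, _) := c in x.
Definition c_dg (c : cell) : option 'I_B.+1 := let: (_, _, _, _, d, _) := c in d.
Definition c_ph (c : cell) : ctl := let: (_, _, _, _, _, p) := c in p.

Definition isL : pred cell := fun c => c_io c == ioE false.
Definition isR : pred cell := fun c => c_io c == ioE true.
Definition marked : pred cell := fun c => (c_x c).2 != None.
Definition not_zero : pred cell := fun c => ~~ isL c && (c_dg c != Some ord0).
Definition not_max : pred cell := fun c => ~~ isL c && (c_dg c != Some ord_max).

(* The index of the tour, and flags: level 0, child exists, at the start of the
   tour, maximal level, halted. *)
Definition treg : finType := (I * bool * bool * bool * bool * bool)%type.
Definition reg : finType := (treg * O)%type.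

Notation prog := (prog 4 cell reg).

(** The factor [i != ord_max] gives the flag the same value at both ends of an edge that [flip]
    crosses, so that the closing test can clear it: one end has positive level, the other has index
    [ord_max]. *)
Definition tog_z (r : reg) (c : cell) : reg :=
  let: ((i, z, g, e, m, h), o) := r in
  ((i, z (+) ((i != ord_max) && (c_dg c == None)), g, e, m, h), o).

Definition tog_g (r : reg) (c : cell) : reg :=
  let: ((i, z, g, e, m, h), o) := r in
  ((i, z, g (+) (~~ z && if (c_x c).2 is Some q then undoable i q (c_x c).1 else false), e, m, h), o).

Definition tog_e (r : reg) (c : cell) : reg :=
  let: ((i, z, g, e, m, h), o) := r in
  ((i, z, g, e (+) ((i == ord0) && isR c), m, h), o).

Definition tog_m (r : reg) (c : cell) : reg :=
  let: ((i, z, g, e, m, h), o) := r in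
  ((i, z, g, e, m (+) ((i == ord_max) && (c_dg c == None)), h), o).

Definition tog_h (r : reg) (c : cell) : reg :=
  let: ((i, z, g, e, m, h), o) := r in
  ((i, z, g, e, m, h (+) ((i == ord_max) && if (c_x c).2 is Some q then stuck q (c_x c).1 else false)), o).

(** The scan gets as far as the right delimiter exactly when the slots and the digits are those of
    the starting node at level 0. *)
Definition differs : pred cell := fun c =>
  ~~ isL c && [|| isR c, c_x c != c_s1 c | (c_dg c != None) && (c_dg c != Some ord0)].

Definition test_z : prog := probe isL not_zero tog_z.
Definition test_g : prog := probe isL marked tog_g.
Definition test_e : prog := probe isL differs tog_e.
Definition test_m : prog := probe isL not_max tog_m.
Definition test_h : prog := probe isL marked tog_h.

(** The rule just undone is stored nowhere: it is the one that [M] would fire next, so state and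
    scanned symbol give it back. *)
Definition fired (q : Q) (a : option A) : option I :=
  [pick i | if rule_at i is Some r then fires q a r else false].

(** Undoing a move takes two rewrites, since the state changes squares. A read/write rule is undone
    by [leave] alone, which lowers the child flag so that the move and [arrive] do nothing;
    backwards, the flag tells [unleave] which case occurred. *)
Definition leave (u : reg * cell) : reg * cell :=
  let: (((i, z, g, e, m, h), o), (c, s1, s2, x, d, p)) := u in
  if rule_at i is Some r then
    match act r ord0 with
    | inl (a, _) => (((ord_max, z, false, e, m, h), o), (c, s1, s2, (Some a, Some (source r)), d, p))
    | inr _ => (((i, z, g, e, m, h), o), (c, s1, s2, (x.1, None), d, p))
    end
  else u.

Definition unleave (u : reg * cell) : reg * cell :=
  let: (((i, z, g, e, m, h), o), (c, s1, s2, x, d, p)) := u in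
  if g then
    if rule_at i is Some r then (((i, z, g, e, m, h), o), (c, s1, s2, (x.1, Some (target r)), d, p))
    else u
  else if x.2 is Some q then
    if fired q x.1 is Some j then
      if rule_at j is Some r then
        if act r ord0 is inl (_, b) then
          (((j, z, true, e, m, h), o), (c, s1, s2, (Some b, Some (target r)), d, p))
        else u
      else u
    else u
  else u.

Definition arrive (u : reg * cell) : reg * cell :=
  let: (((i, z, g, e, m, h), o), (c, s1, s2, x, d, p)) := u in
  if g then
    if rule_at i is Some r then
      (((ord_max, z, false, e, m, h), o), (c, s1, s2, (x.1, Some (source r)), d, p))
    else u
  else u.

Definition unarrive (u : reg * cell) : reg * cell :=
  let: (((i, z, g, e, m, h), o), (c, s1, s2, x, d, p)) := u in
  if x.2 is Some q then
    if fired q x.1 is Some j then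
      if rule_at j is Some r then
        if act r ord0 is inr _ then
          (((j, z, true, e, m, h), o), (c, s1, s2, (x.1, None), d, p))
        else u
      else u
    else u
  else u.

Definition back_move (r : reg) : option bool :=
  let: ((i, z, g, e, m, h), o) := r in
  if g then
    if rule_at i is Some r then if act r ord0 is inr d then Some (~~ d) else None else None
  else None.

Definition undo_step : prog :=
  goR isL marked ;; Rw tm leave unleave ;; Mv tm back_move ;; Rw tm arrive unarrive ;;
  undo (goR isL marked).

Definition borrow (u : reg * cell) : reg * cell :=
  let: (r, (c, s1, s2, x, d, p)) := u in
  (r, (c, s1, s2, x, if d == Some ord0 then Some ord_max else d, p)).

Definition unborrow (u : reg * cell) : reg * cell :=
  let: (r, (c, s1, s2, x, d, p)) := u in
  (r, (c, s1, s2, x, if d == Some ord_max then Some ord0 else d, p)).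

Definition decr (u : reg * cell) : reg * cell :=
  let: (r, (c, s1, s2, x, d, p)) := u in (r, (c, s1, s2, x, omap (@ord_pred _) d, p)).

Definition incr (u : reg * cell) : reg * cell :=
  let: (r, (c, s1, s2, x, d, p)) := u in (r, (c, s1, s2, x, omap (@ordS _) d, p)).

(** After borrowing, the first non-maximal digit is the one just decremented. The undone scan for it
    leads back from the right square, and no position has to be remembered. *)
Definition dec_level : prog :=
  pass isL not_zero borrow unborrow ;; Rw tm decr incr ;; undo (goR isL not_max).

Definition down : prog := undo_step ;; dec_level.

Definition at_max : test 4 cell reg :=
  at_ tm (fun r _ => let: ((i, _, _, _, _, _), _) := r in i == ord_max).
Definition has_child : test 4 cell reg :=
  at_ tm (fun r _ => let: ((_, _, g, _, _, _), _) := r in g).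

(** An involution: it exchanges the two ends of a tree edge, a node with the index of a child and
    that child with [ord_max], and fixes the other states. As for a graph on a surface, the Euler
    tour is this edge involution followed by a rotation at the node. Repeating the tests clears
    their flags. *)
Definition flip : prog :=
  test_z ;; test_g ;;
  If at_max (undo down) (If has_child down skip at_max) has_child ;;
  test_g ;; test_z.

Definition rotate (u : reg * cell) : reg * cell :=
  let: (((i, z, g, e, m, h), o), c) := u in (((ordS i, z, g, e, m, h), o), c).
Definition unrotate (u : reg * cell) : reg * cell :=
  let: (((i, z, g, e, m, h), o), c) := u in (((ord_pred i, z, g, e, m, h), o), c).
Definition set_e (u : reg * cell) : reg * cell :=
  let: (((i, z, g, e, m, h), o), c) := u in (((i, z, g, ~~ e, m, h), o), c).

Definition starting : test 4 cell reg :=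
  at_ tm (fun r _ => let: ((_, _, _, e, _, _), _) := r in e).
Definition finished : test 4 cell reg :=
  at_ tm (fun r _ => let: ((i, _, _, _, m, h), _) := r in (i == ord_max) && (m || h)).

(** The flag [e] means being at the starting state: it is raised once by hand, later recomputed
    after each step, and cleared by the test that opens the body. [m] and [h] may stay set at the
    end; the [undo] in [advance] clears them. *)
Definition tour_prog : prog :=
  Rw tm set_e set_e ;;
  Loop starting (test_e ;; test_m ;; test_h) finished ((flip ;; Rw tm rotate unrotate) ;; test_e).

(** Exchanging [slot0] with [s1] and fixing all else is an involution. The same device in [copy_s2]
    lets [advance] both write and erase its result. *)
Definition copy_x (u : reg * cell) : reg * cell :=
  let: (r, (c, s1, s2, x, d, p)) := u in
  (r, (c, s1, s2, if x == slot0 then s1 else if x == s1 then slot0 else x, d, p)).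
Definition copy_s2 (u : reg * cell) : reg * cell :=
  let: (r, (c, s1, s2, x, d, p)) := u in
  (r, (c, s1, if s2 == slot0 then x else if s2 == x then slot0 else s2, x, d, p)).

Definition advance : prog :=
  (sweep isL isR copy_x copy_x ;; tour_prog) ;; sweep isL isR copy_s2 copy_s2 ;;
  undo (sweep isL isR copy_x copy_x ;; tour_prog).

Section Correctness.
Variables (lo : int) (S nd : nat) (Js Jc Jp : tape cell -> Prop).
Variables (w : int -> io) (s c p : tape cell) (o : O) (s1 s2 : int -> slot).
Hypothesis nd_le : (nd <= S)%N.
Hypothesis w_framed : io_framed lo S w.

Notation sec := (in_section lo S).
Notation exec := (@exec 4 cell reg tp (sel (in_range lo S) Js Jc Jp)).
Notation maxlev := (B.+1 ^ nd).-1.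

Definition mt (w : int -> io) (s1 s2 x : int -> slot) (d : int -> option 'I_B.+1) (z : int) : cell :=
  (w z, s1 z, s2 z, x z, d z, None).

Definition dgt (l : nat) (z : int) : option 'I_B.+1 :=
  if (lo <= z) && (z < lo + nd%:Z) then Some (inord (digit B l `|(z - lo)%R|)) else None.

(** The state may sit on a delimiter, where no symbol is recorded; this is the [None] that
    [undoable] sees. *)
Definition code (X : cfg) (z : int) : slot :=
  (if sec z then Some (X.2 z) else None, if z == X.1.2 then Some X.1.1 else None).

Arguments code : simpl never.
Arguments dgt : simpl never.

Lemma framed_mt x1 x2 x d : framed isL isR lo S (mt w x1 x2 x d).
Proof. by move=> z z1 z2; exact: (w_framed z1 z2). Qed.

Lemma isL_mt x1 x2 x d (z : int) : lo - 1 <= z -> z <= lo + S%:Z -> isL (mt w x1 x2 x d z) = (z == lo - 1).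
Proof. by move=> z1 z2; case: (w_framed z1 z2). Qed.

Lemma isR_mt x1 x2 x d (z : int) : lo - 1 <= z -> z <= lo + S%:Z -> isR (mt w x1 x2 x d z) = (z == lo + S%:Z).
Proof. by move=> z1 z2; case: (w_framed z1 z2). Qed.

Notation R i z g e m h := ((i, z, g, e, m, h), o).
Notation at_lev r h x l := (mk r (h, mt w s1 s2 x (dgt l)) s c p).

Lemma dgt_first (v : 'I_B.+1) L x l q :
  (L <= maxlev)%N -> (l <= maxlev)%N -> (forall j, (j < nd)%N -> digit B L j = v) ->
  first_stop lo S (fun c => ~~ isL c && (c_dg c != Some v)) (mt w s1 s2 x (dgt l)) q ->
  (dgt l q == None) = (l == L).
Proof.
have pos : (0 < B.+1 ^ nd)%N by rewrite expn_gt0.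
move=> L1 l1 Lv [q1 q2 /andP[nL qv] before].
have q3 : q != lo - 1 by apply: contra nL => /eqP ->; rewrite isL_mt ?eqxx //; lia.
have inordK (u : nat) (j : nat) : inord (digit B u j) = v -> digit B u j = v.
  by move=> <-; rewrite inordK // digit_lt.
apply/eqP/eqP => [dq|lL].
  apply: (@digits_inj B nd); [lia|lia|move=> j jn; rewrite Lv //].
  have {}dq : lo + nd%:Z <= q by move: dq; rewrite /dgt; case: ifP => //; lia.
  have := before (lo + j%:Z); rewrite negb_and negbK.
  rewrite isL_mt; [|lia|lia].
  have -> : (lo + j%:Z == lo - 1) = false by lia.
  rewrite /= /dgt; have -> : (lo <= lo + j%:Z) && (lo + j%:Z < lo + nd%:Z) by lia.
  have -> : `|(lo + j%:Z - lo)%R|%N = j by lia.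
  by rewrite negbK => H; have /eqP[/inordK] := H ltac:(lia) ltac:(lia).
apply/eqP; apply: contraNT qv; rewrite /= /dgt lL; case: ifP => // /andP[u1 u2] _.
by rewrite Lv ?inord_val //; lia.
Qed.

Lemma dgt_R l : dgt l (lo + S%:Z) = None.
Proof. by rewrite /dgt; case: ifP => //; lia. Qed.

Lemma not_isL x1 x2 x d : isL (mt w x1 x2 x d (lo + S%:Z)) = false.
Proof. by rewrite isL_mt; lia. Qed.

Lemma exec_test_z i z g e m h x l : (l <= maxlev)%N ->
  exec test_z (at_lev (R i z g e m h) (lo - 1) x l)
    (at_lev (R i (z (+) ((i != ord_max) && (l == 0%N))) g e m h) (lo - 1) x l) (8 * S + 20).
Proof.
move=> lm; have [q fs] : exists q, first_stop lo S not_zero (mt w s1 s2 x (dgt l)) q.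
  by apply: (@first_stop_ex _ _ _ _ _ (lo + S%:Z)); rewrite /not_zero ?not_isL ?dgt_R //= ?dgt_R //; lia.
have E : (dgt l q == None) = (l == 0%N).
  by apply: (dgt_first _ lm _ fs) => // j jn; rewrite digit_zero.
have := @exec_probe _ _ isL isR lo S Js Jc Jp not_zero tog_z q (R i z g e m h) _ s c p _ (framed_mt _ _ _ _) fs _ (leqnn _).
by rewrite /= E; apply; rewrite addbK.
Qed.

Lemma exec_test_m i z g e m h x l : (l <= maxlev)%N ->
  exec test_m (at_lev (R i z g e m h) (lo - 1) x l)
    (at_lev (R i z g e (m (+) ((i == ord_max) && (l == maxlev))) h) (lo - 1) x l) (8 * S + 20).
Proof.
move=> lm; have [q fs] : exists q, first_stop lo S not_max (mt w s1 s2 x (dgt l)) q.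
  by apply: (@first_stop_ex _ _ _ _ _ (lo + S%:Z)); rewrite /not_max ?not_isL ?dgt_R //= ?dgt_R //; lia.
have E : (dgt l q == None) = (l == maxlev).
  by apply: (dgt_first _ lm _ fs) => // j jn; rewrite digit_max.
have := @exec_probe _ _ isL isR lo S Js Jc Jp not_max tog_m q (R i z g e m h) _ s c p _ (framed_mt _ _ _ _) fs _ (leqnn _).
by rewrite /= E; apply; rewrite addbK.
Qed.

Lemma first_marked X l : lo - 1 <= X.1.2 -> X.1.2 <= lo + S%:Z ->
  first_stop lo S marked (mt w s1 s2 (code X) (dgt l)) X.1.2.
Proof.
move=> h1 h2; split=> //; first by rewrite /marked /= eqxx.
by move=> z z1 z2; rewrite /marked /= /code; have -> : (z == X.1.2) = false by lia.
Qed.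

Lemma code_head (X : cfg) : code X X.1.2 = (in_sec lo S X, Some X.1.1).
Proof. by rewrite /code eqxx. Qed.

Lemma exec_test_g i z g e m h (X : cfg) l : lo - 1 <= X.1.2 -> X.1.2 <= lo + S%:Z ->
  exec test_g (at_lev (R i z g e m h) (lo - 1) (code X) l)
    (at_lev (R i z (g (+) (~~ z && child lo S i X)) e m h) (lo - 1) (code X) l) (8 * S + 20).
Proof.
move=> h1 h2; have := @exec_probe _ _ isL isR lo S Js Jc Jp marked tog_g _ (R i z g e m h) _ s c p _ (framed_mt _ _ _ _) (first_marked l h1 h2) _ (leqnn _).
have E : c_x (mt w s1 s2 (code X) (dgt l) X.1.2) = (in_sec lo S X, Some X.1.1) by rewrite -code_head.
by rewrite /tog_g E; apply; rewrite /= addbK.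
Qed.

Lemma exec_test_h i z g e m h (X : cfg) l : lo - 1 <= X.1.2 -> X.1.2 <= lo + S%:Z ->
  exec test_h (at_lev (R i z g e m h) (lo - 1) (code X) l)
    (at_lev (R i z g e m (h (+) ((i == ord_max) && stuck X.1.1 (in_sec lo S X)))) (lo - 1) (code X) l) (8 * S + 20).
Proof.
move=> h1 h2; have := @exec_probe _ _ isL isR lo S Js Jc Jp marked tog_h _ (R i z g e m h) _ s c p _ (framed_mt _ _ _ _) (first_marked l h1 h2) _ (leqnn _).
have E : c_x (mt w s1 s2 (code X) (dgt l) X.1.2) = (in_sec lo S X, Some X.1.1) by rewrite -code_head.
by rewrite /tog_h E; apply; rewrite /= addbK.
Qed.

Lemma code_inj (X Y : cfg) :
  (forall z, ~~ sec z -> X.2 z = blank M) -> (forall z, ~~ sec z -> Y.2 z = blank M) ->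
  sec Y.1.2 -> (forall z, sec z -> code X z = code Y z) -> X = Y.
Proof.
case: X Y => -[q h] t [[q' h'] t'] /= b1 b2 sh E.
have [_] := E _ sh; rewrite eqxx; case: eqP => // <- [->].
congr pair; apply: funext => z; case: (boolP (sec z)) => sz; last by rewrite b1 ?b2.
by have [] := E _ sz; rewrite sz => -[].
Qed.

Lemma exec_test_e i z g e m h (X Y : cfg) l : (l <= maxlev)%N -> s1 = code Y ->
  (forall z, ~~ sec z -> X.2 z = blank M) -> (forall z, ~~ sec z -> Y.2 z = blank M) ->
  sec Y.1.2 -> exists e' : bool,
  (e' <-> (X, l, i) = (Y, 0%N, ord0)) /\
  exec test_e (at_lev (R i z g e m h) (lo - 1) (code X) l)
    (at_lev (R i z g (e (+) e') m h) (lo - 1) (code X) l) (8 * S + 20).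
Proof.
move=> lm s1Y b1 b2 sY.
have [q fs] : exists q, first_stop lo S differs (mt w s1 s2 (code X) (dgt l)) q.
  apply: (@first_stop_ex _ _ _ _ _ (lo + S%:Z)); rewrite /differs ?not_isL //=; try by lia.
  by rewrite isR_mt ?eqxx //; lia.
exists ((i == ord0) && isR (mt w s1 s2 (code X) (dgt l) q)); split; last first.
  have := @exec_probe _ _ isL isR lo S Js Jc Jp differs tog_e q (R i z g e m h) _ s c p _ (framed_mt _ _ _ _) fs _ (leqnn _).
  by apply; rewrite /= addbK.
have [q1 q2 /andP[nL dq] before] := fs.
have inner (y : int) : lo <= y -> y < lo + S%:Z -> isL (mt w s1 s2 (code X) (dgt l) y) = false /\ isR (mt w s1 s2 (code X) (dgt l) y) = false.
  by move=> y1 y2; rewrite isL_mt ?isR_mt; lia.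
split=> [/andP[/eqP -> Rq]|[XY l0 ->]].
  have qR : q = lo + S%:Z.
    by move: Rq; rewrite isR_mt // => /eqP.
  have same (y : int) : sec y -> code X y = code Y y /\ (dgt l y != None -> dgt l y = Some ord0).
    case/andP=> y1 y2; have [iL iR] := inner _ y1 y2.
    have := before y; rewrite /differs iL iR /= s1Y => H.
    have z1 : lo - 1 <= y by clear -y1; lia.
    have z2 : y < q by rewrite qR.
    have {H} := H z1 z2; rewrite negb_or negbK negb_and => /andP[/eqP -> H]; split=> // dy.
    by move: H; rewrite dy /= negbK => /eqP.
  congr (_, _, _); first by apply: code_inj => // y /same[].
  have pos : (0 < B.+1 ^ nd)%N by rewrite expn_gt0.
  apply: (@digits_inj B nd); [lia|lia|move=> j jn; rewrite digit_zero].
  have [|_] := same (lo + j%:Z); first by apply/andP; split; lia.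
  rewrite /dgt; have -> : (lo <= lo + j%:Z) && (lo + j%:Z < lo + nd%:Z) by lia.
  have -> : `|(lo + j%:Z - lo)%R|%N = j by lia.
  by move=> /(_ isT)[E]; rewrite -(inordK (digit_lt B l j)) E.
rewrite eqxx /=; apply: contraTT dq => nR; rewrite (negbTE nR) /= s1Y XY eqxx /= negb_and !negbK.
rewrite l0 /dgt; case: ifP => //= _; rewrite digit_zero.
by apply/eqP; congr Some; apply: val_inj; rewrite /= inordK.
Qed.

Lemma firedE q a i r : rule_at i = Some r -> fires q a r -> fired q a = Some i.
Proof.
move=> ir fr; rewrite /fired; case: pickP => [j|/(_ i)]; last by rewrite ir fr.
case jr: (rule_at j) => [r'|//] fr'; congr Some; apply: rule_at_inj (jr) _.
by rewrite (fires_inj detM (rule_atP jr) (rule_atP ir) fr' fr).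
Qed.

Lemma upd_mt h d (x' : slot) (d' : option 'I_B.+1) x :
  upd (mt w s1 s2 x d) h (w h, s1 h, s2 h, x', d', None) = mt w s1 s2 (upd x h x') (upd d h d').
Proof. by apply: funext => z; rewrite /upd /mt; case: eqP => [->|]. Qed.

Lemma exec_undo_step i z e m h (X : cfg) l :
  lo - 1 <= X.1.2 -> X.1.2 <= lo + S%:Z -> child lo S i X ->
  exec undo_step (at_lev (R i z true e m h) (lo - 1) (code X) l)
    (at_lev (R ord_max z false e m h) (lo - 1) (code (pred_cfg i X)) l) (8 * S + 21).
Proof.
move=> h1 h2 ci; have [r [ir rM fr]] := child_fires ci.
have fE := firedE ir fr.
have goL (x : cfg) : first_stop lo S marked (mt w s1 s2 (code x) (dgt l)) x.1.2 ->
    exec (undo (goR isL marked)) (at_lev (R ord_max z false e m h) x.1.2 (code x) l)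
      (at_lev (R ord_max z false e m h) (lo - 1) (code x) l) (4 * S + 7).
  by move=> fs; apply: exec_goL => //; exact: framed_mt.
have goR' : exec (goR isL marked) (at_lev (R i z true e m h) (lo - 1) (code X) l)
      (at_lev (R i z true e m h) X.1.2 (code X) l) (4 * S + 7).
  by apply: exec_goR (first_marked l h1 h2) _ => //; exact: framed_mt.
have sh : sec X.1.2.
  move: ci; rewrite /child /undoable ir /in_sec; case: ifP => // _ /andP[_].
  by case: (act r ord0) => [[? ?]|?].
have [sh1 sh2] := andP sh.
have JX (t : int -> cell) : in_range lo S (X.1.2, t) by split=> /=; lia.
have JP (t : int -> cell) : in_range lo S ((pred_cfg i X).1.2, t).
  rewrite /pred_cfg ir; case: (act r ord0) => [[? ?]|d] //=.
  by split=> /=; rewrite /shift; case: d; lia.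
have fs' : first_stop lo S marked (mt w s1 s2 (code (pred_cfg i X)) (dgt l)) (pred_cfg i X).1.2.
  by have [] := JP (mt w s1 s2 (code X) (dgt l)); exact: first_marked.
apply: (exec_seq goR' (b2 := (4 * S + 13)%N)); last by lia.
move: (goL _ fs') => goL'; move: ci fE fr JP goL'.
rewrite /child /undoable /pred_cfg ir; case: X {goR' goL fs'} h1 h2 sh sh1 sh2 JX => -[q y] t /= h1 h2 sh sh1 sh2 JX.
case E: (act r ord0) => [[a b]|d] /andP[/eqP rq ar] fE fr JP goL'; rewrite /in_sec /= in fE ar.
- have xE : code (q, y, t) y = (Some b, Some q).
    by move: ar; rewrite /code /= sh eqxx => /eqP ->.
  have cE : upd (code (q, y, t)) y (Some a, Some (source r)) = code (source r, y, upd t y a).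
    by apply: funext => v; rewrite /upd /code /=; case: (v =P y) => [->|//]; rewrite sh.
  have {}fE : fired (source r) (Some a) = Some i by move: fE; rewrite sh /upd eqxx.
  have mtE : upd (mt w s1 s2 (code (q, y, t)) (dgt l)) y
      (w y, s1 y, s2 y, (Some a, Some (source r)), dgt l y, None) = mt w s1 s2 (code (source r, y, upd t y a)) (dgt l).
    by rewrite upd_mt cE upd_id.
  apply: (exec_seq (s1 := at_lev (R ord_max z false e m h) y (code (source r, y, upd t y a)) l) (b1 := 1) (b2 := (4 * S + 11)%N)); [| |lia].
    rewrite -mtE; apply: exec_rw_m; rewrite ?mtE //.
      by rewrite /leave /mt xE ir E.
    by rewrite /unleave /= fE ir E /mt xE rq.
  apply: (exec_seq (b1 := 1) (b2 := (4 * S + 9)%N)); [by apply: exec_mvd0_m (JX _)| |lia].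
  apply: (exec_seq (b1 := 1) (b2 := (4 * S + 7)%N)); [|exact: goL'|lia].
  apply: exec_rwid_m (JX _); first by [].
  rewrite /unarrive /mt.
  have -> : code (source r, y, upd t y a) y = (Some a, Some (source r)).
    by rewrite /code /= sh eqxx /upd eqxx.
  by rewrite /= fE ir E.
- pose k := if sec y then Some (t y) else None.
  have xE : code (q, y, t) y = (k, Some q) by rewrite /code /= eqxx.
  set x1 := upd (code (q, y, t)) y (k, None).
  have mtE : upd (mt w s1 s2 (code (q, y, t)) (dgt l)) y
      (w y, s1 y, s2 y, (k, None), dgt l y, None) = mt w s1 s2 x1 (dgt l).
    by rewrite upd_mt upd_id.
  apply: (exec_seq (s1 := at_lev (R i z true e m h) y x1 l) (b1 := 1) (b2 := (4 * S + 11)%N)); [| |lia].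
    rewrite -mtE; apply: exec_rw_m; rewrite ?mtE //.
      by rewrite /leave /mt xE ir E.
    by rewrite /unleave /mt ir rq xE.
  have yd : y + shift (~~ d) = y - shift d by case: d {E fE JP goL' fr}; rewrite /shift /=; lia.
  apply: (exec_seq (b1 := 1) (b2 := (4 * S + 9)%N)); [| |lia].
    apply: exec_mvd_m; [by rewrite /= ir E|exact: JX|rewrite yd; exact: JP].
  rewrite yd; apply: (exec_seq (b1 := 1) (b2 := (4 * S + 7)%N)); [|exact: goL'|lia].
  set y' := y - shift d in JP goL' fE fr *.
  (* The two squares differ, so writing the state at [y'] does not disturb the square that [leave]
     has cleared. *)
  have yy : (y' == y) = false by rewrite /y'; case: d {E fE JP goL' fr yd y'}; rewrite /shift /=; lia.
  have cE : upd x1 y' ((x1 y').1, Some (source r)) = code (source r, y', t).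
    apply: funext => v; rewrite /upd /x1 /upd yy /code /=.
    by case: (v =P y') => [->//|_]; case: (v =P y) => [->|].
  have x1E : (x1 y').2 = None by rewrite /x1 /upd yy /code /= yy.
  have x1E' : (x1 y').1 = if sec y' then Some (t y') else None by rewrite /x1 /upd yy.
  have mtE' : upd (mt w s1 s2 x1 (dgt l)) y'
      (w y', s1 y', s2 y', ((x1 y').1, Some (source r)), dgt l y', None) = mt w s1 s2 (code (source r, y', t)) (dgt l).
    by rewrite upd_mt cE upd_id.
  rewrite -mtE'; apply: exec_rw_m.
  + by rewrite /arrive /mt ir.
  + by rewrite /unarrive /= x1E' fE ir E /mt -x1E' -x1E -surjective_pairing.
  + exact: JP.
  + exact: JP.
Qed.

Lemma dgt_at l (j : nat) : (j < nd)%N -> dgt l (lo + j%:Z) = Some (inord (digit B l j)).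
Proof.
move=> jn; rewrite /dgt; have -> : (lo <= lo + j%:Z) && (lo + j%:Z < lo + nd%:Z) by lia.
by have -> : `|(lo + j%:Z - lo)%R|%N = j by lia.
Qed.

Lemma exec_dec_level r x l : (l < maxlev)%N ->
  exec dec_level (at_lev r (lo - 1) x l.+1) (at_lev r (lo - 1) x l) (10 * S + 19).
Proof.
move=> lm; have pos : (0 < B.+1 ^ nd)%N by rewrite expn_gt0.
have [j [jn dj dlt]] : exists j, [/\ (j < nd)%N, digit B l.+1 j <> 0%N & forall i, (i < j)%N -> digit B l.+1 i = 0%N].
  by apply: lowest_digit => //; lia.
have [dB dj1 dgt1] := digit_pred dlt dj.
have pos_j (z : int) : lo - 1 <= z -> z < lo + j%:Z -> z = lo - 1 \/ exists2 i, (i < j)%N & z = lo + i%:Z.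
  move=> z1 z2; case: (z =P lo - 1) => [->|zl]; [by left|right].
  by exists `|(z - lo)%R|%N; lia.
have dgtL k : dgt k (lo - 1) = None by rewrite /dgt; case: ifP => //; lia.
have in0 : inord 0 = ord0 :> 'I_B.+1 by apply: val_inj; rewrite /= inordK.
have inB : inord B = ord_max :> 'I_B.+1 by apply: val_inj; rewrite /= inordK.
(* The counter between the two scans: borrowed digits already maximal, the digit at [j] not yet
   decremented. *)
pose dgm (z : int) := if (lo <= z) && (z < lo + j%:Z) then Some ord_max else dgt l.+1 z.
have dgmL : dgm (lo - 1) = None by rewrite /dgm dgtL; case: ifP => //; lia.
have dgm_i i : (i < j)%N -> dgm (lo + i%:Z) = Some ord_max.
  by move=> ij; rewrite /dgm; have -> : (lo <= lo + i%:Z) && (lo + i%:Z < lo + j%:Z) by lia.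
have dgm_j : dgm (lo + j%:Z) = Some (inord (digit B l j).+1).
  rewrite /dgm; have -> : (lo <= lo + j%:Z) && (lo + j%:Z < lo + j%:Z) = false by lia.
  by rewrite dgt_at // dj1.
have dl : dgt l = upd dgm (lo + j%:Z) (Some (inord (digit B l j))).
  apply: funext => z; rewrite /upd; case: eqP => [->|zj]; first by rewrite dgt_at.
  rewrite /dgm; case: ifP => [zlt|zge].
    have -> : z = lo + `|(z - lo)%R|%:Z by lia.
    by rewrite dgt_at ?dB ?inB //; lia.
  rewrite /dgt; case: ifP => // zn; congr (Some (inord _)); apply: dgt1; lia.
have ltB := digit_lt B l.+1 j.
have fs : first_stop lo S not_zero (mt w s1 s2 x (dgt l.+1)) (lo + j%:Z).
  split; try lia.
    rewrite /not_zero isL_mt /=; try lia; apply/andP; split; first by lia.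
    rewrite dgt_at //; apply/eqP => -[] /(congr1 val) /=; rewrite inordK //.
  move=> z z1 z2; rewrite /not_zero isL_mt /=; try lia.
  case: (pos_j z z1 z2) => [->|[i ij ->]]; first by rewrite eqxx.
  by rewrite dgt_at ?dlt ?in0 ?eqxx ?andbF //; lia.
have fs' : first_stop lo S not_max (mt w s1 s2 x (dgt l)) (lo + j%:Z).
  split; try lia.
    rewrite /not_max isL_mt /=; try lia; apply/andP; split; first by lia.
    by rewrite dgt_at //; apply/eqP => -[] /(congr1 val) /=; rewrite inordK; lia.
  move=> z z1 z2; rewrite /not_max isL_mt /=; try lia.
  case: (pos_j z z1 z2) => [->|[i ij ->]]; first by rewrite eqxx.
  by rewrite dgt_at ?dB ?inB ?eqxx ?andbF //; lia.
apply: (exec_seq (s1 := mk r (lo + j%:Z, mt w s1 s2 x dgm) s c p) (b1 := (6 * S + 9)%N) (b2 := (4 * S + 9)%N)); [| |lia].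
  apply: exec_pass; [exact: framed_mt|exact: framed_mt|exact: fs| | |by []].
    move=> z z1 z2; rewrite /borrow /unborrow /mt.
    case: (pos_j z z1 z2) => [->|[i ij ->]]; first by rewrite dgtL dgmL.
    by rewrite dgm_i // dgt_at ?dlt ?in0 ?eqxx //; lia.
  move=> z zout; rewrite /mt; congr (_, _); congr (_, _); rewrite /dgm.
  by case: ifP => // zin; lia.
apply: (exec_seq (s1 := mk r (lo + j%:Z, mt w s1 s2 x (dgt l)) s c p) (b1 := 1) (b2 := (4 * S + 7)%N)); [| |lia].
  have mtE : upd (mt w s1 s2 x dgm) (lo + j%:Z) (w (lo + j%:Z), s1 (lo + j%:Z), s2 (lo + j%:Z), x (lo + j%:Z), Some (inord (digit B l j)), None) = mt w s1 s2 x (dgt l).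
    by rewrite upd_mt upd_id dl.
  have pE : ord_pred (inord (digit B l j).+1) = inord (digit B l j) :> 'I_B.+1.
    apply: val_inj; rewrite /= !inordK; try lia.
    by rewrite addSn /= modnDr modn_small //; lia.
  rewrite -mtE; apply: exec_rw_m.
  - by rewrite /decr /mt dgm_j /= pE.
  - by rewrite /incr /mt dgm_j /= -pE ord_predK.
  - by split=> /=; lia.
  - by split=> /=; lia.
by apply: exec_goL fs' _ => //; exact: framed_mt.
Qed.

Lemma exec_down i z e m h (X : cfg) l : (l < maxlev)%N ->
  lo - 1 <= X.1.2 -> X.1.2 <= lo + S%:Z -> child lo S i X ->
  exec down (at_lev (R i z true e m h) (lo - 1) (code X) l.+1)
    (at_lev (R ord_max z false e m h) (lo - 1) (code (pred_cfg i X)) l) (18 * S + 41).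
Proof.
move=> lm h1 h2 ci; apply: (exec_seq (exec_undo_step z e m h l.+1 h1 h2 ci) (exec_dec_level _ _ lm)); lia.
Qed.

Notation tstate := (cfg * nat * I)%type.
Notation tour_ok := (tour_ok lo S maxlev).
Notation tour := (tour lo S maxlev).

Definition tour_reg (e m h : bool) (u : tstate) : store 4 cell reg :=
  at_lev (R u.2 false false e m h) (lo - 1) (code u.1.1) u.1.2.

Lemma exec_flip_rotate u u' : tour_ok u -> tour_ok u' -> tour u u' ->
  exec (flip ;; Rw tm rotate unrotate) (tour_reg false false false u) (tour_reg false false false u') (50 * S + 140).
Proof.
have Jlo (t : int -> cell) : in_range lo S (lo - 1, t) by split=> /=; lia.
move=> ok ok' T.
suff H : exec flip (tour_reg false false false u)
    (at_lev (R (ord_pred u'.2) false false false false false) (lo - 1) (code u'.1.1) u'.1.2) (50 * S + 137).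
  apply: (exec_seq H (b2 := 1)); last by lia.
  by apply: exec_rwid_m (Jlo _); rewrite /= ?ord_predK ?ordSK.
(* The closing tests toggle by the values at the far end, so the middle step must deliver exactly
   these: [g] changes across an edge, [z] does not. The index is still the one before the
   rotation. *)
suff : exists z g z' g' : bool, let i' := ord_pred u'.2 in
  [/\ z = (u.2 != ord_max) && (u.1.2 == 0%N), g = ~~ z && child lo S u.2 u.1.1,
      z' = (i' != ord_max) && (u'.1.2 == 0%N), g' = ~~ z' && child lo S i' u'.1.1 &
      z' = z /\
     exec (If at_max (undo down) (If has_child down skip at_max) has_child)
      (at_lev (R u.2 z g false false false) (lo - 1) (code u.1.1) u.1.2)
      (at_lev (R i' z' g' false false false) (lo - 1) (code u'.1.1) u'.1.2) (18 * S + 45)].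
  move=> [z [g [z' [g' [zE gE zE' gE' [zz H]]]]]].
  case: ok ok' => [l1 h1 h2 _] [l2 k1 k2 _].
  apply: (exec_seq (exec_test_z u.2 false false false false false (code u.1.1) l1) (b2 := (42 * S + 116)%N)); last by lia.
  rewrite /= -zE.
  apply: (exec_seq (exec_test_g u.2 z false false false false u.1.2 h1 h2) (b2 := (34 * S + 95)%N)); last by lia.
  rewrite /= -gE.
  apply: (exec_seq H (b2 := (16 * S + 49)%N)); last by lia.
  apply: (exec_seq (exec_test_g _ _ _ _ _ _ _ k1 k2) (b2 := (8 * S + 20)%N)); last by lia.
  rewrite -gE' addbb.
  have := exec_test_z (ord_pred u'.2) z' false false false false (code u'.1.1) l2.
  by rewrite -zE' addbb.
case: _ _ / T ok ok' => [X l i ci|X l i im nc|X l i ci lm] [/= lm' h1 h2 _] [/= lm2 k1 k2 _].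
- have im : (i == ord_max) = false by apply/eqP => E; rewrite E child_max in ci.
  have -> : ord_pred (ord0 : I) = ord_max by apply: val_inj; rewrite /= modn_small.
  exists false, true, false, false; rewrite /= eqxx child_max ci im; split=> //; split=> //.
  apply: (exec_if0 (b1 := (18 * S + 43)%N)); [by rewrite /holds /= im| |by []|lia].
  apply: (exec_if1 (b1 := (18 * S + 41)%N)); [by []|exact: exec_down|by rewrite /holds /= eqxx|lia].
- rewrite ordSK im /=; exists (l == 0%N), false, (l == 0%N), false.
  have E : false = (l != 0%N) && child lo S i X by apply/esym/negbTE; rewrite -lt0n.
  split=> //; split=> //.
  apply: (exec_if0 (b1 := (18 * S + 43)%N)); [by rewrite /holds /= (negbTE im)| |by []|lia].
  apply: (exec_if0 (b1 := 1)); [by []|exact: exec_skip (Jlo _)|by rewrite /holds /= (negbTE im)|lia].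
- have im : (i == ord_max) = false by apply/eqP => E; rewrite E child_max in ci.
  rewrite ordSK eqxx child_max /= im /=; exists false, false, false, true.
  split=> //; split=> //.
  apply: (exec_if1 (b1 := (18 * S + 41)%N)); [by rewrite /holds /= eqxx| |by []|lia].
  by apply: exec_undo; apply: exec_down.
Qed.

(** The exit test stays false as long as a step is possible: a state about to step either has an
    index below [ord_max], or goes up, from below the maximal level and along a rule that fires. *)
Lemma tour_source (u v : tstate) : tour u v ->
  ((u.2 == ord_max) && (u.1.2 == maxlev) = false) /\
  ((u.2 == ord_max) && stuck u.1.1.1.1 (in_sec lo S u.1.1) = false).
Proof.
case=> [X l i ci|X l i im nc|X l i ci lm] /=; try by rewrite (negbTE im).
  by have -> : (i == ord_max) = false by apply/eqP => E; rewrite E child_max in ci.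
rewrite eqxx /=; split; first by lia.
have [r [_ rM fr]] := child_fires ci.
by apply/negP => /forallP/(_ r)/implyP/(_ rM); rewrite fr.
Qed.

Lemma tours_ok n (u v : tstate) : tours lo S maxlev n u v -> tour_ok u /\ tour_ok v.
Proof. by elim=> // {}n s0 s3 s4 ok _ _ []. Qed.

Section Tour.
Variable Y : cfg.
Hypotheses (s1_Y : s1 = code Y) (Y_blank : forall z, ~~ sec z -> Y.2 z = blank M).
Hypothesis Y_sec : sec Y.1.2.

Lemma exec_tests (e : bool) (u : tstate) : tour_ok u -> (e <-> u = (Y, 0%N, ord0)) ->
  exec (test_e ;; test_m ;; test_h) (tour_reg e false false u)
   (tour_reg false ((u.2 == ord_max) && (u.1.2 == maxlev))
      ((u.2 == ord_max) && stuck u.1.1.1.1 (in_sec lo S u.1.1)) u) (24 * S + 62).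
Proof.
case: u => -[X l] i [/= lm h1 h2 Xb] eE.
have [e' [e'E H]] := exec_test_e i false false e false false lm s1_Y Xb Y_blank Y_sec.
have ee : e = e' by apply/idP/idP => [/eE/e'E|/e'E/eE].
apply: (exec_seq H (b2 := (16 * S + 41)%N)); last by lia.
rewrite ee addbb; apply: (exec_seq (exec_test_m _ _ _ _ _ _ _ lm) (b2 := (8 * S + 20)%N)); last by lia.
exact: exec_test_h.
Qed.

Lemma tour_chain n (e : bool) (u u' : tstate) : tours lo S maxlev n u u' ->
  u'.2 = ord_max -> (u'.1.2 == maxlev) || stuck u'.1.1.1.1 (in_sec lo S u'.1.1) ->
  (e <-> u = (Y, 0%N, ord0)) ->
  (forall j v, tours lo S maxlev j.+1 u v -> v <> (Y, 0%N, ord0)) ->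
  chain (exec (test_e ;; test_m ;; test_h)) (exec ((flip ;; Rw tm rotate unrotate) ;; test_e))
    starting finished (tour_reg e false false u)
    (tour_reg false (u'.1.2 == maxlev) (stuck u'.1.1.1.1 (in_sec lo S u'.1.1)) u')
    (n.+1 * (82 * S + 230)).
Proof.
move=> T max' fin' ; elim: n e u T => [|n IH] e u T eE fresh; have [ok ok'] := tours_ok T.
  have /= E := toursE T; subst u'.
  apply: Chain1; have := exec_tests ok eE; rewrite max' eqxx /=.
  by move/exec_le; apply; lia.
have /= [v Tv T'] := toursE T; have [okv _] := tours_ok T'.
have [uE1 uE2] := tour_source Tv.
have := exec_tests ok eE; rewrite uE1 uE2 => H1.
have vY : v <> (Y, 0%N, ord0) by apply: (fresh 0%N); apply: tours1.
have [e' [e'E H2]] : exists e' : bool, (e' <-> v = (Y, 0%N, ord0)) /\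
   exec test_e (tour_reg false false false v) (tour_reg (false (+) e') false false v) (8 * S + 20).
  case: v vY okv {Tv T'} => -[X l] i _ [/= lm _ _ Xb]; exact: exec_test_e.
have {e'E} e'F : e' = false by apply/negP => /e'E.
rewrite e'F in H2.
apply: (ChainS (b1 := (24 * S + 62)%N) (b2 := (58 * S + 162)%N) H1 _ (exec_seq (exec_flip_rotate ok okv Tv) H2 _) _ (IH false v T' _ _)).
- by rewrite /holds /=; case: eqP; rewrite ?andbF.
- by lia.
- by [].
- by [].
- by move=> j v' Tj; apply: (fresh j.+1); apply: TourS Tj.
- by rewrite [in X in (_ <= X)%N]mulSn; lia.
Qed.

Lemma exec_tour n (X : cfg) l : tours lo S maxlev n (Y, 0%N, ord0) (X, l, ord_max) ->
  (l == maxlev) || stuck X.1.1 (in_sec lo S X) ->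
  exec tour_prog (at_lev (R ord0 false false false false false) (lo - 1) (code Y) 0)
    (at_lev (R ord_max false false false (l == maxlev) (stuck X.1.1 (in_sec lo S X))) (lo - 1) (code X) l)
    (n.+1 * (82 * S + 230) + 4).
Proof.
have Jlo (t : int -> cell) : in_range lo S (lo - 1, t) by split=> /=; lia.
move=> T fin.
apply: (exec_seq (s1 := tour_reg true false false (Y, 0%N, ord0)) (b1 := 1) (b2 := (n.+1 * (82 * S + 230) + 2)%N)); [| |lia].
  exact: exec_rwid_m (Jlo _).
apply: (exec_loop (b1 := (n.+1 * (82 * S + 230))%N)); [by []| |by rewrite /holds /= eqxx|by []].
apply: (@tour_chain n true _ _ T) => //= j v Tj vY; rewrite vY in Tj.
(* A return to the start would be a cycle, impossible since the final state has no successor. *)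
apply: (tours_norevisit detM T _ Tj) => v' /tour_source /= [].
by rewrite eqxx /=; case: (l == maxlev) fin => //= ->.
Qed.

End Tour.
End Correctness.

Section Advance.
Variables (lo : int) (S nd : nat) (Js Jc Jp : tape cell -> Prop).
Variables (w : int -> io) (s c p : tape cell) (o : O).
Hypothesis nd_le : (nd <= S)%N.
Hypothesis w_framed : io_framed lo S w.

Notation maxlev := (B.+1 ^ nd).-1.
Definition rest_reg : reg := ((ord0, false, false, false, false, false), o).
Definition rest s1 s2 := mk rest_reg (lo - 1, mt w s1 s2 (fun=> slot0) (dgt lo nd 0)) s c p.

Lemma code_out (X : cfg) z : in_section lo S X.1.2 -> ~~ in_section lo S z -> code lo S X z = slot0.
Proof.
by move=> sX sz; rewrite /code (negbTE sz); case: eqP => // E; rewrite E sX in sz.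
Qed.

(** The flag [d] covers both uses of the same program: filling an empty slot with the configuration
    reached, and emptying a slot that holds it. *)
Lemma exec_advance n (X Y : cfg) l (d : bool) :
  (forall z, ~~ in_section lo S z -> Y.2 z = blank M) ->
  in_section lo S X.1.2 -> in_section lo S Y.1.2 ->
  tours lo S maxlev n (Y, 0%N, ord0) (X, l, ord_max) ->
  (l == maxlev) || stuck X.1.1 (in_sec lo S X) ->
  @exec 4 cell reg tp (sel (in_range lo S) Js Jc Jp) advance
    (rest (code lo S Y) (if d then code lo S X else fun=> slot0))
    (rest (code lo S Y) (if d then fun=> slot0 else code lo S X))
    (n.+1 * (164 * S + 460) + (30 * S + 100)).
Proof.
move=> Yb sX sY T fin.
have H s2 : @exec 4 cell reg tp (sel (in_range lo S) Js Jc Jp)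
    (sweep isL isR copy_x copy_x ;; tour_prog) (rest (code lo S Y) s2)
    (mk ((ord_max, false, false, false, l == maxlev, stuck X.1.1 (in_sec lo S X)), o)
      (lo - 1, mt w (code lo S Y) s2 (code lo S X) (dgt lo nd l)) s c p)
    (n.+1 * (82 * S + 230) + (10 * S + 25)).
  apply: (exec_seq (b1 := (10 * S + 20)%N) (b2 := (n.+1 * (82 * S + 230) + 4)%N)); [|by apply: exec_tour T fin|lia].
  apply: exec_sweep => //.
  - move=> z _ _; rewrite /copy_x /mt eqxx; split=> //.
    by case: eqP => [->|_]; rewrite ?eqxx.
  - by move=> z zo; rewrite /mt code_out // /in_section; lia.
apply: (exec_seq (H _) (b2 := (n.+1 * (82 * S + 230) + (20 * S + 50))%N)); last by lia.
apply: (exec_seq (b1 := (10 * S + 20)%N) _ (exec_undo (H _))); last by lia.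
apply: exec_sweep => //.
- move=> z _ _; rewrite /copy_s2 /mt; case: d; split=> //; rewrite ?eqxx //;
  by case: (code lo S X z =P slot0) => [->|_]; rewrite ?eqxx.
- move=> z zo; rewrite /mt; have oX : code lo S X z = slot0 by rewrite code_out // /in_section; lia.
  by case: d; rewrite oX.
Qed.

End Advance.
End BaseLevel.

(** * The halting run of [M], cut into segments *)

Lemma step_det (M : machine 1) (detM : deterministic M) (c d d' : config M) :
  step c d -> step c d' -> d = d'.
Proof.
move=> [r [rM /andP[/eqP sr /forallP/(_ ord0) ar] ->]] [r' [rM' /andP[/eqP sr' /forallP/(_ ord0) ar'] ->]].
suff -> : r = r' by [].
apply: (fires_inj detM rM rM' (q := cstate c) (a := Some (ctape c ord0 (chead c ord0)))).
  by rewrite /fires sr eqxx /=; case: (act r ord0) ar => [[a b]|] // /eqP ->.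
by rewrite /fires sr' eqxx /=; case: (act r' ord0) ar' => [[a b]|] // /eqP ->.
Qed.

Lemma cfg_of_inj (M : machine 1) : injective (@cfg_of M).
Proof.
move=> [q h t] [q' h' t'] [/= -> hh tt]; congr Config; apply: funext => i; by rewrite (ord1 i).
Qed.

Section Run.
Variables (M : machine 1) (detM : deterministic M) (x : seq (symbol M)).
Variables (T S : nat) (lo : int) (c : nat -> config M).
Hypotheses (c0 : c 0%N = init1 x) (cT : halting_run c T) (lo0 : lo <= 0).
Hypothesis x_le : (size x)%:Z <= lo + S%:Z.
Hypothesis heads : forall t, (t <= T)%N -> in_section lo S (chead (c t) ord0).

Notation cf t := (cfg_of (c t)).

Lemma run_blank t z : (t <= T)%N -> ~~ in_section lo S z -> (cf t).2 z = blank M.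
Proof.
elim: t z => [|t IH] z tT sz.
  rewrite c0 /=; case: z sz => [j|//] sz; rewrite /= nth_default //.
  by move: sz; rewrite /in_section; lia.
have [r [_ _ ->]] := cT.1 t tT; rewrite /= /apply_rule /=.
case: (act r ord0) => [[a b]|d]; last exact: IH (ltnW tT) sz.
case: eqP => [E|_]; last exact: IH (ltnW tT) sz.
by rewrite E heads ?(ltnW tT) in sz.
Qed.

Lemma run_pred t : (t < T)%N -> exists i, child lo S i (cf t.+1) /\ pred_cfg i (cf t.+1) = cf t.
Proof. by move=> tT; apply: step_pred_cfg; [exact: cT.1|exact: heads]. Qed.

(** By determinism a repetition would persist up to the end, and the halting configuration would
    have a successor. *)
Lemma run_inj s t : (s < t)%N -> (t <= T)%N -> cf s <> cf t.
Proof.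
move=> st tT /cfg_of_inj E.
have shift_eq j : (t + j <= T)%N -> c (s + j)%N = c (t + j)%N.
  elim: j => [|j IH] le; first by rewrite !addn0.
  have le' : (t + j <= T)%N by lia.
  rewrite !addnS; apply: (step_det detM (c := c (s + j)%N)); first by apply: cT.1; lia.
  by rewrite IH //; apply: cT.1; lia.
have := shift_eq (T - t)%N; rewrite subnKC // => /(_ (leqnn _)) E'.
apply: (cT.2 (c (s + (T - t)).+1)); rewrite -E'.
by apply: cT.1; lia.
Qed.

(** Pigeonhole on the state, the head position and the contents of the section, as the tape is blank
    elsewhere. This bounds the length of the level counter. *)
Lemma run_count : (T < #|state M| * S * #|symbol M| ^ S)%N.
Proof.
have S0 : (0 < S)%N by have := heads (leq0n T); rewrite /in_section; lia.
case: S S0 x_le heads run_blank run_inj => // S1 _ _ hd bl inj.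
pose f (t : 'I_T.+1) : state M * 'I_S1.+1 * {ffun 'I_S1.+1 -> symbol M} :=
  (cstate (c t), inord `|(chead (c t) ord0 - lo)%R|,
   [ffun j : 'I_S1.+1 => ctape (c t) ord0 (lo + (j : nat)%:Z)]).
have tT (t : 'I_T.+1) : (t <= T)%N by rewrite -ltnS.
have f_cf (s t : 'I_T.+1) : f s = f t -> cf s = cf t.
  move=> [qE hE tE]; rewrite /cfg_of qE.
  have hd1 := andP (hd s (tT s)); have hd2 := andP (hd t (tT t)).
  have -> : chead (c s) ord0 = chead (c t) ord0.
    by move: (congr1 val hE); rewrite /= !inordK; lia.
  congr pair; apply: funext => z; case: (boolP (in_section lo S1.+1 z)) => sz.
    have zl : (`|(z - lo)%R| < S1.+1)%N by move: sz; rewrite /in_section; lia.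
    move: (congr1 (fun g : {ffun _ -> _} => g (Ordinal zl)) tE); rewrite !ffunE /=.
    by have -> : lo + `|(z - lo)%R|%:Z = z by move: sz; rewrite /in_section; lia.
  by have /= -> := bl _ _ (tT s) sz; have /= -> := bl _ _ (tT t) sz.
have f_inj : injective f.
  move=> s t /f_cf E; apply: val_inj => /=; case: (ltngtP s t) => // st.
    by case: (inj _ _ st (tT t)).
  by case: (inj _ _ st (tT s)).
by have := leq_card f f_inj; rewrite card_ord !card_prod card_ffun !card_ord.
Qed.

Section RunAdvance.
Variables (B nd : nat) (O : finType) (Js Jc Jp : tape (cell M B) -> Prop).
Variables (w : int -> io M) (st ct pt : tape (cell M B)) (o : O).
Hypothesis nd_le : (nd <= S)%N.
Hypothesis w_framed : io_framed lo S w.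

(** The largest level that [nd] digits express, so that full depth shows as all digits maximal. *)
Definition segment : nat := (B.+1 ^ nd).-1.

Definition segment_time : nat :=
  ((segment.+1 * (subtree_bound M segment).+1).+1 * (164 * S + 460) + (30 * S + 100))%N.

Notation code t := (code lo S (cf t)).
Notation slots s1 s2 := (@rest M B O lo nd w st ct pt o s1 s2).

Lemma exec_segment t (d : bool) : (t <= T)%N ->
  let t' := minn (t + segment) T in
  @exec 4 (cell M B) (reg M O) tp (sel (in_range lo S) Js Jc Jp) (advance M B O)
    (slots (code t) (if d then code t' else fun=> slot0 M))
    (slots (code t) (if d then fun=> slot0 M else code t')) segment_time.
Proof.
move=> tT t'; have [t1 t2] : (t <= t')%N /\ (t' <= T)%N by rewrite /t' leq_min geq_minr leq_addr tT.
have ts : (t' - t <= segment)%N by rewrite /t'; lia.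
have ok j : (j <= t' - t)%N -> tour_ok lo S segment (cf (t + j)%N, j, ord0).
  move=> jl; have hd : in_section lo S (chead (c (t + j)%N) ord0) by apply: heads; lia.
  split=> /=; first by lia.
  - by move: hd; rewrite /in_section; lia.
  - by move: hd; rewrite /in_section; lia.
  - by move=> z; apply: run_blank; lia.
have st' j : (j < t' - t)%N -> exists i, child lo S i (cf (t + j.+1)%N) /\ pred_cfg i (cf (t + j.+1)%N) = cf (t + j)%N.
  by move=> jl; rewrite addnS; apply: run_pred; lia.
have [N NE TT] := tour_path (C := fun j => cf (t + j)%N) ts ok st'.
rewrite addn0 subnKC // in TT.
(* The tour stops either at full depth or, when the run ends earlier, at the halted
   configuration. *)
have fin : (t' - t == segment)%N || stuck (cf t').1.1 (in_sec lo S (cf t')).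
  rewrite /t' /minn; case: ltnP => tm; first by rewrite addKn eqxx.
  by rewrite (halted_stuck cT.2) ?orbT //; apply: heads.
have := @exec_advance M detM B O lo S nd Js Jc Jp w st ct pt o nd_le w_framed N (cf t') (cf t) (t' - t)%N d.
move=> /(_ (fun z => run_blank tT) (heads t2) (heads tT) TT fin) /exec_le; apply.
rewrite /segment_time leq_add2r leq_mul2r ltnS; apply/orP; right.
by apply: (leq_trans NE); rewrite leq_mul2r; lia.
Qed.

End RunAdvance.
End Run.

(** * Concatenation of loops whose first branch is [skip] *)

Section SkipLoop.
Variables (Sy Rg : finType) (Jm Js Jc Jp : tape Sy -> Prop).
Notation exec := (@exec 4 Sy Rg tp (sel Jm Js Jc Jp)).

Lemma exec_skipE s s' b : exec skip s s' b -> s' = s.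
Proof.
case=> _ -> _; case: s => r t; rewrite /set_tape /=; congr Store; apply: funext => j.
by case: eqP => // ->; case: (t tm).
Qed.

(** Two skips in a row merge into one, so chains compose like paths. The single flat loop of the
    recursion is thereby assembled from the pieces that its calls contribute. *)
Lemma chain_skip_cat p e x s s1 s2 b1 b2 :
  chain (exec skip) (exec p) e x s s1 b1 -> chain (exec skip) (exec p) e x s1 s2 b2 ->
  chain (exec skip) (exec p) e x s s2 (b1 + b2).
Proof.
elim=> {s s1 b1} [s s1 b1 /exec_skipE -> C|s s0 s0' s1 a1 a2 a3 a S1 x0 P0 e0 _ IH le /IH C].
  case: C => [s3 s4 b3 S1|s3 s4 s5 s6 a1 a2 a3 a S1 x0 P0 e0 C le].
    by apply: Chain1; apply: (exec_le S1); lia.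
  by apply: ChainS S1 x0 P0 e0 C _; lia.
by apply: ChainS S1 x0 P0 e0 C _; lia.
Qed.

Lemma chain_skip1 p (e x : test 4 Sy Rg) s s1 b : Jm (tps s tm) -> Jm (tps s1 tm) ->
  ~~ holds x s -> exec p s s1 b -> ~~ holds e s1 ->
  chain (exec skip) (exec p) e x s s1 (b + 4).
Proof.
have sk u : Jm (tps u tm) -> exec skip u u 1.
  move=> Ju; case: u Ju => r t Ju; split=> //; rewrite /set_tape /=; congr Store; apply: funext => j.
  by case: eqP => // ->; case: (t tm).
move=> J0 J1 x0 H e0.
by apply: (ChainS (sk _ J0) x0 H e0 (Chain1 _ _ _ (sk _ J1))); lia.
Qed.

Lemma chain_skip_le p e x s s1 b b' :
  chain (exec skip) (exec p) e x s s1 b -> (b <= b')%N ->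
  chain (exec skip) (exec p) e x s s1 b'.
Proof.
case=> {s s1 b} [s s1 b S1 le|s s0 s0' s1 a1 a2 a3 a S1 x0 P0 e0 C le le'].
  by apply: Chain1; apply: (exec_le S1).
by apply: ChainS S1 x0 P0 e0 C _; lia.
Qed.

End SkipLoop.

(** * The recursion *)

Section Recursion.
Variables (M : machine 1) (detM : deterministic M) (B W : nat).

Notation slot := (slot M).
Notation slot0 := (slot0 M).
Notation cell := (cell M B).
Notation isL := (@isL M B).
Notation isR := (@isR M B).

(* The residue of the number of bits of T that have been scanned, whether k is
   0, the direction of the recursion (up or down), and a bit or a slot in transit
   between two tapes. *)
Definition oreg : finType := ('I_W.+1 * bool * bool * option bool * slot)%type.
Notation reg := (reg M oreg).
Notation prog := (prog 4 cell reg).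

Definition swap_hold (u : reg * cell) : reg * cell :=
  let: ((t, (r, kz, md, hb, f)), (i, s1, s2, x, d, p)) := u in
  ((t, (r, kz, md, hb, s1)), (i, f, s2, x, d, p)).

Notation perm3 := (slot * slot * slot -> slot * slot * slot).

Definition permute (pi : perm3) (u : reg * cell) : reg * cell :=
  let: ((t, (r, kz, md, hb, f)), (i, s1, s2, x, d, p)) := u in
  let: (s1', s2', f') := pi (s1, s2, f) in
  ((t, (r, kz, md, hb, f')), (i, s1', s2', x, d, p)).

Definition pi_swap : perm3 := fun u => (u.1.1, u.2, u.1.2).
Definition pi_cyc : perm3 := fun u => (u.1.2, u.2, u.1.1).
Definition pi_cyc' : perm3 := fun u => (u.2, u.1.1, u.1.2).

(** An [Rw] acts on one tape only, so slots on two tapes are permuted through the register [f],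
    which holds [slot0] before and after. *)
Definition xfer (pi pi' : perm3) : prog :=
  Rw ts swap_hold swap_hold ;; Rw tm (permute pi) (permute pi') ;; Rw ts swap_hold swap_hold.

(** Both heads advance together by [S.+1] squares, the left delimiter included. The main tape thus
    measures the frames, and the stack carries no markers. *)
Definition slide (pi pi' : perm3) : prog :=
  Loop (at_ tm (fun _ => isL)) skip (at_ tm (fun _ => isR))
    (xfer pi pi' ;; mv tm true ;; mv ts true) ;;
  undo (goR isL isR).

Definition L_end : ctl := Some None.
Definition ph0 : ctl := Some (Some (false, false)).
Definition ph1 : ctl := Some (Some (false, true)).
Definition ph2 : ctl := Some (Some (true, false)).
Definition ph3 : ctl := Some (Some (true, true)).

(* A level is entered (md = false) in phase 0, and resumed (md = true) in
   phases 1, 2, 3, when its three recursive calls return. *)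
Definition next_phase (u : reg * cell) : reg * cell :=
  let: ((t, (r, kz, md, hb, f)), (i, s1, s2, x, d, p)) := u in
  let: (md', p') :=
    match md, p with
    | false, None => (true, None)
    | false, Some (Some (false, false)) => (false, ph1)
    | true, Some (Some (false, true)) => (false, ph2)
    | true, Some (Some (true, false)) => (false, ph3)
    | true, Some (Some (true, true)) => (true, ph0)
    | _, _ => (md, p)
    end in
  ((t, (r, kz, md', hb, f)), (i, s1, s2, x, d, p')).

Definition prev_phase (u : reg * cell) : reg * cell :=
  let: ((t, (r, kz, md, hb, f)), (i, s1, s2, x, d, p)) := u in
  let: (md', p') :=
    match md, p with
    | true, None => (false, None)
    | false, Some (Some (false, true)) => (false, ph0)
    | false, Some (Some (true, false)) => (true, ph1)
    | false, Some (Some (true, true)) => (true, ph2)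
    | true, Some (Some (false, false)) => (true, ph3)
    | _, _ => (md, p)
    end in
  ((t, (r, kz, md', hb, f)), (i, s1, s2, x, d, p')).

Definition md_of (r : reg) : bool := let: (_, (_, _, md, _, _)) := r in md.
Definition at_phase (md : bool) (p : ctl) : test 4 cell reg :=
  at_ tc (fun r c => (md_of r == md) && (c_ph c == p)).

(** The undone slide with [id] only takes the stack head back to the base of the frame; the other
    one rotates the two arguments with the frame. *)
Definition cycle_slots : prog := undo (slide id id) ;; slide pi_cyc pi_cyc'.

(** The actions change neither the control square nor the direction, so each test also serves as the
    assertion of its branch. *)
Definition phase_action : prog :=
  If (at_phase false ph1) (slide pi_swap pi_swap)
    (If (at_phase false ph2) cycle_slots
      (If (at_phase false ph3) (undo cycle_slots)
        (If (at_phase true ph0) (undo (slide pi_swap pi_swap))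
           (If (at_phase true None) (advance M B oreg) skip (at_phase true None))
         (at_phase true ph0))
       (at_phase false ph3))
     (at_phase false ph2))
   (at_phase false ph1).

Definition turn (u : reg * cell) : reg * cell :=
  let: ((t, (r, kz, md, hb, f)), c) := u in ((t, (r, kz, ~~ md, hb, f)), c).

Definition phase_step : prog :=
  Rw tc next_phase prev_phase ;; phase_action ;; Mv tc (fun r => Some (~~ md_of r)).

(** One flat loop stands for all calls: the control head moves right to call and left to return. The
    final [turn] resets the direction. *)
Definition recursion : prog :=
  Loop (at_phase false L_end) skip (at_phase true L_end) phase_step ;; Rw tc turn turn.

Section Correctness.
Variables (x : seq (symbol M)) (T S : nat) (lo : int) (c : nat -> config M).
Hypotheses (c0 : c 0%N = init1 x) (cT : halting_run c T) (lo0 : lo <= 0).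
Hypothesis x_le : (size x)%:Z <= lo + S%:Z.
Hypothesis heads : forall t, (t <= T)%N -> in_section lo S (chead (c t) ord0).
Variables (nd k : nat) (Js Jc Jp : tape cell -> Prop) (w : int -> io M) (pt : tape cell).
Hypothesis nd_le : (nd <= S)%N.
Hypothesis w_framed : io_framed lo S w.
Variable base : int.
Hypothesis Js_ok : forall y u, base <= y -> y <= base + (k * S.+1)%N%:Z -> Js (y, u).
Hypothesis Jc_ok : forall y u, 0 <= y -> y <= k.+1%:Z -> Jc (y, u).
Variables (rr : 'I_W.+1) (kz : bool).

Notation exec := (@exec 4 cell reg tp (sel (in_range lo S) Js Jc Jp)).
Notation cf t := (cfg_of (c t)).
Notation code t := (code lo S (cf t)).
Notation D0 := (dgt B lo nd 0).

Definition rg_md (md : bool) (f : slot) : reg := rest_reg M (rr, kz, md, None, f).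
Notation R md := (rg_md md slot0).

Definition with_s1 (c : cell) (f : slot) : cell :=
  let: (i, _, s2, x, d, p) := c in (i, f, s2, x, d, p).

Definition frame (u : int -> cell) (y : int) (f : int -> slot) (z : int) : cell :=
  if (y <= z) && (z < y + S.+1%:Z) then with_s1 (u z) (f (z - y + (lo - 1))) else u z.

Lemma exec_slide pi pi' md s1 s2 f s1' s2' f' u y xx ct :
  (forall z, pi (s1 z, s2 z, f z) = (s1' z, s2' z, f' z)) ->
  (forall z, pi' (s1' z, s2' z, f' z) = (s1 z, s2 z, f z)) ->
  (forall z : int, (z < lo - 1) || (lo + S%:Z <= z) -> s1' z = s1 z /\ s2' z = s2 z) ->
  base <= y -> y + S.+1%:Z <= base + (k * S.+1)%N%:Z ->
  exec (slide pi pi') (mk (R md) (lo - 1, mt w s1 s2 xx D0) (y, frame u y f) ct pt)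
    (mk (R md) (lo - 1, mt w s1' s2' xx D0) (y + S.+1%:Z, frame u y f') ct pt) (16 * S + 30).
Proof.
move=> piE piE' out y1 y2.
have fr a1 a2 : framed isL isR lo S (mt w a1 a2 xx D0) := framed_mt w_framed a1 a2 xx D0.
pose t := mt w s1 s2 xx D0; pose t' := mt w s1' s2' xx D0.
pose v := frame u y f; pose v' := frame u y f'.
pose tn (n : nat) z := if z < lo + S%:Z - n%:Z then t' z else t z.
pose vn (n : nat) z := if z < y + S.+1%:Z - n%:Z then v' z else v z.
apply: (exec_seq (s1 := mk (R md) (lo + S%:Z, t') (y + S.+1%:Z, v') ct pt) (b1 := (12 * S.+1 + 3)%N) (b2 := (4 * S + 7)%N)); [| |lia]; last first.
  by apply: exec_goL; [exact: fr|exact: first_stop_R (fr _ _)|].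
apply: (exec_loop (b1 := (12 * S.+1 + 1)%N)); last by lia.
- by rewrite /holds /at_ /scan /=; case: (fr s1 s2 (lo - 1)) => [| |->]; rewrite ?eqxx; lia.
- have -> : mt w s1 s2 xx D0 = tn S.+1.
    apply: funext => z; rewrite /tn; case: ifP => // zl; rewrite /t' /mt.
    by have [|-> ->] := out z; first by lia.
  have -> : t' = tn 0%N.
    apply: funext => z; rewrite /tn; case: ifP => // zl; rewrite /t' /t /mt.
    by have [|-> ->] := out z; first by lia.
  have -> : frame u y f = vn S.+1.
    apply: funext => z; rewrite /vn /v' /v /frame; case: ifP => // zl; case: ifP => //; lia.
  have -> : v' = vn 0%N.
    apply: funext => z; rewrite /vn /v' /v /frame; case: ifP => // zl; case: ifP => //; lia.
  suff H n : (n <= S.+1)%N -> chain (exec skip) (exec (xfer pi pi' ;; mv tm true ;; mv ts true))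
      (at_ tm (fun=> isL)) (at_ tm (fun=> isR))
      (mk (R md) (lo + S%:Z - n%:Z, tn n) (y + S.+1%:Z - n%:Z, vn n) ct pt)
      (mk (R md) (lo + S%:Z, tn 0%N) (y + S.+1%:Z, vn 0%N) ct pt) (12 * n + 1).
    have := H S.+1 (leqnn _).
    have -> : lo + S%:Z - S.+1%:Z = lo - 1 by lia.
    by have -> : y + S.+1%:Z - S.+1%:Z = y by lia.
  elim: n => [|n IH] n1.
    have -> : lo + S%:Z - 0%:Z = lo + S%:Z by lia.
    have -> : y + S.+1%:Z - 0%:Z = y + S.+1%:Z by lia.
    by apply: Chain1; apply: exec_skip; split=> //=; lia.
  pose h := lo + S%:Z - n.+1%:Z; pose g := y + S.+1%:Z - n.+1%:Z; rewrite -/h -/g.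
  have hn : h + shift true = lo + S%:Z - n%:Z by rewrite /h /shift; lia.
  have gn : g + shift true = y + S.+1%:Z - n%:Z by rewrite /g /shift; lia.
  have Jh a : in_range lo S (h, a : int -> cell) by split; rewrite /= /h; lia.
  have Jg a : Js (g, a) by apply: Js_ok; rewrite /g; lia.
  have th : tn n.+1 h = t h by rewrite /tn /h ltxx.
  have vg : vn n.+1 g = v g by rewrite /vn /g ltxx.
  have tE : tn n = upd (tn n.+1) h (t' h).
    apply: funext => z; rewrite /upd /tn; case: eqP => [->|/eqP zh].
      by have -> : h < lo + S%:Z - n%:Z by rewrite /h; lia.
    by congr (if _ then _ else _); rewrite /h in zh; lia.
  have vE : vn n = upd (vn n.+1) g (v' g).
    apply: funext => z; rewrite /upd /vn; case: eqP => [->|/eqP zg].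
      by have -> : g < y + S.+1%:Z - n%:Z by rewrite /g; lia.
    by congr (if _ then _ else _); rewrite /g in zg; lia.
  have gi : (y <= g) && (g < y + S.+1%:Z) by rewrite /g; lia.
  have gh : g - y + (lo - 1) = h by rewrite /g /h; lia.
  have v0 : v g = with_s1 (u g) (f h) by rewrite /v /frame gi gh.
  have v1 : v' g = with_s1 (u g) (f' h) by rewrite /v' /frame gi gh.
  apply: (ChainS (b1 := 1) (b2 := 9) (s1 := mk (R md) (h, tn n.+1) (g, vn n.+1) ct pt)
     (s2 := mk (R md) (h + shift true, tn n) (g + shift true, vn n) ct pt) (b3 := (12 * n + 1)%N)).
  + by apply: exec_skip.
  + rewrite /holds /at_ /scan /= th; case: (fr s1 s2 h) => [||_ ->]; rewrite /h; lia.
  + pose f1 := vn n.+1.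
    apply: (exec_seq (s1 := mk (R md) (h, tn n) (g, vn n) ct pt) (b1 := 5) (b2 := 3)) => //.
      pose f2 := upd (vn n.+1) g (with_s1 (u g) slot0).
      apply: (exec_seq (s1 := mk (rg_md md (f h)) (h, tn n.+1) (g, f2) ct pt) (b1 := 1) (b2 := 3)) => //.
        rewrite /f2; apply: exec_rw_s => //; rewrite vg v0 /with_s1; by case: (u g) => -[[[[? ?] ?] ?] ?] ?.
      apply: (exec_seq (s1 := mk (rg_md md (f' h)) (h, tn n) (g, f2) ct pt) (b1 := 1) (b2 := 1)) => //.
        rewrite tE; apply: exec_rw_m => //; rewrite ?th /t /t' /mt /= ?piE ?piE' //.
      have -> : vn n = upd f2 g (v' g) by rewrite /f2 upd_upd vE.
      by apply: exec_rw_s => //; rewrite /f2 /upd eqxx v1 /with_s1; case: (u g) => -[[[[? ?] ?] ?] ?] ?.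
    apply: (exec_seq (s1 := mk (R md) (h + shift true, tn n) (g, vn n) ct pt) (b1 := 1) (b2 := 1)) => //.
      by apply: exec_mv_m => //; split; rewrite /= hn; lia.
    by apply: exec_mv_s => //; apply: Js_ok; rewrite gn; lia.
  + rewrite hn /holds /at_ /scan /= /tn ltxx.
    by case: (fr s1 s2 (lo + S%:Z - n%:Z)) => [||->]; lia.
  + by rewrite hn gn; apply: IH; lia.
  + by lia.
- by rewrite /holds /at_ /scan /=; case: (fr s1' s2' (lo + S%:Z)) => [| |_ ->]; rewrite ?eqxx; lia.
Qed.

Lemma frame0 u y : (forall z, y <= z -> c_s1 (u z) = slot0) -> frame u y (fun=> slot0) = u.
Proof.
move=> u0; apply: funext => z; rewrite /frame; case: ifP => // /andP[yz _].
by have := u0 z yz; rewrite /with_s1; case: (u z) => -[[[[? ?] ?] ?] ?] ? /= ->.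
Qed.

Definition ctl_tape (P : int -> ctl) (z : int) : cell :=
  (ioS (blank M), slot0, slot0, slot0, None, P z).

Definition levels (z : int) : ctl :=
  if z == 0 then L_end else if (0 < z) && (z <= k%:Z) then ph0 else None.

Notation st md s1 s2 y u d P :=
  (mk (R md) (lo - 1, mt w s1 s2 (fun=> slot0) D0) (y, u) (d, ctl_tape P) pt).

Lemma exec_phase_step md md' p' s1 s2 s1' s2' y u y' u' (d : int) P b :
  next_phase (R md, ctl_tape P d) = (R md', ctl_tape (fun=> p') d) ->
  prev_phase (R md', ctl_tape (fun=> p') d) = (R md, ctl_tape P d) ->
  0 <= d -> d <= k.+1%:Z -> 0 <= d + shift (~~ md') -> d + shift (~~ md') <= k.+1%:Z ->
  exec phase_action (st md' s1 s2 y u d (upd P d p')) (st md' s1' s2' y' u' d (upd P d p')) b ->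
  exec phase_step (st md s1 s2 y u d P)
    (st md' s1' s2' y' u' (d + shift (~~ md')) (upd P d p')) (b + 4).
Proof.
move=> nE pE d1 d2 d3 d4 H.
have uE : upd (ctl_tape P) d (ctl_tape (fun=> p') d) = ctl_tape (upd P d p').
  by apply: funext => z; rewrite /ctl_tape /upd; case: eqP.
apply: (exec_seq (s1 := st md' s1 s2 y u d (upd P d p')) (b1 := 1) (b2 := b.+2)); [| |lia].
  by rewrite -uE; apply: exec_rw_c => //; apply: Jc_ok.
apply: (exec_seq H (b2 := 1)); last by lia.
by apply: exec_mvd_c => //; apply: Jc_ok.
Qed.

Lemma holds_at_phase md p md' s1 s2 y u d P :
  holds (at_phase md p) (st md' s1 s2 y u d P) = (md' == md) && (P d == p).
Proof. by []. Qed.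

Section Action.
Variables (md : bool) (s1 s2 s1' s2' : int -> slot) (y y' : int) (u u' : int -> cell).
Variables (d : int) (P : int -> ctl) (b : nat).
Notation s := (st md s1 s2 y u d P).
Notation s' := (st md s1' s2' y' u' d P).

Local Ltac other_phase p n :=
  apply: (exec_if0 (b1 := n)); rewrite ?holds_at_phase ?p //; last by lia.

Lemma action_ph1 : md = false -> P d = ph1 -> exec (slide pi_swap pi_swap) s s' b ->
  exec phase_action s s' (b + 10).
Proof.
move=> m p; rewrite m => H; apply: (exec_if1 _ H); rewrite ?holds_at_phase ?p //; lia.
Qed.

Lemma action_ph2 : md = false -> P d = ph2 -> exec cycle_slots s s' b ->
  exec phase_action s s' (b + 10).
Proof.
move=> m p; rewrite m => H; other_phase p (b + 8)%N.
apply: (exec_if1 _ H); rewrite ?holds_at_phase ?p //; lia.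
Qed.

Lemma action_ph3 : md = false -> P d = ph3 -> exec (undo cycle_slots) s s' b ->
  exec phase_action s s' (b + 10).
Proof.
move=> m p; rewrite m => H; other_phase p (b + 8)%N. other_phase p (b + 6)%N.
apply: (exec_if1 _ H); rewrite ?holds_at_phase ?p //; lia.
Qed.

Lemma action_ph0 : md = true -> P d = ph0 -> exec (undo (slide pi_swap pi_swap)) s s' b ->
  exec phase_action s s' (b + 10).
Proof.
move=> m p; rewrite m => H; other_phase p (b + 8)%N. other_phase p (b + 6)%N. other_phase p (b + 4)%N.
apply: (exec_if1 _ H); rewrite ?holds_at_phase ?p //; lia.
Qed.

Lemma action_none : md = true -> P d = None -> exec (advance M B oreg) s s' b ->
  exec phase_action s s' (b + 10).
Proof.
move=> m p; rewrite m => H; other_phase p (b + 8)%N. other_phase p (b + 6)%N. other_phase p (b + 4)%N. other_phase p (b + 2)%N.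
apply: (exec_if1 _ H); rewrite ?holds_at_phase ?p //; lia.
Qed.

Lemma action_end : md = false -> P d = L_end -> exec skip s s' b ->
  exec phase_action s s' (b + 10).
Proof.
move=> m p; rewrite m => H; other_phase p (b + 8)%N. other_phase p (b + 6)%N. other_phase p (b + 4)%N. other_phase p (b + 2)%N.
apply: (exec_if0 _ H); rewrite ?holds_at_phase ?p //; lia.
Qed.

End Action.

Lemma code_out_run t z : (t <= T)%N -> ~~ in_section lo S z -> code t z = slot0.
Proof. by move=> tT; apply: code_out; apply: heads. Qed.

Definition pass_time : nat := (32 * S + 80)%N.

Fixpoint level_time (n : nat) : nat :=
  if n is n'.+1 then (3 * level_time n' + 4 * pass_time)%N
  else (segment_time M S B nd + pass_time)%N.

Notation stretch n t := (minn (t + 2 ^ n * segment B nd) T).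
Notation toggle d f := (if d then f else fun=> slot0).
Notation iterate := (chain (exec skip) (exec phase_step) (at_phase false L_end) (at_phase true L_end)).

(** Write (a, b; f) for the two slots and the frame, 0 for empty, [t1] for the time halfway, [V] and
    [V'] for the second slot before and after. The states are (t, V; 0), pushed to (t, 0; V), called
    to (t, t1; V), rotated to (t1, V; t), called to (t1, V'; t), rotated back to (t, t1; V'), called
    to (t, 0; V'), popped to (t, V'; 0). [S1] to [S4] are the phase steps, [I1] to [I3] the
    calls. *)
Lemma exec_level n : (n <= k)%N -> forall (d : int) P u y t (v : bool),
  d = k.+1%:Z - n%:Z -> (t <= T)%N -> base <= y -> y + (n * S.+1)%N%:Z <= base + (k * S.+1)%N%:Z ->
  (forall z, d <= z -> P z = levels z) -> (forall z, y <= z -> c_s1 (u z) = slot0) ->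
  iterate (st false (code t) (toggle v (code (stretch n t))) y u d P)
    (st true (code t) (toggle (~~ v) (code (stretch n t))) y u (d - 1) P) (level_time n).
Proof.
have Jm (a : int -> cell) : in_range lo S (lo - 1, a) by split=> /=; lia.
elim: n => [|n IH] nk d P u y t v dE tT y1 y2 Pl u0.
  have Pd : P d = None.
    rewrite Pl // /levels; have -> : (d == 0) = false by lia.
    by have -> : (0 < d) && (d <= k%:Z) = false by lia.
  have PE : upd P d None = P by rewrite -Pd upd_id.
  rewrite expn0 mul1n; apply: (@chain_skip_le _ _ _ _ _ _ _ _ _ _ _ (segment_time M S B nd + 10 + 4 + 4)%N); last first.
    by rewrite /level_time /pass_time; lia.
  apply: chain_skip1; [exact: Jm|exact: Jm|by rewrite holds_at_phase| |by rewrite holds_at_phase].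
  have := @exec_phase_step false true None (code t) (toggle v (code (minn (t + segment B nd) T))) (code t)
    (toggle (~~ v) (code (minn (t + segment B nd) T))) y u y u d P (segment_time M S B nd + 10).
  rewrite PE; apply; rewrite /shift /=; try lia.
  - by rewrite /ctl_tape Pd.
  - by rewrite /ctl_tape Pd.
  apply: action_none => //.
  have := @exec_segment M detM x T S lo c c0 cT lo0 x_le heads B nd oreg Js Jc Jp w (y, u) (d, ctl_tape P) pt (rr, kz, true, None, slot0) nd_le w_framed t v tT.
  by case: v.
have nS : (n.+1 * S.+1 = n * S.+1 + S.+1)%N by rewrite mulSn addnC.
have [nk' y1' y2'] : [/\ (n <= k)%N, base <= y + S.+1%:Z & y + S.+1%:Z + (n * S.+1)%N%:Z <= base + (k * S.+1)%N%:Z].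
  by rewrite nS in y2; split; lia.
have dS : d + 1 = k.+1%:Z - n%:Z by rewrite dE; lia.
have [d0 dk] : 0 < d /\ d <= k%:Z by lia.
have Pd : P d = ph0.
  rewrite Pl // /levels; have -> : (d == 0) = false by lia.
  by rewrite d0 dk.
have PP q : upd P d q d = q by rewrite /upd eqxx.
have Pl' q z : d + 1 <= z -> upd P d q z = levels z.
  by move=> dz; rewrite /upd; case: eqP => [E|_]; [lia|apply: Pl; lia].
have u0' f z : y + S.+1%:Z <= z -> c_s1 (frame u y f z) = slot0.
  move=> yz; rewrite /frame; case: ifP => [|_]; [lia|apply: u0; lia].
pose t1 := stretch n t; pose t2 := stretch n.+1 t.
have t1T : (t1 <= T)%N by rewrite geq_minr.
(* Cutting at [T] is compatible with halving: a stretch that starts at [T] stays there. *)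
have t2E : stretch n t1 = t2.
  by rewrite /t1 /t2 expnS; lia.
have t2T : (t2 <= T)%N by rewrite geq_minr.
pose V := toggle v (code t2); pose V' := toggle (~~ v) (code t2).
have IHx q f t' v' : (t' <= T)%N ->
  iterate (st false (code t') (toggle v' (code (stretch n t'))) (y + S.+1%:Z) (frame u y f) (d + 1) (upd P d q))
   (st true (code t') (toggle (~~ v') (code (stretch n t'))) (y + S.+1%:Z) (frame u y f) d (upd P d q)) (level_time n).
  move=> tT'; have := IH nk' (d + 1) (upd P d q) (frame u y f) (y + S.+1%:Z) t' v' dS tT' y1' y2' (Pl' q) (u0' f).
  by have -> : d + 1 - 1 = d by lia.
have ys : y + S.+1%:Z <= base + (k * S.+1)%N%:Z by rewrite nS in y2; lia.
have outV z : ~~ in_section lo S z -> V z = slot0 by rewrite /V; case: (v) => //= zs; exact: code_out_run.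
have outV' z : ~~ in_section lo S z -> V' z = slot0 by rewrite /V'; case: (v) => //= zs; exact: code_out_run.
have outc t' z : (t' <= T)%N -> ~~ in_section lo S z -> code t' z = slot0 by exact: code_out_run.
have secP (z : int) : (z < lo - 1) || (lo + S%:Z <= z) -> ~~ in_section lo S z by rewrite /in_section; lia.
have uu : frame u y (fun=> slot0) = u by apply: frame0.
have Hsw W1 md : (forall z, ~~ in_section lo S z -> W1 z = slot0) ->
   exec (slide pi_swap pi_swap)
    (mk (R md) (lo - 1, mt w (code t) W1 (fun=> slot0) D0) (y, u) (d, ctl_tape (upd P d (if md then ph0 else ph1))) pt)
    (mk (R md) (lo - 1, mt w (code t) (fun=> slot0) (fun=> slot0) D0) (y + S.+1%:Z, frame u y W1) (d, ctl_tape (upd P d (if md then ph0 else ph1))) pt)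
    (16 * S + 30).
  move=> W0; rewrite -{1}uu; apply: exec_slide => // z zo; split=> //.
  by rewrite W0 //; exact: secP.
have id_slide a1 a2 f md ct : exec (slide id id)
    (mk (R md) (lo - 1, mt w a1 a2 (fun=> slot0) D0) (y, frame u y f) ct pt)
    (mk (R md) (lo - 1, mt w a1 a2 (fun=> slot0) D0) (y + S.+1%:Z, frame u y f) ct pt) (16 * S + 30).
  by apply: exec_slide.
have Hcyc W1 ct : (forall z, ~~ in_section lo S z -> W1 z = slot0) -> exec cycle_slots
    (mk (R false) (lo - 1, mt w (code t) (code t1) (fun=> slot0) D0) (y + S.+1%:Z, frame u y W1) ct pt)
    (mk (R false) (lo - 1, mt w (code t1) W1 (fun=> slot0) D0) (y + S.+1%:Z, frame u y (code t)) ct pt) (32 * S + 61).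
  move=> W0; apply: (exec_seq (exec_undo (id_slide _ _ _ _ _)) (b2 := (16 * S + 30)%N)); last by lia.
  apply: exec_slide => // z zo; split; first by rewrite !outc //; exact: secP.
  by rewrite outc ?W0 //; exact: secP.
have next q q' md md' s1 s2 s1' s2' z z' f f' b :
  next_phase (R md, ctl_tape (fun=> q) d) = (R md', ctl_tape (fun=> q') d) ->
  prev_phase (R md', ctl_tape (fun=> q') d) = (R md, ctl_tape (fun=> q) d) ->
  (md, q) <> (true, L_end) -> (md', q') <> (false, L_end) ->
  (md' == false) && (upd P d q' (d + shift (~~ md')) == L_end) = false ->
  exec phase_action (st md' s1 s2 z f d (upd P d q')) (st md' s1' s2' z' f' d (upd P d q')) b ->
  iterate (st md s1 s2 z f d (upd P d q)) (st md' s1' s2' z' f' (d + shift (~~ md')) (upd P d q')) (b + 8).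
  move=> nE pE nq nq' ne H; have -> : (b + 8 = b + 4 + 4)%N by lia.
  apply: chain_skip1; [exact: Jm|exact: Jm| | |]; last by rewrite holds_at_phase ne.
    by rewrite holds_at_phase PP; apply/negP => /andP[/eqP E1 /eqP E2]; apply: nq; rewrite E1 E2.
  rewrite -(upd_upd P d q q'); apply: exec_phase_step; rewrite ?upd_upd //; try lia.
  - by rewrite /ctl_tape PP.
  - by rewrite /ctl_tape PP.
  - by case: md' {nE pE nq' ne H}; rewrite /shift /=; lia.
  - by case: md' {nE pE nq' ne H}; rewrite /shift /=; lia.
have notL q : upd P d q (d + 1) == L_end = false.
  rewrite Pl' // /levels; have -> : (d + 1 == 0) = false by lia.
  by case: ifP.
have PE : upd P d ph0 = P by rewrite -Pd upd_id.
rewrite -{1 2}PE.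
have S1 : iterate (st false (code t) V y u d (upd P d ph0))
   (st false (code t) (fun=> slot0) (y + S.+1%:Z) (frame u y V) (d + 1) (upd P d ph1)) (16 * S + 48).
  have -> : (16 * S + 48 = 16 * S + 30 + 10 + 8)%N by lia.
  apply: (next ph0 ph1 false false) => //; first by rewrite /= notL.
  by apply: action_ph1 => //; exact: (Hsw V false outV).
have S2 : iterate (st true (code t) (code t1) (y + S.+1%:Z) (frame u y V) d (upd P d ph1))
   (st false (code t1) V (y + S.+1%:Z) (frame u y (code t)) (d + 1) (upd P d ph2)) (32 * S + 79).
  have -> : (32 * S + 79 = 32 * S + 61 + 10 + 8)%N by lia.
  apply: (next ph1 ph2 true false) => //; first by rewrite /= notL.
  by apply: action_ph2 => //; exact: Hcyc.
have S3 : iterate (st true (code t1) V' (y + S.+1%:Z) (frame u y (code t)) d (upd P d ph2))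
   (st false (code t) (code t1) (y + S.+1%:Z) (frame u y V') (d + 1) (upd P d ph3)) (32 * S + 79).
  have -> : (32 * S + 79 = 32 * S + 61 + 10 + 8)%N by lia.
  apply: (next ph2 ph3 true false) => //; first by rewrite /= notL.
  by apply: action_ph3 => //; apply: exec_undo; exact: Hcyc.
have S4 : iterate (st true (code t) (fun=> slot0) (y + S.+1%:Z) (frame u y V') d (upd P d ph3))
   (st true (code t) V' y u (d - 1) (upd P d ph0)) (16 * S + 48).
  have -> : (16 * S + 48 = 16 * S + 30 + 10 + 8)%N by lia.
  apply: (next ph3 ph0 true true) => //.
  by apply: action_ph0 => //; apply: exec_undo; exact: (Hsw V' true outV').
have I1 := IHx ph1 V t false tT.
have I2 := IHx ph2 (code t) t1 v t1T; rewrite t2E in I2.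
have I3 := IHx ph3 V' t true tT.
apply: (chain_skip_le (chain_skip_cat S1 (chain_skip_cat I1 (chain_skip_cat S2 (chain_skip_cat I2 (chain_skip_cat S3 (chain_skip_cat I3 S4))))))).
by rewrite /= /pass_time; lia.
Qed.

Lemma exec_recursion (v : bool) u : (forall z, base <= z -> c_s1 (u z) = slot0) ->
  exec recursion (st false (code 0) (toggle v (code (stretch k 0))) base u 0 levels)
    (st false (code 0) (toggle (~~ v) (code (stretch k 0))) base u 0 levels) (level_time k + pass_time).
Proof.
have Jm (a : int -> cell) : in_range lo S (lo - 1, a) by split=> /=; lia.
move=> u0; set s1 := code 0; set s2 := toggle v _; set s2' := toggle (~~ v) _.
apply: (exec_seq (s1 := st true s1 s2' base u 0 levels) (b1 := (19 + level_time k + 2)%N) (b2 := 1)); [| |by rewrite /pass_time; lia]; last first.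
  have := @exec_rw_c cell reg (in_range lo S) Js Jc Jp (R true) (R false) 0 (ctl_tape levels) (ctl_tape levels 0) (lo - 1, mt w s1 s2' (fun=> slot0) D0) (base, u) pt turn turn.
  by rewrite upd_id; apply=> //; apply: Jc_ok.
apply: (exec_loop (b1 := (19 + level_time k)%N)); [by rewrite holds_at_phase| |by rewrite holds_at_phase|by []].
(* [L_end] belongs to no phase: the opening iteration only moves the control head to square 1. *)
have S1 : iterate (st false s1 s2 base u 0 levels) (st false s1 s2 base u 1 levels) 19.
  have -> : (19 = 1 + 10 + 4 + 4)%N by [].
  apply: chain_skip1; [exact: Jm|exact: Jm|by rewrite holds_at_phase| |].
    have := @exec_phase_step false false L_end s1 s2 s1 s2 base u base u 0 levels 11.
    have lE : upd levels 0 L_end = levels by rewrite -{2}(upd_id levels 0).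
    rewrite lE add0r; apply=> //; try lia.
    by apply: (@action_end _ _ _ _ _ _ _ _ _ _ _ 1) => //; exact: exec_skip.
  by rewrite holds_at_phase /levels /=; case: ifP.
apply: (chain_skip_cat S1).
have := exec_level (leqnn k) (d := 1) (P := levels) (u := u) (y := base) (t := 0) v.
by rewrite subrr; apply=> //; lia.
Qed.

End Correctness.

(** Adding 2p turns the recurrence L' = 3L + 4p into L' + 2p = 3(L + 2p). *)
Lemma level_time_le S nd k :
  (level_time S nd k + 2 * pass_time S = 3 ^ k * (segment_time M S B nd + 3 * pass_time S))%N.
Proof.
elim: k => [|n IH] /=; first by rewrite expn0; lia.
rewrite expnS -mulnA -IH; lia.
Qed.

End Recursion.

(** Spares an induction on chains for each loop of the setup: it suffices to display the stores
    before and after the [j]-th pass through the body. *)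
Lemma exec_family (Sy Rg : finType) (J : 'I_4 -> tape Sy -> Prop) (e x : test 4 Sy Rg) p q
    (st st' : nat -> store 4 Sy Rg) n bp bq b :
  holds e (st 0%N) -> holds x (st' n) ->
  (forall j, (j <= n)%N -> exec tp J p (st j) (st' j) bp) ->
  (forall j, (j < n)%N ->
     [/\ ~~ holds x (st' j), exec tp J q (st' j) (st j.+1) bq & ~~ holds e (st j.+1)]) ->
  (n.+1 * (bp + bq + 2) + 2 <= b)%N ->
  exec tp J (Loop e p x q) (st 0%N) (st' n) b.
Proof.
move=> e0 xn Hp Hq le; exists (n.+1 * (bp + bq + 2))%N; split=> //.
suff H m j : (j + m = n)%N -> chain (exec tp J p) (exec tp J q) e x (st j) (st' n) (m.+1 * (bp + bq + 2)).
  by apply: (H n 0%N).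
elim: m j => [|m IH] j E.
  rewrite addn0 in E; rewrite -E; apply: Chain1; apply: (exec_le (Hp _ _)); first by lia.
  by rewrite mul1n; lia.
have [x1 H1 e1] : [/\ ~~ holds x (st' j), exec tp J q (st' j) (st j.+1) bq & ~~ holds e (st j.+1)].
  by apply: Hq; lia.
have jn : (j <= n)%N by lia.
apply: (ChainS (Hp _ jn) x1 H1 e1 (IH j.+1 _)); first by lia.
by rewrite [in X in (_ <= X)%N]mulSn; lia.
Qed.

Lemma exec_walk (Sy Rg : finType) (Jm Js Jc Jp : tape Sy -> Prop) (e x : test 4 Sy Rg) i d
    (st : nat -> store 4 Sy Rg) n b :
  (forall j, (j <= n)%N -> Jm (tps (st j) tm)) ->
  (forall j, (j <= n)%N -> exec tp (sel Jm Js Jc Jp) (mv i d) (st j) (st j.+1) 1) ->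
  holds e (st 0%N) -> holds x (st n.+1) ->
  (forall j, (0 < j)%N -> (j <= n)%N -> ~~ holds x (st j) /\ ~~ holds e (st j)) ->
  (4 * n + 6 <= b)%N ->
  exec tp (sel Jm Js Jc Jp) (Loop e (mv i d) x skip) (st 0%N) (st n.+1) b.
Proof.
move=> Jst H e0 xn nex le; apply: (@exec_family _ _ _ _ _ _ _ _ (fun j => st j.+1) n 1 1) => //; last by lia.
move=> j jn; have [x1 e1] := nex j.+1 isT jn; split=> //.
case: (st j.+1) (Jst _ jn) => r t /= Jt; split=> //; rewrite /set_tape /=; congr Store; apply: funext => a.
by case: eqP => // ->; case: (t tm).
Qed.

Section Holds.
Variables (Sy Rg : finType) (F : Rg -> Sy -> bool) (r : Rg) (m s c p : tape Sy).
Variables (h : int) (t : int -> Sy).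

Lemma holds_m : holds (at_ tm F) (mk r (h, t) s c p) = F r (t h). Proof. by []. Qed.
Lemma holds_s : holds (at_ ts F) (mk r m (h, t) c p) = F r (t h). Proof. by []. Qed.
Lemma holds_c : holds (at_ tc F) (mk r m s (h, t) p) = F r (t h). Proof. by []. Qed.
Lemma holds_p : holds (at_ tp F) (mk r m s c (h, t)) = F r (t h). Proof. by []. Qed.

End Holds.

(** * Reading the parameters *)

Section Setup.
Variables (M : machine 1) (detM : deterministic M) (B W : nat).

Notation slot := (slot M).
Notation slot0 := (slot0 M).
Notation cell := (cell M B).
Notation isL := (@isL M B).
Notation isR := (@isR M B).
Notation ioS := (@ioS M).
Notation ioP := (@ioP M).
Notation ioM := (@ioM M).
Notation reg := (reg M (oreg M W)).
Notation prog := (prog 4 cell reg).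

Definition io_cell (i : io M) : cell := (i, slot0, slot0, slot0, None, None).
Definition blank_cell : cell := io_cell (ioS (blank M)).
Definition par_cell (o : option bool) : cell := io_cell (ioM o).

Definition is_blank (i : 'I_4) : test 4 cell reg := at_ i (fun _ c => c == blank_cell).
Definition is_sep : test 4 cell reg := at_ tp (fun _ c => c_io c == ioM None).
Definition is_bit (d : bool) : test 4 cell reg := at_ ts (fun _ c => c_io c == ioM (Some d)).
Definition at_end : test 4 cell reg := at_ tc (fun _ c => c_ph c == L_end).
Definition beyond : test 4 cell reg := at_ tc (fun _ c => c_ph c == None).
Definition zero_flag : test 4 cell reg := at_ tc (fun r _ => let: ((_, z, _, _, _, _), _) := r in z).
Definition k_is_0 : test 4 cell reg := at_ tc (fun r _ => let: (_, (_, kz, _, _, _)) := r in kz).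

Definition par_right : prog :=
  mv tp false ;; Loop (is_blank tp) (mv tp true) (is_blank tp) skip.

Definition tog_kz (u : reg * cell) : reg * cell :=
  let: ((t, (r, kz, md, hb, f)), c) := u in
  ((t, (r, kz (+) (c_io c == ioM (Some false)), md, hb, f)), c).

(** The last parameter symbol is the leading bit of [k], which is 0 only for [k = 0]. *)
Definition test_k : prog :=
  (par_right ;; mv tp false) ;; Rw tp tog_kz tog_kz ;; undo (par_right ;; mv tp false).

Definition read_bit (u : reg * cell) : reg * cell :=
  let: ((t, (r, kz, md, hb, f)), c) := u in
  if c_io c is inr (Some d) then ((t, (r, kz, md, Some d, f)), c) else u.
Definition unread_bit (u : reg * cell) : reg * cell :=
  let: ((t, (r, kz, md, hb, f)), c) := u in ((t, (r, kz, md, None, f)), c).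
Definition write_bit (u : reg * cell) : reg * cell :=
  let: ((t, (r, kz, md, hb, f)), c) := u in
  if hb is Some d then ((t, (r, kz, md, None, f)), par_cell (Some d)) else u.
Definition unwrite_bit (u : reg * cell) : reg * cell :=
  let: ((t, (r, kz, md, hb, f)), c) := u in
  if c_io c is inr (Some d) then ((t, (r, kz, md, Some d, f)), blank_cell) else u.
Definition set_bit (d : bool) (u : reg * cell) : reg * cell := (u.1, par_cell (Some d)).
Definition set_ph (p : ctl) (u : reg * cell) : reg * cell :=
  let: (r, (i, s1, s2, x, d, _)) := u in (r, (i, s1, s2, x, d, p)).
Definition tog_zero (b : reg * cell -> bool) (u : reg * cell) : reg * cell :=
  let: (((i, z, g, e, m, h), o), c) := u in (((i, z (+) b u, g, e, m, h), o), c).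

Definition copy_k : prog :=
  Loop (is_blank tp) (mv tp false) is_sep
    (Rw tp read_bit unread_bit ;; Rw ts write_bit unwrite_bit ;; mv ts true).

Definition dec_k : prog :=
  Loop (is_blank ts) (mv ts false) (is_bit true) (Rw ts (set_bit true) (set_bit false)) ;;
  Rw ts (set_bit false) (set_bit true) ;;
  Loop (is_bit false) (mv ts true) (is_blank ts) skip.

Definition find_bit : prog := Loop (is_blank ts) (mv ts false) (tneg (is_bit false)) skip.

Definition tog_blank : reg * cell -> reg * cell := tog_zero (fun u => u.2 == blank_cell).
Definition test_zero : prog := find_bit ;; Rw ts tog_blank tog_blank ;; undo find_bit.

Definition ctl_left : prog := Loop beyond (mv tc false) at_end skip.

(** Each decrement of the binary copy lays down one [ph0]. The entry test fails later on because the
    control head has left [L_end]. The copy, now all zeros, remains below the stack until the setup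
    is undone. *)
Definition to_unary : prog :=
  Loop at_end (mv tc true ;; Rw tc (set_ph ph0) (set_ph None) ;; dec_k ;; test_zero) zero_flag skip ;;
  Rw tc (tog_zero (fun=> true)) (tog_zero (fun=> true)).

Definition io_fst (i : io M) : option (symbol M) :=
  match i with inl (inl (inl a)) => Some a | inl (inl (inr (a, _))) => Some a | _ => None end.

Definition put_start (u : reg * cell) : reg * cell :=
  let: (r, (i, s1, s2, x, d, p)) := u in (r, (i, (None, Some (start M)), s2, x, d, p)).
Definition unput_start (u : reg * cell) : reg * cell :=
  let: (r, (i, s1, s2, x, d, p)) := u in (r, (i, slot0, s2, x, d, p)).
Definition started : pred cell := fun c => (c_s1 c).2 != None.

Definition load (u : reg * cell) : reg * cell :=
  let: (r, (i, s1, s2, x, d, p)) := u in (r, (i, (io_fst i, s1.2), s2, x, d, p)).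
Definition unload (u : reg * cell) : reg * cell :=
  let: (r, (i, s1, s2, x, d, p)) := u in (r, (i, (None, s1.2), s2, x, d, p)).

Definition load_input : prog :=
  Rw tm put_start unput_start ;; undo (goR isL started) ;; sweep isL isR load unload.

Definition mark_move (r : reg) : option bool :=
  let: (_, (r, _, _, _, _)) := r in if r == ord0 then Some true else None.
Definition mark (u : reg * cell) : reg * cell :=
  let: ((t, (r, kz, md, hb, f)), (i, s1, s2, x, d, p)) := u in
  ((t, (ordS r, kz, md, hb, f)), (i, s1, s2, x, if r == ord0 then Some ord0 else d, p)).
Definition unmark (u : reg * cell) : reg * cell :=
  let: ((t, (r, kz, md, hb, f)), (i, s1, s2, x, d, p)) := u in
  ((t, (ord_pred r, kz, md, hb, f)), (i, s1, s2, x, if ord_pred r == ord0 then None else d, p)).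
Definition unmarked : pred cell := fun c => ~~ isL c && (c_dg c == None).

(** Division by [W.+1] with the remainder in the register: while the parameter head walks from
    square [k] to the end of the bits of [T], the first iteration and every [W.+1]-th after it mark
    one more digit square. *)
Definition mark_digits : prog :=
  Loop (at_ tm (fun _ => isL)) (Mv tm mark_move ;; Rw tm mark unmark) is_sep (mv tp true) ;;
  mv tm true ;; undo (goR isL unmarked).

(** The loop before the last [ctl_left] carries the parameter head along with the control head, from
    square -1 to square [k]. This subtracts [k] from the number of bits of [T] that [mark_digits]
    will scan. *)
Definition unary_k : prog :=
  par_right ;; copy_k ;; Loop is_sep (mv tp true) (is_blank tp) skip ;;
  Loop (is_blank tp) (mv tp false) (is_blank tp) skip ;;
  Rw tc (set_ph L_end) (set_ph None) ;; to_unary ;; mv tc true ;; ctl_left ;;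
  Loop at_end (mv tc true ;; mv tp true) beyond skip ;; ctl_left.

Section Correctness.
Variables (T S k : nat) (Jm Js Jc : tape cell -> Prop).

Notation word := (param_word T S k).
Definition par_tape : int -> cell := word_tape blank_cell [seq par_cell o | o <- word].
Definition Jp (u : tape cell) : Prop := -1 <= u.1 /\ u.1 <= (size word)%:Z.
Notation exec := (@exec 4 cell reg tp (sel Jm Js Jc Jp)).
Notation plen := (size word).
Definition len_k : nat := (trunc_log 2 k).+1.
Definition len_T : nat := (trunc_log 2 T).+1.


Lemma size_bits n : size (bits n) = (trunc_log 2 n).+1.
Proof. by rewrite size_map size_iota. Qed.

Lemma nth_bits n i : (i <= trunc_log 2 n)%N -> nth false (bits n) i = (digit 1 n i == 1%N).
Proof.
move=> il; rewrite (nth_map 0%N) ?size_iota // nth_iota // add0n /digit modn2.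
by case: (odd _).
Qed.

Lemma plenE : plen = (len_T + (trunc_log 2 S).+1 + len_k + 2)%N.
Proof. by rewrite /param_word size_cat /= size_cat /= !size_map !size_iota /len_T /len_k; lia. Qed.

Lemma par_tapeE (j : nat) : (j < plen)%N -> par_tape j%:Z = par_cell (nth None word j).
Proof. by move=> jl; rewrite /par_tape /word_tape (nth_map None). Qed.

Lemma par_tape_end : par_tape plen%:Z = blank_cell.
Proof. by rewrite /par_tape /word_tape nth_default // size_map. Qed.

Lemma par_tape_neg : par_tape (-1) = blank_cell.
Proof. by []. Qed.

Lemma par_neq_blank o : par_cell o == blank_cell = false.
Proof. by apply/eqP. Qed.

Lemma par_tape_blank (z : int) : 0 <= z -> z < plen%:Z -> par_tape z == blank_cell = false.
Proof.
move=> z0 z1; have -> : z = `|z|%N%:Z by lia.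
by rewrite par_tapeE ?par_neq_blank //; lia.
Qed.

Lemma par_tape_k (j : nat) : (j < len_k)%N ->
  par_tape (plen%:Z - 1 - j%:Z) = par_cell (Some (digit 1 k (len_k - 1 - j) == 1%N)).
Proof.
move=> jl; have pE := plenE.
have -> : plen%:Z - 1 - j%:Z = (plen - 1 - j)%N%:Z by lia.
rewrite par_tapeE; last by lia.
have [iT jj] : (plen - 1 - j < len_T)%N = false /\ (plen - 1 - j - len_T = ((trunc_log 2 S).+1 + (len_k - 1 - j).+1).+1)%N.
  by rewrite pE; split; lia.
have jk : (len_k - 1 - j < size (bits k))%N by rewrite size_bits -/len_k; lia.
rewrite -nth_bits; last by rewrite /len_k; lia.
rewrite /param_word nth_cat size_map size_bits -/len_T iT jj.
move: (bits S) (size_bits S) (bits k) jk => bS sS bk jk; rewrite [nth _ (_ :: _) _]/= nth_cat size_map sS.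
by rewrite ltnNge leq_addr /= addKn /= (nth_map false).
Qed.

Lemma par_tape_sep_k : c_io (par_tape (plen%:Z - 1 - len_k%:Z)) = ioM None.
Proof.
have pE := plenE.
have -> : plen%:Z - 1 - len_k%:Z = (plen - 1 - len_k)%N%:Z by lia.
rewrite par_tapeE; last by lia.
have [iT jj] : (plen - 1 - len_k < len_T)%N = false /\ (plen - 1 - len_k - len_T = (trunc_log 2 S).+2)%N.
  by rewrite pE; split; lia.
rewrite /param_word nth_cat size_map size_bits -/len_T iT jj.
move: (bits S) (size_bits S) (bits k) => bS sS bk; rewrite [nth _ (_ :: _) _]/= nth_cat size_map sS.
by rewrite ltnn subnn.
Qed.

Lemma par_tape_T (j : nat) : (j < len_T)%N -> c_io (par_tape j%:Z) != ioM None.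
Proof.
move=> jl; have pE := plenE; rewrite par_tapeE; last by lia.
rewrite /param_word nth_cat size_map size_bits -/len_T jl (nth_map false) ?size_bits //.
Qed.

Lemma par_tape_sep_T : c_io (par_tape len_T%:Z) = ioM None.
Proof.
have pE := plenE; rewrite par_tapeE; last by lia.
by rewrite /param_word nth_cat size_map size_bits -/len_T ltnn subnn.
Qed.

Notation P h := (h, par_tape).

Lemma Jp_ok y u : -1 <= y -> y <= plen%:Z -> Jp (y, u).
Proof. by []. Qed.

Lemma exec_mv_par d a a' r m s c : a' = a + shift d ->
  -1 <= a -> a <= plen%:Z -> -1 <= a' -> a' <= plen%:Z ->
  exec (mv tp d) (mk r m s c (P a)) (mk r m s c (P a')) 1.
Proof. by move=> -> *; apply: exec_mv_p; apply: Jp_ok. Qed.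

Lemma exec_par_right r m s c b : Jm m -> (4 * plen + 8 <= b)%N ->
  exec par_right (mk r m s c (P 0)) (mk r m s c (P plen%:Z)) b.
Proof.
move=> mJ le; apply: (exec_seq (s1 := mk r m s c (P (-1))) (b1 := 1) (b2 := (4 * plen + 6)%N)); [by apply: exec_mv_par| |lia].
have := @exec_walk _ _ Jm Js Jc Jp (is_blank tp) (is_blank tp) tp true
  (fun j => mk r m s c (P (j%:Z - 1))) plen (4 * plen + 6).
cbv beta; have -> : plen.+1%:Z - 1 = plen%:Z by lia.
rewrite sub0r; apply=> //.
- by move=> j jl; apply: exec_mv_par; rewrite /shift; lia.
- by rewrite holds_p par_tape_neg eqxx.
- by rewrite holds_p par_tape_end eqxx.
- by move=> j j1 j2; rewrite holds_p par_tape_blank; lia.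
Qed.

Lemma top_digit : digit 1 k (trunc_log 2 k) = (0 < k)%N.
Proof.
rewrite /digit; case: (posnP k) => [->|k0]; first by rewrite div0n.
have /andP[k1 k2] := trunc_log_bounds (isT : (1 < 2)%N) k0.
suff -> : (k %/ 2 ^ trunc_log 2 k = 1)%N by [].
apply/eqP; rewrite eqn_leq -ltnS ltn_divLR ?expn_gt0 // -expnS k2 /=.
by rewrite divn_gt0 ?expn_gt0.
Qed.

Lemma exec_test_k t r kz md hb f m s c b : Jm m -> (8 * plen + 30 <= b)%N ->
  exec test_k (mk (t, (r, kz, md, hb, f)) m s c (P 0))
    (mk (t, (r, kz (+) (k == 0%N), md, hb, f)) m s c (P 0)) b.
Proof.
move=> mJ le; have pE := plenE.
have H u : exec (par_right ;; mv tp false) (mk u m s c (P 0)) (mk u m s c (P (plen%:Z - 1))) (4 * plen + 10).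
  apply: (exec_seq (exec_par_right _ _ _ mJ (leqnn _)) (b2 := 1)); last by lia.
  by apply: exec_mv_par; rewrite /shift; lia.
apply: (exec_seq (H _) (b2 := (4 * plen + 12)%N)); last by lia.
have cE : c_io (par_tape (plen%:Z - 1)) == ioM (Some false) = (k == 0%N).
  have := @par_tape_k 0 isT; rewrite subr0 => ->.
  by rewrite subn0 /len_k /= subn1 /= top_digit; case: k.
apply: (exec_seq (b1 := 1) (b2 := (4 * plen + 10)%N) _ (exec_undo (H _))); last by lia.
by apply: exec_rw_p; [rewrite /= cE|rewrite /= cE addbK|apply: Jp_ok; lia].
Qed.

Section Unary.
Hypothesis k_gt0 : (0 < k)%N.
Hypothesis Js_ok : forall y u, -1 <= y -> y <= len_k%:Z -> Js (y, u).
Hypothesis Jc_ok : forall y u, 0 <= y -> y <= k.+1%:Z -> Jc (y, u).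
Variables (m : tape cell) (mJ : Jm m).

Definition unary_reg (z : bool) (hb : option bool) : reg :=
  ((ord0, z, false, false, false, false), (ord0, false, false, hb, slot0)).
Notation R := unary_reg.

(* The n most significant of the len_k bits of l, most significant first. *)
Definition counter (n l : nat) (z : int) : cell :=
  if (0 <= z) && (z < n%:Z) then par_cell (Some (digit 1 l (len_k - 1 - `|z|%N) == 1%N))
  else blank_cell.

Lemma exec_mv_stk d a a' u r c p : a' = a + shift d ->
  -1 <= a -> a <= len_k%:Z -> -1 <= a' -> a' <= len_k%:Z ->
  exec (mv ts d) (mk r m (a, u) c p) (mk r m (a', u) c p) 1.
Proof. by move=> -> *; apply: exec_mv_s; apply: Js_ok. Qed.

Lemma exec_mv_ctl d a a' u r s p : a' = a + shift d ->
  0 <= a -> a <= k.+1%:Z -> 0 <= a' -> a' <= k.+1%:Z ->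
  exec (mv tc d) (mk r m s (a, u) p) (mk r m s (a', u) p) 1.
Proof. by move=> -> *; apply: exec_mv_c; apply: Jc_ok. Qed.

Lemma exec_copy_k c : exec copy_k
  (mk (R false None) m (0, fun=> blank_cell) c (P plen%:Z))
  (mk (R false None) m (len_k%:Z, counter len_k k) c (P (plen%:Z - 1 - len_k%:Z))) (8 * len_k + 10).
Proof.
have pE := plenE.
have cnt0 : counter 0 k = fun=> blank_cell.
  by apply: funext => z; rewrite /counter; case: ifP => //; lia.
have := @exec_family _ _ (sel Jm Js Jc Jp) (is_blank tp) is_sep (mv tp false)
  (Rw tp read_bit unread_bit ;; Rw ts write_bit unwrite_bit ;; mv ts true)
  (fun j => mk (R false None) m (j%:Z, counter j k) c (P (plen%:Z - j%:Z)))
  (fun j => mk (R false None) m (j%:Z, counter j k) c (P (plen%:Z - 1 - j%:Z))) len_k 1 5 (8 * len_k + 10).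
rewrite cnt0 subr0; apply; last by lia.
- by rewrite holds_p par_tape_end eqxx.
- by rewrite holds_p par_tape_sep_k eqxx.
- by move=> j jl; apply: exec_mv_par; rewrite /shift; lia.
move=> j jl; split.
- by rewrite holds_p par_tape_k.
- set bit := digit 1 k (len_k - 1 - j) == 1%N.
  apply: (exec_seq (s1 := mk (R false (Some bit)) m (j%:Z, counter j k) c (P (plen%:Z - 1 - j%:Z))) (b1 := 1) (b2 := 3)) => //.
    by apply: exec_rw_p; rewrite ?par_tape_k //; apply: Jp_ok; lia.
  apply: (exec_seq (s1 := mk (R false None) m (j%:Z, counter j.+1 k) c (P (plen%:Z - 1 - j%:Z))) (b1 := 1) (b2 := 1)) => //.
    have -> : counter j.+1 k = upd (counter j k) j%:Z (par_cell (Some bit)).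
      apply: funext => z; rewrite /upd /counter; case: (z =P j%:Z) => [->|zj].
        by have -> : (0 <= j%:Z) && (j%:Z < j.+1%:Z) by lia.
      by have -> : (0 <= z) && (z < j.+1%:Z) = (0 <= z) && (z < j%:Z) by lia.
    apply: exec_rw_s; [by []| |by apply: Js_ok; lia|by apply: Js_ok; lia].
    by rewrite /= /counter; have -> : (0 <= j%:Z) && (j%:Z < j%:Z) = false by lia.
  have -> : plen%:Z - j.+1%:Z = plen%:Z - 1 - j%:Z by lia.
  by apply: exec_mv_stk; rewrite /shift; lia.
- by rewrite holds_p par_tape_blank; lia.
Qed.

Lemma counter_at l (i : nat) : (i < len_k)%N ->
  counter len_k l (len_k%:Z - 1 - i%:Z) = par_cell (Some (digit 1 l i == 1%N)).
Proof.
move=> il; rewrite /counter.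
have -> : (0 <= len_k%:Z - 1 - i%:Z) && (len_k%:Z - 1 - i%:Z < len_k%:Z) by lia.
by have -> : (len_k - 1 - `|(len_k%:Z - 1 - i%:Z)%R|)%N = i by lia.
Qed.

Lemma counter_end l : counter len_k l len_k%:Z = blank_cell.
Proof. by rewrite /counter; case: ifP => //; lia. Qed.

Lemma counter_neg l : counter len_k l (-1) = blank_cell.
Proof. by []. Qed.

Lemma k_lt : (k < 2 ^ len_k)%N.
Proof. exact: trunc_log_ltn. Qed.

Lemma digit1_neq0 l i : digit 1 l i <> 0%N -> digit 1 l i = 1%N.
Proof. by have := digit_lt 1 l i; lia. Qed.

Lemma exec_dec_k l r c p : (l < k)%N ->
  exec dec_k (mk r m (len_k%:Z, counter len_k l.+1) c p) (mk r m (len_k%:Z, counter len_k l) c p) (8 * len_k + 20).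
Proof.
move=> lk; have [|i [il /digit1_neq0 di lo]] := @lowest_digit 1 len_k l.+1 isT.
  exact: leq_ltn_trans lk k_lt.
have nz : digit 1 l.+1 i <> 0%N by rewrite di.
have [d0 d1 d2] := digit_pred lo nz.
have {d1}d1 : digit 1 l i = 0%N by lia.
(* The counter after [j] borrows. The most significant bit comes first, so the bits already changed
   are at the right end. *)
pose mid (j : nat) (z : int) := if (len_k%:Z - j%:Z <= z) && (z < len_k%:Z) then par_cell (Some true) else counter len_k l.+1 z.
have midS j : (j < len_k)%N -> mid j.+1 = upd (mid j) (len_k%:Z - 1 - j%:Z) (par_cell (Some true)).
  move=> jl; apply: funext => z; rewrite /upd /mid; case: (z =P len_k%:Z - 1 - j%:Z) => [->|zj].
    by have -> : (len_k%:Z - j.+1%:Z <= len_k%:Z - 1 - j%:Z) && (len_k%:Z - 1 - j%:Z < len_k%:Z) by lia.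
  by congr (if _ then _ else _); lia.
have mid_at j : (j < len_k)%N -> mid j (len_k%:Z - 1 - j%:Z) = par_cell (Some (digit 1 l.+1 j == 1%N)).
  by move=> jl; rewrite /mid counter_at //; case: ifP => //; lia.
have lE : counter len_k l = upd (mid i) (len_k%:Z - 1 - i%:Z) (par_cell (Some false)).
  apply: funext => z; rewrite /upd; case: (z =P len_k%:Z - 1 - i%:Z) => [->|zi]; first by rewrite counter_at // d1.
  rewrite /mid; case: ifP => [zl|zl].
    have -> : z = len_k%:Z - 1 - `|(len_k%:Z - 1 - z)%R|%:Z by lia.
    by rewrite counter_at ?d0 //; lia.
  rewrite /counter; case: ifP => // zk; rewrite d2 //; lia.
have mid0 : mid 0%N = counter len_k l.+1.
  by apply: funext => z; rewrite /mid; case: ifP => //; lia.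
apply: (exec_seq (s1 := mk r m (len_k%:Z - 1 - i%:Z, mid i) c p) (b1 := (4 * len_k + 6)%N) (b2 := (4 * len_k + 8)%N)); [| |lia].
  have := @exec_family _ _ (sel Jm Js Jc Jp) (is_blank ts) (is_bit true) (mv ts false)
    (Rw ts (set_bit true) (set_bit false)) (fun j => mk r m (len_k%:Z - j%:Z, mid j) c p)
    (fun j => mk r m (len_k%:Z - 1 - j%:Z, mid j) c p) i 1 1 (4 * len_k + 6).
  rewrite mid0 subr0; apply; last by lia.
  - by rewrite holds_s counter_end eqxx.
  - by rewrite holds_s mid_at // di.
  - by move=> j jl; apply: exec_mv_stk; rewrite /shift; lia.
  move=> j jl; have jk : (j < len_k)%N := ltn_trans jl il; split.
  - by rewrite holds_s mid_at // lo.
  - have -> : len_k%:Z - j.+1%:Z = len_k%:Z - 1 - j%:Z by lia.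
    rewrite midS //; apply: exec_rw_s; [by []| |by apply: Js_ok; lia|by apply: Js_ok; lia].
    by rewrite mid_at // lo.
  - rewrite holds_s /mid.
    have -> : (len_k%:Z - j.+1%:Z <= len_k%:Z - j.+1%:Z) && (len_k%:Z - j.+1%:Z < len_k%:Z) by lia.
    by rewrite par_neq_blank.
apply: (exec_seq (s1 := mk r m (len_k%:Z - 1 - i%:Z, counter len_k l) c p) (b1 := 1) (b2 := (4 * len_k + 6)%N)); [| |lia].
  rewrite lE; apply: exec_rw_s; [by []| |by apply: Js_ok; lia|by apply: Js_ok; lia].
  by rewrite mid_at // di.
have := @exec_walk _ _ Jm Js Jc Jp (is_bit false) (is_blank ts) ts true
  (fun j => mk r m (len_k%:Z - 1 - i%:Z + j%:Z, counter len_k l) c p) i (4 * len_k + 6).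
cbv beta; have -> : len_k%:Z - 1 - i%:Z + i.+1%:Z = len_k%:Z by lia.
rewrite addr0; apply => //; last by lia.
- by move=> j jl; apply: exec_mv_stk; rewrite /shift; lia.
- by rewrite holds_s counter_at // d1.
- by rewrite holds_s counter_end eqxx.
move=> j j1 j2; rewrite !holds_s.
have -> : len_k%:Z - 1 - i%:Z + j%:Z = len_k%:Z - 1 - (i - j)%N%:Z by lia.
by rewrite counter_at ?d0 ?par_neq_blank //; lia.
Qed.

Lemma exec_test_zero l z hb c p : (l <= k)%N ->
  exec test_zero (mk (R z hb) m (len_k%:Z, counter len_k l) c p)
    (mk (R (z (+) (l == 0%N)) hb) m (len_k%:Z, counter len_k l) c p) (8 * len_k + 20).
Proof.
move=> lk.
(* The lowest nonzero bit; for [l = 0] the witness [len_k] puts the head on the blank square -1. *)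
have [i [il end_i lo]] : exists i, [/\ (i <= len_k)%N,
    (counter len_k l (len_k%:Z - 1 - i%:Z) == blank_cell = (l == 0%N)) /\
    (c_io (counter len_k l (len_k%:Z - 1 - i%:Z)) != ioM (Some false))
    & forall j, (j < i)%N -> digit 1 l j = 0%N].
  have [->|l0] := posnP l.
    exists len_k; split=> //; last by move=> j _; rewrite digit_zero.
    have -> : len_k%:Z - 1 - len_k%:Z = -1 by lia.
    by rewrite counter_neg eqxx.
  have [|i [il /digit1_neq0 di lo]] := lowest_digit l0 (_ : (l < 2 ^ len_k)%N).
    exact: leq_ltn_trans lk k_lt.
  exists i; split=> //; first exact: ltnW.
  by rewrite counter_at // di par_neq_blank; split=> //; lia.
have H r : exec find_bit (mk r m (len_k%:Z, counter len_k l) c p)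
    (mk r m (len_k%:Z - 1 - i%:Z, counter len_k l) c p) (4 * len_k + 6).
  have := @exec_walk _ _ Jm Js Jc Jp (is_blank ts) (tneg (is_bit false)) ts false
    (fun j => mk r m (len_k%:Z - j%:Z, counter len_k l) c p) i (4 * len_k + 6).
  cbv beta; have -> : len_k%:Z - i.+1%:Z = len_k%:Z - 1 - i%:Z by lia.
  rewrite subr0; apply => //; last by lia.
  - by move=> j jl; apply: exec_mv_stk; rewrite /shift; lia.
  - by rewrite holds_s counter_end eqxx.
  - exact: end_i.2.
  move=> j j1 j2.
  have E : counter len_k l (len_k%:Z - j%:Z) = par_cell (Some false).
    have -> : len_k%:Z - j%:Z = len_k%:Z - 1 - (j - 1)%N%:Z by lia.
    by rewrite counter_at ?lo //; lia.
  change (~~ ~~ (c_io (counter len_k l (len_k%:Z - j%:Z)) == ioM (Some false)) /\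
          ~~ (counter len_k l (len_k%:Z - j%:Z) == blank_cell)).
  by rewrite E par_neq_blank /= ?eqxx.
apply: (exec_seq (H _) (b2 := (4 * len_k + 8)%N)); last by lia.
apply: (exec_seq (s1 := mk (R (z (+) (l == 0%N)) hb) m (len_k%:Z - 1 - i%:Z, counter len_k l) c p) (b1 := 1) (b2 := (4 * len_k + 6)%N)); [| |lia].
  have := @exec_rw_s _ _ Jm Js Jc Jp (R z hb) (R (z (+) (l == 0%N)) hb) (len_k%:Z - 1 - i%:Z) (counter len_k l) (counter len_k l (len_k%:Z - 1 - i%:Z)) m c p tog_blank tog_blank.
  rewrite upd_id; apply; rewrite /= ?end_i.1 ?addbK //; apply: Js_ok; lia.
exact: exec_undo.
Qed.

Notation ctls := (ctl_tape M B).

Lemma levels_next j : upd (@ctl_tape M B (levels j)) j.+1%:Z (ctl_tape M B (fun=> ph0) 0) =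
  ctl_tape M B (levels j.+1).
Proof.
apply: funext => z; rewrite /upd /ctl_tape /levels; case: (z =P j.+1%:Z) => [->|zj].
  by have -> : (0 < j.+1%:Z) && (j.+1%:Z <= j.+1%:Z) by lia.
by case: eqP => // z0; have -> : (0 < z) && (z <= j.+1%:Z) = (0 < z) && (z <= j%:Z) by lia.
Qed.
Lemma levels0 j : levels j 0 = L_end. Proof. by []. Qed.

Lemma levels_in j (z : int) : 0 < z -> z <= j%:Z -> levels j z = ph0.
Proof. by move=> z0 zj; rewrite /levels z0 zj; case: eqP => //; lia. Qed.

Lemma levels_out j : levels j j.+1%:Z = None.
Proof. by rewrite /levels; case: eqP => //; case: ifP => //; lia. Qed.

Lemma c_phE P z : c_ph (ctl_tape M B P z) = P z. Proof. by []. Qed.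

Lemma exec_to_unary p :
  exec to_unary (mk (R false None) m (len_k%:Z, counter len_k k) (0, ctls (levels 0)) p)
   (mk (R false None) m (len_k%:Z, counter len_k 0) (k%:Z, ctls (levels k)) p) (k * (16 * len_k + 80) + 5).
Proof.
apply: (exec_seq (s1 := mk (R true None) m (len_k%:Z, counter len_k 0) (k%:Z, ctls (levels k)) p)
   (b1 := (k * (16 * len_k + 80) + 2)%N) (b2 := 1)); [| |lia]; last first.
  have := @exec_rw_c _ _ Jm Js Jc Jp (R true None) (R false None) k%:Z (ctls (levels k)) (ctls (levels k) k%:Z) m (len_k%:Z, counter len_k 0) p (tog_zero (fun=> true)) (tog_zero (fun=> true)).
  by rewrite upd_id; apply=> //; apply: Jc_ok; lia.
(* [exec_family] counts the repetitions after the first pass through the body, hence [k.-1] for [k]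
   passes. *)
have kE : k.-1.+1 = k by rewrite prednK.
have := @exec_family _ _ (sel Jm Js Jc Jp) at_end zero_flag
  (mv tc true ;; Rw tc (set_ph ph0) (set_ph None) ;; dec_k ;; test_zero) skip
  (fun j => mk (R false None) m (len_k%:Z, counter len_k (k - j)) (j%:Z, ctls (levels j)) p)
  (fun j => mk (R (k - j.+1 == 0)%N None) m (len_k%:Z, counter len_k (k - j.+1)) (j.+1%:Z, ctls (levels j.+1)) p)
  k.-1 (16 * len_k + 70) 1 (k * (16 * len_k + 80) + 2).
rewrite kE subn0 subnn; apply.
- by rewrite holds_c c_phE levels0 eqxx.
- by [].
- move=> j jk; have E : (k - j = (k - j.+1).+1)%N by lia.
  apply: (exec_seq (s1 := mk (R false None) m (len_k%:Z, counter len_k (k - j)) (j.+1%:Z, ctls (levels j)) p) (b1 := 1) (b2 := (16 * len_k + 60)%N)); [| |lia].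
    by apply: exec_mv_ctl; rewrite /shift; lia.
  apply: (exec_seq (s1 := mk (R false None) m (len_k%:Z, counter len_k (k - j)) (j.+1%:Z, ctls (levels j.+1)) p) (b1 := 1) (b2 := (16 * len_k + 50)%N)); [| |lia].
    rewrite -levels_next; apply: exec_rw_c; [by []| |by apply: Jc_ok; lia|by apply: Jc_ok; lia].
    by rewrite /ctl_tape /= levels_out.
  rewrite E; apply: (exec_seq (exec_dec_k _ _ _ _)); [lia|by apply: exec_test_zero; lia|lia].
- move=> j jk; split.
  + by change (~~ (k - j.+1 == 0)%N); lia.
  + have -> : (k - j.+1 == 0)%N = false by lia.
    exact: exec_skip.
  + by rewrite holds_c c_phE levels_in //; lia.
- by rewrite leq_add2r leq_mul2l; lia.
Qed.

Lemma exec_ctl_left r s p :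
  exec ctl_left (mk r m s (k.+1%:Z, ctls (levels k)) p) (mk r m s (0, ctls (levels k)) p) (4 * k + 6).
Proof.
have := @exec_walk _ _ Jm Js Jc Jp beyond at_end tc false
  (fun j => mk r m s (k.+1%:Z - j%:Z, ctls (levels k)) p) k (4 * k + 6).
cbv beta; rewrite subrr subr0; apply=> //.
- by move=> j jk; apply: exec_mv_ctl; rewrite /shift; lia.
- by rewrite holds_c c_phE levels_out.
- by move=> j j1 j2; rewrite !holds_c c_phE levels_in //; lia.
Qed.

Lemma exec_unary_k : (k <= plen)%N ->
  exec unary_k (mk (R false None) m (0, fun=> blank_cell) (0, fun=> blank_cell) (P 0))
   (mk (R false None) m (len_k%:Z, counter len_k 0) (0, ctls (levels k)) (P k%:Z))
   (8 * plen + 12 * len_k + k * (16 * len_k + 100) + 100).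
Proof.
move=> kp; have pE := plenE.
apply: (exec_seq (exec_par_right _ _ _ mJ (leqnn _)) (b2 := (4 * plen + 12 * len_k + k * (16 * len_k + 100) + 85)%N)); last by lia.
apply: (exec_seq (exec_copy_k _) (b2 := (4 * plen + 4 * len_k + k * (16 * len_k + 100) + 72)%N)); last by lia.
apply: (exec_seq (s1 := mk (R false None) m (len_k%:Z, counter len_k k) (0, fun=> blank_cell) (P plen%:Z)) (b1 := (4 * len_k + 6)%N) (b2 := (4 * plen + k * (16 * len_k + 100) + 64)%N)); [| |lia].
  have := @exec_walk _ _ Jm Js Jc Jp is_sep (is_blank tp) tp true
    (fun j => mk (R false None) m (len_k%:Z, counter len_k k) (0, fun=> blank_cell) (P (plen%:Z - 1 - len_k%:Z + j%:Z))) len_k (4 * len_k + 6).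
  cbv beta; have -> : plen%:Z - 1 - len_k%:Z + len_k.+1%:Z = plen%:Z by lia.
  rewrite addr0; apply=> //.
  - by move=> j jl; apply: exec_mv_par; rewrite /shift; lia.
  - by rewrite holds_p par_tape_sep_k eqxx.
  - by rewrite holds_p par_tape_end eqxx.
  move=> j j1 j2; rewrite !holds_p.
  have -> : plen%:Z - 1 - len_k%:Z + j%:Z = plen%:Z - 1 - (len_k - j)%N%:Z by lia.
  by rewrite par_tape_k ?par_neq_blank //; lia.
apply: (exec_seq (s1 := mk (R false None) m (len_k%:Z, counter len_k k) (0, fun=> blank_cell) (P (-1))) (b1 := (4 * plen + 6)%N) (b2 := (k * (16 * len_k + 100) + 56)%N)); [| |lia].
  have := @exec_walk _ _ Jm Js Jc Jp (is_blank tp) (is_blank tp) tp false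
    (fun j => mk (R false None) m (len_k%:Z, counter len_k k) (0, fun=> blank_cell) (P (plen%:Z - j%:Z))) plen (4 * plen + 6).
  cbv beta; have -> : plen%:Z - plen.+1%:Z = -1 by lia.
  rewrite subr0; apply=> //.
  - by move=> j jl; apply: exec_mv_par; rewrite /shift; lia.
  - by rewrite holds_p par_tape_end eqxx.
  - by rewrite holds_p par_tape_neg eqxx.
  by move=> j j1 j2; rewrite !holds_p par_tape_blank //; lia.
apply: (exec_seq (s1 := mk (R false None) m (len_k%:Z, counter len_k k) (0, ctls (levels 0)) (P (-1))) (b1 := 1) (b2 := (k * (16 * len_k + 100) + 54)%N)); [| |lia].
  have -> : ctls (levels 0) = upd (fun=> blank_cell) 0 (ctls (fun=> L_end) 0).
    apply: funext => z; rewrite /upd /ctl_tape /levels; case: (z =P 0) => // _.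
    by case: ifP => //; lia.
  by apply: exec_rw_c => //; apply: Jc_ok.
apply: (exec_seq (exec_to_unary _) (b2 := (k * 20 + 45)%N)); last by lia.
apply: (exec_seq (s1 := mk (R false None) m (len_k%:Z, counter len_k 0) (k.+1%:Z, ctls (levels k)) (P (-1))) (b1 := 1) (b2 := (k * 20 + 42)%N)); [| |lia].
  by apply: exec_mv_ctl; rewrite /shift; lia.
apply: (exec_seq (exec_ctl_left _ _ _) (b2 := (k * 16 + 34)%N)); last by lia.
apply: (exec_seq (s1 := mk (R false None) m (len_k%:Z, counter len_k 0) (k.+1%:Z, ctls (levels k)) (P k%:Z)) (b1 := (6 * k + 8)%N) (b2 := (4 * k + 6)%N)); [| |lia].
  have := @exec_family _ _ (sel Jm Js Jc Jp) at_end beyond (mv tc true ;; mv tp true) skip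
    (fun j => mk (R false None) m (len_k%:Z, counter len_k 0) (j%:Z, ctls (levels k)) (P (j%:Z - 1)))
    (fun j => mk (R false None) m (len_k%:Z, counter len_k 0) (j.+1%:Z, ctls (levels k)) (P j%:Z)) k 3 1 (6 * k + 8).
  rewrite sub0r; apply; last by lia.
  - by [].
  - by rewrite holds_c c_phE levels_out.
  - move=> j jk; apply: (exec_seq (s1 := mk (R false None) m (len_k%:Z, counter len_k 0) (j.+1%:Z, ctls (levels k)) (P (j%:Z - 1))) (b1 := 1) (b2 := 1)) => //.
      by apply: exec_mv_ctl; rewrite /shift; lia.
    by apply: exec_mv_par; rewrite /shift; lia.
  - move=> j jk; split.
    + by rewrite holds_c c_phE levels_in //; lia.
    + have -> : j.+1%:Z - 1 = j%:Z by lia.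
      exact: exec_skip.
    + by rewrite holds_c c_phE levels_in //; lia.
exact: exec_ctl_left.
Qed.

End Unary.
End Correctness.

(** * Loading the input and marking the digit squares *)

Section MainTape.
Variables (lo : int) (S T k : nat) (Js Jc : tape cell -> Prop).
Variables (w : int -> io M) (s c : tape cell).
Hypothesis S_gt0 : (0 < S)%N.
Hypothesis w_framed : io_framed lo S w.

Notation exec := (@exec 4 cell reg tp (sel (in_range lo S) Js Jc (Jp T S k))).
Notation P h := (h, par_tape T S k).
Notation none := (fun=> None).
Notation empty := (fun=> slot0).

Lemma exec_load_input r p (t0 : int -> symbol M) :
  in_section lo S 0 ->
  (forall z : int, lo - 1 <= z -> z <= lo + S%:Z ->
     io_fst (w z) = if in_section lo S z then Some (t0 z) else None) ->
  exec load_input (mk r (0, mt w empty empty empty none) s c p)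
    (mk r (lo - 1, mt w (code lo S (start M, 0, t0)) empty empty none) s c p) (14 * S + 40).
Proof.
move=> s0 w_fst; have [lo1 lo2] := andP s0.
pose s1 (z : int) : slot := (None, if z == 0 then Some (start M) else None).
have fr a d : framed isL isR lo S (mt w a empty empty d) := framed_mt w_framed a empty empty d.
apply: (exec_seq (s1 := mk r (0, mt w s1 empty empty none) s c p) (b1 := 1) (b2 := (14 * S + 38)%N)); [| |lia].
  have -> : mt w s1 empty empty none = upd (mt (B := B) w empty empty empty none) 0 (w 0, (None, Some (start M)), slot0, slot0, None, None).
    by apply: funext => z; rewrite /upd /mt /s1; case: eqP => [->|].
  by apply: exec_rw_m => //; split=> /=; lia.
apply: (exec_seq (s1 := mk r (lo - 1, mt w s1 empty empty none) s c p) (b1 := (4 * S + 7)%N) (b2 := (10 * S + 20)%N)); [| |lia].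
  apply: exec_goL; [exact: fr| |by []].
  split; try lia; first by rewrite /started /mt /s1 /= ?eqxx.
  by move=> z z1 z2; rewrite /started /mt /s1 /=; have -> : (z == 0) = false by lia.
apply: exec_sweep; [exact: fr|exact: fr| | |by []].
  move=> z z1 z2; rewrite /load /unload /mt /s1 /code /= w_fst //; last by lia.
move=> z zo; rewrite /mt /s1 /code; case: ifP => //; rewrite /in_section; lia.
Qed.

Lemma dgt_mark n : upd (dgt B lo n 0) (lo + n%:Z) (Some ord0) = dgt B lo n.+1 0.
Proof.
have in0 : inord 0 = ord0 :> 'I_B.+1 by apply: val_inj; rewrite /= inordK.
apply: funext => z; rewrite /upd /dgt digit_zero in0; case: (z =P lo + n%:Z) => [->|zn].
  by have -> : (lo <= lo + n%:Z) && (lo + n%:Z < lo + n.+1%:Z) by lia.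
by have -> : (lo <= z) && (z < lo + n.+1%:Z) = (lo <= z) && (z < lo + n%:Z) by lia.
Qed.

Definition residue (j : nat) : 'I_W.+1 := iter j (@ordS _) ord0.

Arguments residue : simpl never.

Lemma residueE j : residue j = (j %% W.+1)%N :> nat.
Proof.
elim: j => [|j IH]; first by rewrite mod0n.
by rewrite /residue /= -/(residue j) IH -addn1 modnDml addn1.
Qed.

(** The ceiling of [j / W.+1]. *)
Definition marks (j : nat) : nat := ((j + W) %/ W.+1)%N.

Lemma marksS j : marks j.+1 = (marks j + (residue j == ord0))%N.
Proof.
have -> : (residue j == ord0) = (j %% W.+1 == 0)%N by rewrite -val_eqE /= residueE.
have -> : marks j.+1 = (j %/ W.+1 + 1)%N by rewrite /marks addSnnS divnDr // divnn.
suff -> : marks j = (j %/ W.+1 + (0 < j %% W.+1))%N by case: (j %% W.+1)%N => [|i]; lia.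
rewrite /marks {1}(divn_eq j W.+1) -addnA divnMDl //; congr addn.
have := ltn_pmod j (ltn0Sn W); case: (j %% W.+1)%N => [|i] iW; first by rewrite divn_small.
by rewrite addSnnS divnDr // divnn divn_small //; lia.
Qed.

Lemma exec_mark_digits t kz md hb f s1 s2 x :
  let n := (len_T T - k)%N in (k <= len_T T)%N -> (marks n.+1 <= S)%N ->
  exec mark_digits (mk (t, (ord0, kz, md, hb, f)) (lo - 1, mt w s1 s2 x none) s c (P k%:Z))
    (mk (t, (residue n.+1, kz, md, hb, f)) (lo - 1, mt w s1 s2 x (dgt B lo (marks n.+1) 0)) s c (P (len_T T)%:Z))
    (6 * n + 4 * S + 30).
Proof.
move=> n kT nS; have pE := plenE T S k.
have fr d : framed isL isR lo S (mt w s1 s2 x d) := framed_mt w_framed s1 s2 x d.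
pose R j : reg := (t, (residue j, kz, md, hb, f)).
pose h j := lo - 1 + (marks j)%:Z.
pose u j := mt (B := B) w s1 s2 x (dgt B lo (marks j) 0).
have marks_le j : (j <= n.+1)%N -> (marks j <= S)%N.
  by move=> jn; apply: leq_trans nS; rewrite /marks leq_div2r // leq_add2r.
have Jh j a : (j <= n.+1)%N -> in_range lo S (h j, a : int -> cell).
  by move=> /marks_le jS; split; rewrite /= /h; lia.
apply: (exec_seq (s1 := mk (R n.+1) (h n.+1, u n.+1) s c (P (len_T T)%:Z)) (b1 := (6 * n + 8)%N) (b2 := (4 * S + 10)%N)); [| |lia].
  have := @exec_family _ _ (sel (in_range lo S) Js Jc (Jp T S k)) (at_ tm (fun _ => isL)) is_sep
    (Mv tm mark_move ;; Rw tm mark unmark) (mv tp true)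
    (fun j => mk (R j) (h j, u j) s c (P (k + j)%N%:Z))
    (fun j => mk (R j.+1) (h j.+1, u j.+1) s c (P (k + j)%N%:Z)) n 3 1 (6 * n + 8).
  have -> : (k + n)%N = len_T T by rewrite /n subnKC.
  have m0 : marks 0 = 0%N by rewrite /marks divn_small.
  have d0 : dgt B lo 0 0 = none by apply: funext => z; rewrite /dgt; case: ifP => //; lia.
  have h0 : h 0%N = lo - 1 by rewrite /h m0 addr0.
  have u0 : u 0%N = mt w s1 s2 x none by rewrite /u m0 d0.
  rewrite addn0 h0 u0; apply; last by lia.
  - by rewrite holds_m; case: (fr none (lo - 1)) => [| |->]; rewrite ?eqxx //; lia.
  - by rewrite holds_p par_tape_sep_T eqxx.
  - move=> j jn; have jn' := leqW jn.
    apply: (exec_seq (s1 := mk (R j) (h j.+1, u j) s c (P (k + j)%N%:Z)) (b1 := 1) (b2 := 1)) => //.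
      case r0: (residue j == ord0).
        have -> : h j.+1 = h j + shift true by rewrite /h marksS r0 /shift; lia.
        apply: exec_mvd_m; [by rewrite /= r0|exact: Jh|].
        have -> : h j + shift true = h j.+1 by rewrite /h marksS r0 /shift; lia.
        exact: Jh.
      have -> : h j.+1 = h j by rewrite /h marksS r0 addn0.
      by apply: exec_mvd0_m; [rewrite /= r0|exact: Jh].
    have rS : ordS (residue j) = residue j.+1 by [].
    case r0: (residue j == ord0); last first.
      have uE : u j.+1 = u j by rewrite /u marksS r0 addn0.
      rewrite uE; apply: exec_rwid_m; last by exact: Jh.
        by rewrite /= r0 /u /mt rS.
      by rewrite /= /R -rS ordSK r0 /u /mt.
    have hE : h j.+1 = lo + (marks j)%:Z by rewrite /h marksS r0; lia.
    have dN : dgt B lo (marks j) 0 (h j.+1) = None by rewrite hE /dgt; case: ifP => //; lia.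
    have -> : u j.+1 = upd (u j) (h j.+1) (w (h j.+1), s1 (h j.+1), s2 (h j.+1), x (h j.+1), Some ord0, None).
      by rewrite /u upd_mt upd_id marksS r0 addn1 hE dgt_mark.
    apply: exec_rw_m; [| |exact: Jh|exact: Jh].
      by rewrite /= r0 /R rS.
    by rewrite /= -rS ordSK r0 /u /mt dN.
  move=> j jn; split.
  - by rewrite holds_p par_tape_T; lia.
  - by apply: exec_mv_par; rewrite /shift; lia.
  (* The very first iteration marks a square, so the head has left [lo - 1] for good and the entry
     test fails. *)
  - have mj : (0 < marks j.+1)%N by rewrite /marks addSnnS divn_gt0 //; lia.
    have mS := marks_le j.+1 (leqW jn).
    by rewrite holds_m; case: (fr (dgt B lo (marks j.+1) 0) (h j.+1)) => [||->]; rewrite /h; lia.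
apply: (exec_seq (s1 := mk (R n.+1) (lo + (marks n.+1)%:Z, u n.+1) s c (P (len_T T)%:Z)) (b1 := 1) (b2 := (4 * S + 7)%N)); [| |lia].
  have -> : lo + (marks n.+1)%:Z = h n.+1 + shift true by rewrite /h /shift; lia.
  by apply: exec_mv_m; [exact: Jh|split; rewrite /= /h /shift; lia].
apply: exec_goL; [exact: fr| |by []].
have cond (z : int) : lo - 1 <= z -> z <= lo + S%:Z -> unmarked (u n.+1 z) = (lo + (marks n.+1)%:Z <= z).
  move=> z1 z2; rewrite /unmarked; case: (fr (dgt B lo (marks n.+1) 0) z z1 z2) => -> _.
  by rewrite /= /dgt; case: ifP => zz; [rewrite andbF|rewrite eqxx andbT]; lia.
split; try lia; first by rewrite cond; lia.
by move=> z z1 z2; rewrite cond; lia.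
Qed.

End MainTape.
End Setup.

(** * The simulation *)

Section Simulator.
Variables (M : machine 1) (detM : deterministic M).

(* A configuration within S squares is one of at most 2 ^ (S * bits_pred), so that a
   counter with one digit in base 2 ^ bits_pred.+1 per square can count up to T. *)
Definition bits_pred : nat := (#|state M| + #|symbol M|).+1.
Definition base_pred : nat := (2 ^ bits_pred.+1).-1.

Notation slot0 := (slot0 M).
Notation cell := (cell M base_pred).
Notation isL := (@isL M base_pred).
Notation isR := (@isR M base_pred).
Notation reg := (reg M (oreg M bits_pred)).
Notation prog := (prog 4 cell reg).
Notation empty := (fun=> slot0).
Notation none := (fun=> None).

Definition setup : prog :=
  test_k M base_pred bits_pred ;; If (@k_is_0 M base_pred bits_pred) skip (unary_k M base_pred bits_pred) (@k_is_0 M base_pred bits_pred) ;;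
  load_input M base_pred bits_pred ;; mark_digits M base_pred bits_pred ;;
  If (@k_is_0 M base_pred bits_pred) (advance M base_pred (oreg M bits_pred)) (recursion M base_pred bits_pred) (@k_is_0 M base_pred bits_pred).

Definition pair_output (u : reg * cell) : reg * cell :=
  let: (r, (i, s1, s2, x, d, p)) := u in
  if i is inl (inl (inl a)) then
    if s2.1 is Some b then (r, (ioP a b, s1, s2, x, d, p)) else u
  else u.

Definition unpair_output (u : reg * cell) : reg * cell :=
  let: (r, (i, s1, s2, x, d, p)) := u in
  if i is inl (inl (inr (a, _))) then (r, (ioS a, s1, s2, x, d, p)) else u.

Definition simulator : prog :=
  setup ;; sweep isL isR pair_output unpair_output ;; undo setup.

Lemma BE : base_pred.+1 = (2 ^ bits_pred.+1)%N.
Proof. by rewrite /base_pred prednK // expn_gt0. Qed.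

Section Run.
Variables (x : seq (symbol M)) (T S k : nat) (lo : int) (c : nat -> config M).
Hypotheses (c0 : c 0%N = init1 x) (cT : halting_run c T) (lo0 : lo <= 0).
Hypothesis x_le : (size x)%:Z <= lo + S%:Z.
Hypothesis heads : forall t, (t <= T)%N -> in_section lo S (chead (c t) ord0).

Notation LT := (len_T T).

Definition n_bits : nat := (LT - k)%N.
Definition n_digits : nat := (n_bits %/ bits_pred.+1).+1.

Lemma S_gt0 : (0 < S)%N.
Proof. by have := heads (leq0n T); rewrite /in_section; lia. Qed.

Lemma T_lt : (T < 2 ^ (bits_pred * S))%N.
Proof.
apply: leq_trans (run_count detM c0 cT lo0 x_le heads) _.
have le2 a : (a <= 2 ^ a)%N by apply/ltnW/ltn_expl.
have -> : (bits_pred * S = #|state M| * S + S + #|symbol M| * S)%N by rewrite /bits_pred mulSn mulnDl; lia.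
rewrite !expnD; apply: leq_mul.
  apply: leq_mul (le2 S); apply: leq_trans (le2 _) _.
  by rewrite leq_exp2l // leq_pmulr // S_gt0.
by rewrite expnM leq_exp2r ?S_gt0.
Qed.

Hypothesis kT : (2 ^ k <= T)%N.

Lemma T_gt0 : (0 < T)%N.
Proof. by apply: leq_trans kT; rewrite expn_gt0. Qed.

Lemma T_bounds : (2 ^ LT.-1 <= T < 2 ^ LT)%N.
Proof. exact: (trunc_log_bounds (isT : 1 < 2)%N T_gt0). Qed.

Lemma k_lt_LT : (k < LT)%N.
Proof.
have /andP[_ T2] := T_bounds; rewrite -(ltn_exp2l _ _ (isT : 1 < 2)%N).
exact: leq_ltn_trans T2.
Qed.

(** A digit holds one bit more than the [bits_pred] bits per square that [T] may require; over [S]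
    squares this surplus pays for the rounding up. *)
Lemma n_digits_le : (n_digits <= S)%N.
Proof.
have /andP[T1 _] := T_bounds.
have : (LT.-1 < bits_pred * S)%N by rewrite -(ltn_exp2l _ _ (isT : 1 < 2)%N) (leq_ltn_trans T1) // T_lt.
have := S_gt0; rewrite /n_digits /n_bits ltn_divLR // => S0 h.
by rewrite mulnC mulSn; lia.
Qed.

Lemma marks_digits : marks bits_pred n_bits.+1 = n_digits.
Proof. by rewrite /marks addSnnS divnDr // divnn addn1. Qed.

Lemma segment_ge : (2 ^ n_bits <= segment base_pred n_digits)%N.
Proof.
rewrite /segment BE -expnM.
suff : (2 ^ n_bits.+1 <= 2 ^ (bits_pred.+1 * n_digits))%N.
  by rewrite expnS; have : (0 < 2 ^ n_bits)%N; [rewrite expn_gt0|lia].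
by rewrite leq_exp2l // /n_digits mulnC ltn_ceil.
Qed.

(** Rounding up the number of digits lengthens a segment by at most the constant factor
    [2 ^ bits_pred.+1], which ends up in the constant of the exponent. *)
Lemma segment_lt : (segment base_pred n_digits < 2 ^ (n_bits + bits_pred.+1))%N.
Proof.
rewrite /segment BE -expnM prednK ?expn_gt0 // leq_exp2l // /n_digits mulnS addnC leq_add2r.
by rewrite mulnC leq_trunc_div.
Qed.

Lemma segments_cover : (T <= 2 ^ k * segment base_pred n_digits)%N.
Proof.
have /andP[_ T2] := T_bounds; apply: (leq_trans (ltnW T2)).
have -> : LT = (k + n_bits)%N by rewrite /n_bits subnKC // ltnW // k_lt_LT.
by rewrite expnD leq_mul2l segment_ge orbT.
Qed.

(** For [k = 0] the space bound is exactly [S], so this tape must count as untouched. Otherwise the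
    binary copy of [k] lies below [k] frames, and -1 is the blank square that bounds the copy on the
    left. *)
Definition stack_tape_ok (u : tape cell) : Prop :=
  if k == 0%N then u.1 = 0 /\ u.2 0 = blank_cell M base_pred
  else -1 <= u.1 /\ u.1 <= (len_k k + k * S.+1)%N%:Z.

Definition ctl_tape_ok (u : tape cell) : Prop :=
  if k == 0%N then u.1 = 0 /\ u.2 0 = blank_cell M base_pred
  else 0 <= u.1 /\ u.1 <= k.+1%:Z.

Lemma stack_ok y u : (0 < k)%N -> -1 <= y -> y <= (len_k k + k * S.+1)%N%:Z -> stack_tape_ok (y, u).
Proof. by move=> k0 y1 y2; rewrite /stack_tape_ok -[k == 0%N]negbK -lt0n k0. Qed.

Lemma ctl_ok y u : (0 < k)%N -> 0 <= y -> y <= k.+1%:Z -> ctl_tape_ok (y, u).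
Proof. by move=> k0 y1 y2; rewrite /ctl_tape_ok -[k == 0%N]negbK -lt0n k0. Qed.

Notation exec := (@exec 4 cell reg tp (sel (in_range lo S) stack_tape_ok ctl_tape_ok (Jp T S k))).
Notation P h := (h, par_tape M base_pred T S k).
Notation cf t := (cfg_of (c t)).
Notation blanks := (fun=> blank_cell M base_pred).

Definition init_reg : reg := rest_reg M (ord0, false, false, None, slot0).

Definition stack_of : tape cell :=
  if k == 0%N then (0, blanks) else ((len_k k)%:Z, counter M base_pred k (len_k k) 0).
Definition ctl_of : tape cell := if k == 0%N then (0, blanks) else (0, ctl_tape M base_pred (levels k)).

Definition setup_time : nat :=
  (16 * size (param_word T S k) + 12 * len_k k + k * (16 * len_k k + 100) + 18 * S + 6 * n_bits + 300
   + (level_time M base_pred S n_digits k + pass_time S))%N.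

(** Apart from the delimiters, only the first components of [w] are fixed: [exec_simulator] applies
    this to the letters [wS] and, undone, to the pairs [wP]. *)
Lemma exec_setup (w : int -> io M) :
  io_framed lo S w ->
  (forall z : int, lo - 1 <= z -> z <= lo + S%:Z ->
     io_fst (w z) = if in_section lo S z then Some (ctape (c 0%N) ord0 z) else None) ->
  exec setup (mk init_reg (0, mt w empty empty empty none) (0, blanks) (0, blanks) (P 0))
    (mk (rest_reg M (residue bits_pred n_bits.+1, k == 0%N, false, None, slot0))
      (lo - 1, mt w (code lo S (cf 0)) (code lo S (cf T)) empty (dgt base_pred lo n_digits 0))
      stack_of ctl_of (P LT%:Z)) setup_time.
Proof.
move=> w_framed w_fst; have kLT := k_lt_LT; have S0 := S_gt0.
have pE := plenE T S k.
have s0 : in_section lo S 0 by have := heads (leq0n T); rewrite c0.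
have J0 a : in_range lo S (0, a : int -> cell) by move: s0; rewrite /in_section; split=> /=; lia.
have cf0 : cf 0 = (start M, 0, ctape (c 0%N) ord0) by rewrite /cfg_of c0.
pose R rr : reg := rest_reg M (rr, k == 0%N, false, None, slot0).
have H1 := @exec_test_k M base_pred bits_pred T S k (in_range lo S) stack_tape_ok ctl_tape_ok
  (ord0, false, false, false, false, false) ord0 false false None slot0
  (0, mt w empty empty empty none) (0, blanks) (0, blanks) _ (J0 _) (leqnn _).
apply: (exec_seq H1 (b2 := (setup_time - 8 * size (param_word T S k) - 40)%N)); last by rewrite /setup_time; lia.
have kP : (k <= size (param_word T S k))%N by lia.
have H2 : exec (If (@k_is_0 M base_pred bits_pred) skip (unary_k M base_pred bits_pred) (@k_is_0 M base_pred bits_pred))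
    (mk (R ord0) (0, mt w empty empty empty none) (0, blanks) (0, blanks) (P 0))
    (mk (R ord0) (0, mt w empty empty empty none) stack_of ctl_of (P k%:Z))
    (8 * size (param_word T S k) + 12 * len_k k + k * (16 * len_k k + 100) + 103).
  rewrite /R /stack_of /ctl_of; case: (posnP k) => [k0|k_gt0].
    apply: (exec_if1 (b1 := 1)); [by []| |by []|lia].
    have -> : k%:Z = 0 by rewrite k0.
    exact: exec_skip.
  apply: (exec_if0 (b1 := (8 * size (param_word T S k) + 12 * len_k k + k * (16 * len_k k + 100) + 100)%N)); [by []| |by []|lia].
  apply: exec_unary_k => //.
  - by move=> y u y1 y2; apply: stack_ok => //; lia.
  - by move=> y u y1 y2; apply: ctl_ok.
apply: (exec_seq H2 (b2 := (18 * S + 6 * n_bits + 110 + (level_time M base_pred S n_digits k + pass_time S))%N)); last first.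
  by rewrite /setup_time; lia.
apply: (exec_seq (s1 := mk (R ord0) (lo - 1, mt w (code lo S (cf 0)) empty empty none) stack_of ctl_of (P k%:Z)) (b1 := (14 * S + 40)%N)
   (b2 := (4 * S + 6 * n_bits + 60 + (level_time M base_pred S n_digits k + pass_time S))%N)); [| |lia].
  by rewrite cf0; apply: exec_load_input.
apply: (exec_seq (s1 := mk (R (residue bits_pred n_bits.+1)) (lo - 1, mt w (code lo S (cf 0)) empty empty (dgt base_pred lo n_digits 0)) stack_of ctl_of (P LT%:Z)) (b1 := (6 * n_bits + 4 * S + 30)%N)
   (b2 := (20 + (level_time M base_pred S n_digits k + pass_time S))%N)); [| |lia].
  rewrite -marks_digits; apply: exec_mark_digits => //; first exact: ltnW.
  by rewrite marks_digits n_digits_le.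
have tE : minn (0 + 2 ^ k * segment base_pred n_digits) T = T.
  by apply/minn_idPr; rewrite add0n segments_cover.
rewrite /R /stack_of /ctl_of; case: (posnP k) => [k0|k_gt0].
  apply: (exec_if1 (b1 := segment_time M S base_pred n_digits)); [by []| |by []|].
    have := @exec_segment M detM x T S lo c c0 cT lo0 x_le heads base_pred n_digits (oreg M bits_pred) stack_tape_ok ctl_tape_ok
      (Jp T S k) w (0, blanks) (0, blanks) (P LT%:Z) (residue bits_pred n_bits.+1, true, false, None, slot0)
      n_digits_le w_framed 0 false (leq0n T).
    by rewrite /= (_ : minn (0 + segment base_pred n_digits) T = T) // -[RHS]tE k0 expn0 mul1n.
  have -> : level_time M base_pred S n_digits k = (segment_time M S base_pred n_digits + pass_time S)%N by rewrite k0.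
  lia.
have kn : (k == 0%N) = false by lia.
apply: (exec_if0 (b1 := (level_time M base_pred S n_digits k + pass_time S)%N)); [by []| |by []|by lia].
have := @exec_recursion M detM base_pred bits_pred x T S lo c c0 cT lo0 x_le heads n_digits k stack_tape_ok ctl_tape_ok (Jp T S k) w
   (P LT%:Z) n_digits_le w_framed (len_k k)%:Z.
move=> /(_ _ _ (residue bits_pred n_bits.+1) false false (counter M base_pred k (len_k k) 0)); rewrite tE; apply.
- by move=> y u y1 y2; apply: stack_ok => //; lia.
- by move=> y u y1 y2; apply: ctl_ok.
- move=> z z1; rewrite /counter; case: ifP => //; lia.
Qed.

Lemma exec_simulator (wS wP : int -> io M) :
  (forall z, wS z = if z == lo - 1 then ioE M false else if z == lo + S%:Z then ioE M true
     else ioS (if in_section lo S z then ctape (c 0%N) ord0 z else blank M)) ->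
  (forall z, wP z = if in_section lo S z then ioP (ctape (c 0%N) ord0 z) (ctape (c T) ord0 z) else wS z) ->
  exec simulator (mk init_reg (0, mt wS empty empty empty none) (0, blanks) (0, blanks) (P 0))
    (mk init_reg (0, mt wP empty empty empty none) (0, blanks) (0, blanks) (P 0))
    (2 * setup_time + 10 * S + 30).
Proof.
move=> wSE wPE.
have frS (z : int) : lo - 1 <= z -> z <= lo + S%:Z ->
    (wS z == ioE M false) = (z == lo - 1) /\ (wS z == ioE M true) = (z == lo + S%:Z).
  move=> z1 z2; rewrite wSE; case: (z =P lo - 1) => [->|zl].
    by have -> : (lo - 1 == lo + S%:Z) = false by lia.
  by case: (z =P lo + S%:Z).
have secE (z : int) : in_section lo S z -> (z == lo - 1) = false /\ (z == lo + S%:Z) = false.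
  by rewrite /in_section; lia.
have nsec (z : int) : lo - 1 <= z -> z <= lo + S%:Z -> ~~ in_section lo S z -> z = lo - 1 \/ z = lo + S%:Z.
  by rewrite /in_section; lia.
have frP (z : int) : lo - 1 <= z -> z <= lo + S%:Z ->
    (wP z == ioE M false) = (z == lo - 1) /\ (wP z == ioE M true) = (z == lo + S%:Z).
  move=> z1 z2; rewrite wPE; case: ifP => sz; last exact: frS.
  by have [-> ->] := secE _ sz.
have HS := exec_setup frS; have HP := exec_setup frP.
apply: (exec_seq (HS _) (b2 := (setup_time + 10 * S + 25)%N)); last by lia.
  move=> z z1 z2; rewrite wSE; case: (boolP (in_section lo S z)) => [/secE[-> ->] //|/(nsec _ z1 z2)[] ->].
    by rewrite eqxx.
  by rewrite eqxx; have -> : (lo + S%:Z == lo - 1) = false by lia.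
apply: (exec_seq (b1 := (10 * S + 20)%N) (b2 := setup_time) _ (exec_undo (HP _))); last by lia.
  apply: exec_sweep; [exact: framed_mt|exact: framed_mt| | |by []].
    move=> z z1 z2; rewrite /pair_output /unpair_output /mt wPE wSE /code /=.
    case: (boolP (in_section lo S z)) => sz; first by have [-> ->] := secE _ sz.
    case: (nsec _ z1 (ltW z2) sz) => ->; rewrite ?eqxx //.
    by have -> : (lo + S%:Z == lo - 1) = false by lia.
  by move=> z zo; rewrite /mt wPE; case: ifP => //; rewrite /in_section; lia.
move=> z z1 z2; rewrite wPE wSE; case: (boolP (in_section lo S z)) => [//|/(nsec _ z1 z2)[] ->].
  by rewrite eqxx.
by rewrite eqxx; have -> : (lo + S%:Z == lo - 1) = false by lia.
Qed.


(** * Time and space bounds *)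

Notation depth := (2 ^ (n_bits + bits_pred.+1))%N.
Notation growth := (2 ^ ((nrules M + 4) * depth))%N.

Lemma segment_time_le : (segment_time M S base_pred n_digits <= 2002 * (growth * S))%N.
Proof.
have S0 := S_gt0; have sd := segment_lt.
have E0 : (0 < (nrules M + 3) ^ depth)%N by rewrite expn_gt0 addn3.
have sb : (subtree_bound M (segment base_pred n_digits) <= (nrules M + 3) ^ depth)%N.
  by rewrite /subtree_bound leq_exp2l // addn3.
(* By [depth <= 2 ^ depth] the product is at most [(2 * (nrules M + 3)) ^ depth], and
   [2 * (r + 3) <= 2 ^ (r + 4)]. *)
have g : (depth * (nrules M + 3) ^ depth <= growth)%N.
  apply: (@leq_trans (2 ^ depth * (nrules M + 3) ^ depth)); first by rewrite leq_mul2r ltnW ?orbT // ltn_expl.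
  rewrite -expnMn expnM leq_exp2r ?expn_gt0 //.
  rewrite -{1}(expn1 2) addn4 addn3 expnS leq_mul2l; apply/orP; right.
  apply/ltnW/(ltn_expl _ (isT : 1 < 2)%N).
have d0 : (0 < depth)%N by rewrite expn_gt0.
have q : ((segment base_pred n_digits).+1 * (subtree_bound M (segment base_pred n_digits)).+1 <= depth * ((nrules M + 3) ^ depth).+1)%N.
  exact: leq_mul.
have q2 : (((segment base_pred n_digits).+1 * (subtree_bound M (segment base_pred n_digits)).+1).+1 <= 3 * growth)%N.
  apply: (@leq_trans (depth * ((nrules M + 3) ^ depth).+1).+1); first exact: q.
  rewrite mulnS.
  have : (depth <= depth * (nrules M + 3) ^ depth)%N by rewrite leq_pmulr.
  by move: g d0; move: (depth * _)%N => e; lia.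
rewrite /segment_time.
(* With [S] positive, 624 = 164 + 460 and 130 = 30 + 100; then 3 * 624 + 130 = 2002. *)
apply: (@leq_trans (3 * growth * (624 * S) + 130 * S)).
  by apply: leq_add; [apply: leq_mul => //; lia|lia].
have : (S <= growth * S)%N by rewrite leq_pmull // expn_gt0.
have -> : (3 * growth * (624 * S) = 1872 * (growth * S))%N by rewrite mulnACA.
by lia.
Qed.

Lemma trunc_log_lt n : (0 < n)%N -> (trunc_log 2 n < n)%N.
Proof. by move=> n0; apply: (leq_trans (ltn_expl _ (isT : 1 < 2)%N)); exact: trunc_logP. Qed.

Lemma run_time_le : (2 * setup_time + 10 * S + 30 <= 2 ^ 13 * (3 ^ k * growth * S))%N.
Proof.
have S0 := S_gt0; set Z := (3 ^ k * growth * S)%N.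
have g0 : (0 < growth)%N by rewrite expn_gt0.
have k3 : (0 < 3 ^ k)%N by rewrite expn_gt0.
have ZS : (S <= Z)%N by rewrite leq_pmull // muln_gt0 k3.
have Zk : (3 ^ k <= Z)%N by rewrite /Z -mulnA leq_pmulr // muln_gt0 g0.
have Zg : (growth <= Z)%N by rewrite /Z (mulnC (3 ^ k)%N) -mulnA leq_pmulr // muln_gt0 k3.
(* The cost of making [k] unary, of the order of [k * len_k k], is absorbed by [3 ^ k]. *)
have kk : (k * k.+1 <= 3 ^ k)%N.
  elim: (k) => [|j IH] //; rewrite expnS; case: j IH => [|[|j]] // IH.
  by apply: (@leq_trans (3 * (j.+2 * j.+3))); [nia|rewrite leq_mul2l].
have k1 : (k.+1 <= 3 ^ k)%N by exact: ltn_expl.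
have lk : (len_k k <= k.+1)%N.
  by rewrite /len_k; case: (posnP k) => [->|k0] //; have := trunc_log_lt k0; lia.
have klk : (k * len_k k <= 3 ^ k)%N by apply: leq_trans kk; rewrite leq_mul2l lk orbT.
have nZ : (n_bits <= Z)%N.
  apply: leq_trans Zg; apply: (@leq_trans depth).
    by apply/ltnW; apply: (leq_trans (ltn_expl _ (isT : 1 < 2)%N)); rewrite leq_exp2l // leq_addr.
  apply/ltnW; apply: (leq_trans (ltn_expl _ (isT : 1 < 2)%N)).
  by rewrite leq_exp2l // leq_pmull // addn4.
have lS := trunc_log_lt S0.
have LTE : LT = (n_bits + k)%N by have := k_lt_LT; rewrite /n_bits; lia.
have pl := plenE T S k.
have lvl := level_time_le M base_pred S n_digits k.
have st := segment_time_le.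
(* Here 2338 = 2002 + 3 * 112, as [pass_time S] is at most [112 * S]. *)
have big : (3 ^ k * (segment_time M S base_pred n_digits + 3 * pass_time S) <= 2338 * Z)%N.
  have -> : (2338 * Z = 3 ^ k * (2338 * (growth * S)))%N by rewrite /Z -mulnA mulnCA.
  rewrite leq_mul2l; apply/orP; right; rewrite /pass_time.
  have : (S <= growth * S)%N by rewrite leq_pmull.
  by lia.
have kE : (k * (16 * len_k k + 100) = 16 * (k * len_k k) + 100 * k)%N by rewrite mulnDr mulnCA (mulnC k 100).
rewrite /setup_time pl LTE kE.
have -> : (2 ^ 13 * Z = 4 * (2048 * Z))%N by rewrite mulnA.
rewrite -lvl in big; clear lvl st kk g0 k3 pl kT; clearbody Z.
move: klk big k1 lk nZ lS Zk Zg ZS.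
move: (3 ^ k)%N growth (k * len_k k)%N (level_time _ _ _ _ _) (pass_time _) (trunc_log 2 S) => *; lia.
Qed.

(** Since [2 ^ LT.-1 <= T], the depth of the trees is of order [T / 2 ^ k], with a constant that
    depends only on [M]. *)
Lemma depth_le : (depth * 2 ^ k <= 2 ^ bits_pred.+2 * T)%N.
Proof.
have /andP[T1 _] := T_bounds; have kLT := k_lt_LT.
have -> : (depth * 2 ^ k = 2 ^ bits_pred.+2 * 2 ^ LT.-1)%N.
  by rewrite -!expnD; congr (2 ^ _)%N; rewrite /n_bits; lia.
by rewrite leq_mul2l T1 orbT.
Qed.

Definition machine_of : machine 4 := @compile 4 cell reg tp (blank_cell M base_pred) init_reg simulator.

(** For [k > 0] the binary copy of [k], the control squares and the margins are absorbed in
    multiples of [k * S]. For [k = 0] there is no slack, and both auxiliary tapes are shown to be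
    untouched. *)
Lemma squares_le (d : nat -> config machine_of) T' :
  (forall j i, (j <= T')%N ->
     sel (in_range lo S) stack_tape_ok ctl_tape_ok (Jp T S k) i (chead (d j) i, ctape (d j) i)) ->
  (size (@squares_used 2 machine_of lo S d T') <= S + 9 * (k * S))%N.
Proof.
move=> Jd; have S0 := S_gt0.
pose aux : seq ('I_4 * int) := if k == 0%N then [::] else
  [seq (ts, -1 + j%:Z) | j <- iota 0 (len_k k + k * S.+1 + 2)] ++ [seq (tc, j%:Z) | j <- iota 0 k.+2].
pose all : seq ('I_4 * int) := [seq (tm, lo + j%:Z) | j <- iota 0 S] ++ aux.
have aux_le : (size all <= S + 9 * (k * S))%N.
  rewrite /all /aux size_cat size_map size_iota leq_add2l; case: (posnP k) => [_|k0] //.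
  rewrite size_cat !size_map !size_iota mulnS.
  have lk : (len_k k <= k)%N by rewrite /len_k; exact: trunc_log_lt.
  have : (k <= k * S)%N by rewrite leq_pmulr.
  by lia.
apply: leq_trans aux_le; apply: uniq_leq_size; first exact: undup_uniq.
move=> u; rewrite mem_undup mem_cat => /orP[u1|]; first by rewrite mem_cat u1.
rewrite mem_filter => /andP[/and3P[up ut um] /allpairsP[[i t] [_ ti uE]]].
subst u; rewrite /= in up ut um *.
have {}ti : (t <= T')%N by move: ti; rewrite mem_iota.
have Jt j : (j <= T')%N -> _ := fun jT => Jd j i jT.
have unused : k = 0%N -> (forall j, (j <= T')%N -> chead (d j) i = 0 /\ ctape (d j) i 0 = blank_cell M base_pred) -> False.
  move=> _ H; move: ut; rewrite /touched => /hasP[j]; rewrite mem_iota => /andP[_ jT].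
  have [h0 _] := H 0%N (leq0n _); have [hj tj] := H j jT.
  by rewrite h0 hj tj !eqxx.
rewrite mem_cat; case: i Jt unused up um {ut} => [[|[|[|[|//]]]] hi] Jt unused up um.
- have im : Ordinal hi = tm by apply: val_inj.
  have := Jt t ti; rewrite /sel /= => -[h1 h2]; move: um; rewrite im /= /delimiter negb_or => /andP[/eqP n1 /eqP n2].
  apply/orP; left; apply/mapP; exists `|(chead (d t) tm - lo)%R|%N.
    by rewrite mem_iota; rewrite im /= in h1 h2; lia.
  by rewrite im in h1 h2 *; congr pair; rewrite /= in h1 h2 *; lia.
- have im : Ordinal hi = ts by apply: val_inj.
  rewrite im in Jt unused *; apply/orP; right; rewrite /aux.
  case: (posnP k) => k0.
    by case: unused => // j jT; have := Jt j jT; rewrite /sel /= /stack_tape_ok k0 eqxx => -[].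
  rewrite mem_cat; apply/orP; left; apply/mapP.
  have [h1 h2] : -1 <= chead (d t) ts /\ chead (d t) ts <= (len_k k + k * S.+1)%N%:Z.
    by have := Jt t ti; rewrite /sel /= /stack_tape_ok -[k == 0%N]negbK -lt0n k0.
  exists `|(chead (d t) ts + 1)%R|%N.
    by rewrite mem_iota; lia.
  by congr pair; lia.
- have im : Ordinal hi = tc by apply: val_inj.
  rewrite im in Jt unused *; apply/orP; right; rewrite /aux.
  case: (posnP k) => k0.
    by case: unused => // j jT; have := Jt j jT; rewrite /sel /= /ctl_tape_ok k0 eqxx => -[].
  rewrite mem_cat; apply/orP; right; apply/mapP.
  have [h1 h2] : 0 <= chead (d t) tc /\ chead (d t) tc <= k.+1%:Z.
    by have := Jt t ti; rewrite /sel /= /ctl_tape_ok -[k == 0%N]negbK -lt0n k0.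
  exists `|(chead (d t) tc)%R|%N.
    by rewrite mem_iota; lia.
  by congr pair; lia.
by case/negP: up; apply/eqP/val_inj.
Qed.

End Run.
End Simulator.
Definition encode (M : machine 1) (i : io_symbol (symbol M)) : cell M (base_pred M) :=
  match i with
  | Single a => @io_cell M (base_pred M) (ioS a)
  | Pair a b => @io_cell M (base_pred M) (ioP a b)
  | EndMark d => @io_cell M (base_pred M) (ioE M d)
  | Param o => @par_cell M (base_pred M) o
  end.

Lemma log2_expn (R : realType) (k T : nat) : (0 < T)%N -> k%:R <= log2 (T%:R : R) -> (2 ^ k <= T)%N.
Proof.
move=> T0; have T0' : 0 < T%:R :> R by rewrite ltr0n.
rewrite /log2 ler_pdivlMr ?ln_gt0 ?ltr1n // mulr_natl -lnXn // ler_ln ?posrE ?exprn_gt0 //.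
by rewrite -natrX ler_nat.
Qed.

(* The exponent 13 + a m of the running time is at most (13 + a b) x because
   m <= b x and 1 <= x. *)
Lemma exponent_bound (R : realType) (a b m k T S n : nat) :
  (2 ^ k <= T)%N -> (m * 2 ^ k <= b * T)%N -> (n <= 2 ^ 13 * (3 ^ k * 2 ^ (a * m) * S))%N ->
  n%:R <= 3 ^+ k * powR 2 ((13 + a * b)%N%:R * (T%:R / 2 ^+ k)) * S%:R :> R.
Proof.
move=> kT mT nle; have k0 : 0 < 2 ^+ k :> R by rewrite exprn_gt0.
pose e := (13 + a * m)%N.
have en : (n <= 3 ^ k * 2 ^ e * S)%N.
  by apply: (leq_trans nle); rewrite /e expnD (mulnCA (3 ^ k)%N) !mulnA.
have x1 : 1 <= T%:R / 2 ^+ k :> R by rewrite ler_pdivlMr // mul1r -natrX ler_nat.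
have mx : m%:R <= b%:R * (T%:R / 2 ^+ k) :> R.
  by rewrite mulrA ler_pdivlMr // -natrX -!natrM ler_nat.
have ex : e%:R <= (13 + a * b)%N%:R * (T%:R / 2 ^+ k) :> R.
  rewrite /e !natrD !natrM mulrDl -mulrA; apply: lerD; first by rewrite ler_peMr.
  exact: ler_wpM2l.
clearbody e; apply: (@le_trans _ _ (3 ^ k * 2 ^ e * S)%N%:R); first by rewrite ler_nat.
rewrite !natrM !natrX; apply: ler_wpM2r; first exact: ler0n.
apply: ler_wpM2l; first exact: exprn_ge0.
rewrite -powR_mulrn ?ler0n //; apply: (ler_powR _ ex).
by rewrite ler1n.
Qed.

Theorem theorem1 (R : realType) (M : machine 1) (detM : deterministic M) :
  exists (m : nat) (N : machine m.+2) (enc : io_symbol (symbol M) -> symbol N)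
         (ct cs : R),
    [/\ reversible N,
        read_only N (param_tape m),
        injective enc,
        enc (Single (blank M)) = blank N
      & forall (x : seq (symbol M)) (T S k : nat) (lo : int)
               (c : nat -> config M),
          (* the computation of M on x, in time T and in a section of S squares *)
          c 0%N = init1 x ->
          halting_run c T ->
          lo <= 0 -> (size x)%:Z <= lo + S%:Z ->
          (forall t, (t <= T)%N -> in_section lo S (chead (c t) ord0)) ->
          (0 < T)%N ->
          k%:R <= log2 (T%:R : R) ->
          exists (T' : nat) (d : nat -> config N),
            [/\ d 0%N = init_sim enc lo T S k
                          (fun z => Single (ctape (c 0%N) ord0 z)),
                halting_run d T',
                forall i z, ctape (d T') i z =
                  layout enc lo T S k
                    (fun z => Pair (ctape (c 0%N) ord0 z) (ctape (c T) ord0 z)) i z,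
                (* the parameter head stays next to the parameters *)
                forall t, (t <= T')%N ->
                  -1 <= chead (d t) (param_tape m) <= (size (param_word T S k))%:Z
              & T'%:R <= 3 ^+ k * powR 2 (ct * (T%:R / 2 ^+ k)) * S%:R /\
                (size (squares_used lo S d T'))%:R <= S%:R * (1 + cs * k%:R)]].
Proof.
exists 2%N, (machine_of M), (@encode M : io_symbol (symbol M) -> symbol (machine_of M)).
(* 13 accounts for the factor [2 ^ 13] of [run_time_le]; the other term is the rate [nrules M + 4]
   of the growth times the constant of [depth_le]. The 9 comes from [squares_le]. *)
exists (13 + (nrules M + 4) * 2 ^ (bits_pred M).+2)%N%:R, 9%:R.
split; [exact: compile_reversible|exact: compile_read_only| |by []|].
  by case=> [a|a b|d|o] [a'|a' b'|d'|o'] //= [] *; congruence.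
move=> x T S k lo c c0 cT lo0 x_le heads T0 /(log2_expn T0) kT.
pose wS (z : int) := if z == lo - 1 then ioE M false else if z == lo + S%:Z then ioE M true
     else ioS (if in_section lo S z then ctape (c 0%N) ord0 z else blank M).
pose wP (z : int) := if in_section lo S z then ioP (ctape (c 0%N) ord0 z) (ctape (c T) ord0 z) else wS z.
have H := exec_simulator detM c0 cT lo0 x_le heads kT (wS := wS) (wP := wP) (fun=> erefl) (fun=> erefl).
set s0 := mk _ _ _ _ _ in H; set s1 := mk _ _ _ _ _ in H.
have Js i : sel (in_range lo S) (@stack_tape_ok M S k) (@ctl_tape_ok M k) (@Jp M (base_pred M) T S k) i (tps s0 i).
  case: i => [[|[|[|[|//]]]] hi]; rewrite /sel /=.
  - by split; rewrite /=; lia.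
  - by rewrite /stack_tape_ok; case: ifP => //= _; split; lia.
  - by rewrite /ctl_tape_ok; case: ifP => //= _; split; lia.
  - by split=> /=; lia.
have [T' [d [Tle d0 dT hr Jd]]] := exec_compile (blank_cell M (base_pred M)) (erefl : rg s0 = init_reg M) Js H.
have sec_end (z : int) : in_section lo S z -> (z == lo - 1) = false /\ (z == lo + S%:Z) = false.
  by rewrite /in_section; lia.
exists T', d; split=> //.
- rewrite d0 /conf /init_sim; congr (@Config 4 (machine_of M)); apply: funext.
    by case=> [[|[|[|[|//]]]] hi].
  case=> [[|[|[|[|//]]]] hi]; apply: funext => z; rewrite /layout /=.
  + rewrite /mt /wS; case: (z == lo - 1) => //; case: (z == lo + S%:Z) => //.
    by case: (in_section lo S z).
  + by [].
  + by [].
  + by [].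
- move=> i z; rewrite dT /layout; case: i => [[|[|[|[|//]]]] hi] //=.
  rewrite /mt /wP /wS; case: (boolP (in_section lo S z)) => [/sec_end[-> ->] //|_].
  by case: (z == lo - 1) => //; case: (z == lo + S%:Z).
- by move=> t tT; have := Jd t tp tT; rewrite /sel /= => -[-> ->].
split.
  apply: (exponent_bound R (a := nrules M + 4) (S := S) kT (depth_le lo0 x_le kT)).
  exact: leq_trans Tle (run_time_le lo0 x_le heads kT).
rewrite -natrM -(natrD _ 1) -natrM ler_nat.
apply: leq_trans (squares_le lo0 x_le heads kT Jd) _.
by rewrite mulnDr muln1 leq_add2l mulnA mulnC.
Qed.
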